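(* Let $M\ge 1$ be an integer, let $\mathbf{M}=\{1,\dots,M\}$, and let $(N^m)_{m\in\mathbf{M}}$ be a stationary linear Hawkes process with base rates $(\mu_m)_{m\in\mathbf{M}}\subset\mathbb{R}_+$ and measurable interaction functions $h^m_{m'}:\mathbb{R}_+\to\mathbb{R}_+$, and let $\mathbf{H}=(\|h^m_{m'}\|_1)_{m',m\in\mathbf{M}}$. Let $0<r<1$ and $0\le K<\infty$ be such that $\|\mathbf{H}^n\|_{\infty,\mathrm{op}}\le K r^n$ for all integers $n\ge 1$, and set $$C_{r,K}=1+\frac{2K}{1-r},\qquad \xi_{r,K}=\frac{1}{C_{r,K}}\log\left(\frac{1+r}{2r}\right).$$ Let $f:\mathbb{R}\to[0,\infty)$ be a (measurable) function, let $T>0$, and define $$N(f)=\sum_{m\in\mathbf{M}}\sum_{x\in N^m}f(x),\qquad |f|^{\infty}_{1,T}=\sup_{t\in\mathbb{R}}\sum_{n\in\mathbb{Z}}f(t+nT).$$ Then, for all real $\xi$ with $0\le\xi\le \xi_{r,K}/|f|^{\infty}_{1,T}$, $$\mathbb{E}\left[e^{\xi N(f)}\right]\le\exp\left(\left[e^{\xi\,|f|^{\infty}_{1,T}\,C_{r,K}}-1\right]T\sum_{m\in\mathbf{M}}\mu_m\right).$$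
   Context: Hawkes process. A point process on $\mathbb{R}$ is a random subset of $\mathbb{R}$ that is almost surely locally finite. Given base rates $\mu_m\ge 0$ and measurable interaction functions $h^m_{m'}:\mathbb{R}_+\to\mathbb{R}_+$ ($m,m'\in\mathbf{M}$), a (linear) Hawkes process with these parameters, on a probability space with filtration $(\mathcal{F}_t)_{t\in\mathbb{R}}$, is a family $(N^m)_{m\in\mathbf{M}}$ of point processes on $\mathbb{R}$ that is adapted to $(\mathcal{F}_t)$, such that almost surely $N^m$ and $N^{m'}$ have no common points when $m\ne m'$, and which has the predictable stochastic intensity $(\lambda^m)_{m\in\mathbf{M}}$ given by $$\lambda^m_t=\mu_m+\sum_{m'\in\mathbf{M}}\int_{-\infty}^{t^-}h^m_{m'}(t-s)\,dN^{m'}_s,\qquad m\in\mathbf{M},\ t\in\mathbb{R}.$$ Here $\|h\|_1=\int_0^\infty h(t)\,dt$, and $\mathbf{H}_{m',m}=\|h^m_{m'}\|_1$ (row $m'$, column $m$). Stationary process and its law (known facts, due to Brémaud–Massoulié and Hawkes–Oakes). When the spectral radius of $\mathbf{H}$ is $<1$ (which follows from the hypothesis on $r,K$), the stationary Hawkes process exists, and its law is that of the following cluster construction, which is the Hawkes process meant in the statement. Let $\mathcal{U}=\bigcup_{n\ge 0}(\mathbb{N}^* )^n$ be the set of Ulam–Harris–Neveu labels, with $\mathbb{N}^*=\{1,2,\dots\}$ and $(\mathbb{N}^* )^0=\{\varnothing\}$. A cluster with root of type $m_0\in\mathbf{M}$ born at time $t_0\in\mathbb{R}$ is a random family $((u,\mathrm{tp}(u),\mathrm{bd}(u)))_{u\in\mathcal{T}}$,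 where $\mathcal{T}\subset\mathcal{U}$ is a random tree, $\mathrm{tp}(u)\in\mathbf{M}$ is the type and $\mathrm{bd}(u)\in\mathbb{R}$ the birth date of $u$, such that: the root $\varnothing$ has type $m_0$; independently for all individuals $u$ and all types $m$, the number of children of $u$ of type $m$ is Poisson with parameter $\mathbf{H}_{\mathrm{tp}(u),m}$; $\mathrm{bd}(\varnothing)=t_0$; and conditionally on the typed tree, independently for all pairs with $v$ a child of $u$, $\mathrm{bd}(v)-\mathrm{bd}(u)$ has density $h^{\mathrm{tp}(v)}_{\mathrm{tp}(u)}(s)\mathbf{1}_{s>0}/\int_0^\infty h^{\mathrm{tp}(v)}_{\mathrm{tp}(u)}(t)\,dt$. Take independent homogeneous Poisson processes $\pi^m$ on $\mathbb{R}$ with rates $\mu_m$ and, conditionally on them, independent clusters $G^m_x$ with root of type $m$ born at time $x$, for $m\in\mathbf{M}$ and $x\in\pi^m$. Then $N^m$ is the set of birth dates of all individuals of type $m$ in all these clusters. Norm. $\|A\|_{\infty,\mathrm{op}}$ is the operator norm associated with the sup norm $\|\cdot\|_\infty$ on vectors, i.e. $\|A\|_{\infty,\mathrm{op}}=\max_i\sum_j|A_{ij}|$. Conventions for degenerate cases: if $|f|^\infty_{1,T}=0$, then $\xi_{r,K}/|f|^\infty_{1,T}=+\infty$ and every real $\xi\ge0$ is allowed; if $|f|^\infty_{1,T}=+\infty$, then $\xi_{r,K}/|f|^\infty_{1,T}=0$, so only $\xi=0$ is allowed, with $0\cdot\infty=0$. *)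

(* Defs.v *)
From mathcomp Require Import all_boot all_order all_algebra.
From mathcomp Require Import all_classical all_reals all_analysis measurable_realfun.
Set Implicit Arguments.
Unset Strict Implicit.
Unset Printing Implicit Defensive.
Import Order.TTheory GRing.Theory Num.Theory.
Import numFieldNormedType.Exports.

Local Open Scope classical_set_scope.
Local Open Scope ring_scope.
Local Open Scope ereal_scope.

(* [poisson_prob] takes a second argument that its body ignores.  It is used
   rather than [poisson_pmf], which is 1 everywhere when the rate is 0, whereas
   [poisson_prob 0] is the Dirac mass at 0. *)
Definition poisson_weight (R : realType) (rate : R) (k : nat) : \bar R :=
  poisson_prob rate 0%N [set k].

Definition mutually_independent (R : realType) (d : measure_display)
    (Omega : measurableType d) (P : probability Omega R) (I : eqType)
    (F : I -> set (set Omega)) : Prop :=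
  forall (s : seq I) (E : I -> set Omega), uniq s ->
    (forall i, i \in s -> F i (E i)) ->
    P (\bigcap_(i in [set` s]) E i) = \prod_(i <- s) P (E i).

Definition point_config (M : nat) (R : realType) := 'I_M -> set R.

(* Events {(number of points of type m in B) \in E}; the sigma-algebra they
   generate is the one that carries the laws of families of point processes. *)
Definition count_events (M : nat) (R : realType) : set (set (point_config M R)) :=
  [set A | exists (m : 'I_M) (B : set R) (E : set (\bar R)),
    [/\ measurable B, measurable E &
        A = [set c | E (counting (c m `&` B))]]].

Definition config_space (M : nat) (R : realType) :=
  g_sigma_algebraType (@count_events M R).

Definition point_processes (R : realType) (d : measure_display)
    (Omega : measurableType d) (P : probability Omega R) (M : nat)
    (N : Omega -> point_config M R) : Prop :=
  measurable_fun setT (N : Omega -> config_space M R) /\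
  {ae P, forall w, forall (m : 'I_M) (a b : R),
    finite_set (N w m `&` `[a, b])}.

Definition same_law (R : realType)
    (d1 : measure_display) (Omega1 : measurableType d1)
    (P1 : probability Omega1 R)
    (d2 : measure_display) (Omega2 : measurableType d2)
    (P2 : probability Omega2 R)
    (M : nat) (N1 : Omega1 -> point_config M R) (N2 : Omega2 -> point_config M R)
    : Prop :=
  forall A : set (config_space M R), measurable A ->
    P1 (N1 @^-1` A) = P2 (N2 @^-1` A).

Definition poisson_process (R : realType) (d : measure_display)
    (Omega : measurableType d) (P : probability Omega R) (rate : R)
    (p : Omega -> set R) : Prop :=
  (forall (B : set R) (k : nat), measurable B -> lebesgue_measure B < +oo ->
     P [set w | counting (p w `&` B) = k%:R%:E :> \bar R] =
     poisson_weight (rate * fine (lebesgue_measure B))%R k) /\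
  (forall (n : nat) (B : 'I_n -> set R), (forall i, measurable (B i)) ->
     trivIset setT B ->
     mutually_independent P
       (fun i => g_sigma_algebra_preimage
          (fun w => counting (p w `&` B i) : \bar R))).

(* The points of a random set are listed by random variables [pt k] with values
   in \bar R; an infinite value means that there is no k-th point. *)
Definition points (R : realType) (Omega : Type)
    (pt : nat -> Omega -> \bar R) (w : Omega) : set R :=
  [set x | exists k, pt k w = x%:E].

Definition measurable_enum (R : realType) (d : measure_display)
    (Omega : measurableType d) (pt : nat -> Omega -> \bar R) : Prop :=
  (forall k, measurable_fun setT (pt k)) /\
  (forall w k l, pt k w \is a fin_num -> pt k w = pt l w -> k = l).

Definition L1norm (R : realType) (h : R -> R) : \bar R :=
  \int[lebesgue_measure]_(t in `[0%R, +oo[) (h t)%:E.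

(* [h m' m] is the effect of the points of type m' on type m. *)
Definition L1_matrix (R : realType) (M : nat) (h : 'I_M -> 'I_M -> R -> R)
    : 'M[R]_M :=
  \matrix_(m', m) fine (L1norm (h m' m)).

(* Operator norm associated with the sup norm on vectors. *)
Definition opnorm_infty (R : realType) (M : nat) (A : 'M[R]_M) : R :=
  \big[Num.max/0%R]_(i < M) (\sum_(j < M) `|A i j|)%R.

(* The probability measure on R with density h(s) 1_{s > 0} / ||h||_1. *)
Definition delay_law (R : realType) (h : R -> R) (B : set R) : \bar R :=
  \int[lebesgue_measure]_(s in B `&` `]0%R, +oo[)
    (h s / fine (L1norm h))%:E.

(* Ulam-Harris-Neveu labels; children are numbered from 0, and the j-th child
   of u is [rcons u j]. *)
Definition label := seq nat.

(* [g u = Some (m, x)]: u is in the tree, with type m and birth date x;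
   [g u = None]: u is not in the tree. *)
Definition cluster (M : nat) (R : realType) := label -> option ('I_M * R).

Definition in_tree (M : nat) (R : realType) (g : cluster M R) (u : label) : Prop :=
  g u <> None.

Definition tp (M : nat) (R : realType) (g : cluster M R) (u : label)
    : option 'I_M := omap fst (g u).

(* Birth date, with the junk value 0 outside the tree. *)
Definition bd (M : nat) (R : realType) (g : cluster M R) (u : label) : R :=
  if g u is Some (_, x) then x else 0%R.

Definition is_tree (M : nat) (R : realType) (g : cluster M R) : Prop :=
  in_tree g [::] /\
  forall (u : label) (j : nat), in_tree g (rcons u j) ->
    in_tree g u /\ forall i, (i <= j)%N -> in_tree g (rcons u i).

Definition nb_children (M : nat) (R : realType) (g : cluster M R) (u : label)
    (m : 'I_M) : \bar R :=
  counting [set j : nat | tp g (rcons u j) = Some m].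

Definition cluster_events (M : nat) (R : realType) : set (set (cluster M R)) :=
  [set A | exists (u : label) (m : 'I_M) (B : set R),
    measurable B /\ A = [set g | exists2 x, B x & g u = Some (m, x)]].

Definition cluster_space (M : nat) (R : realType) :=
  g_sigma_algebraType (@cluster_events M R).

(* Sigma-algebra on Omega generated by the typed tree restricted to the labels
   in D. *)
Definition typed_tree_sigma (R : realType) (Omega : Type) (M : nat)
    (G : Omega -> cluster M R) (D : set label) : set (set Omega) :=
  <<s [set A | exists (u : label) (m : 'I_M),
         D u /\ A = [set w | tp (G w) u = Some m]] >>.

(* Conditionally on the typed tree up to generation n, the numbers of children
   of each type of the individuals of generation n are independent Poisson
   variables.  The conditioning is expressed by integrating over the events A of
   the sigma-algebra of the first generations, on the event that the labels in s
   are individuals with types given by t. *)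
Definition poisson_offspring (R : realType) (d : measure_display)
    (Omega : measurableType d) (P : probability Omega R) (M : nat)
    (H : 'M[R]_M) (G : Omega -> cluster M R) : Prop :=
  forall (n : nat) (A : set Omega) (s : seq label) (t : label -> 'I_M)
      (k : label -> 'I_M -> nat),
    typed_tree_sigma G [set u | (size u <= n)%N] A ->
    uniq s -> (forall u, u \in s -> size u = n) ->
    let C := A `&` [set w | forall u, u \in s -> tp (G w) u = Some (t u)] in
    P (C `&` [set w | forall u, u \in s ->
                      forall m, nb_children (G w) u m = (k u m)%:R%:E]) =
    P C * \prod_(u <- s) \prod_(m < M) poisson_weight (H (t u) m) (k u m).

(* Conditionally on the whole typed tree, the delays between the births of
   parents and children are independent, with laws [delay_law].  A pair (u, j)
   in s stands for the individual u and its child [rcons u j]. *)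
Definition independent_delays (R : realType) (d : measure_display)
    (Omega : measurableType d) (P : probability Omega R) (M : nat)
    (h : 'I_M -> 'I_M -> R -> R) (G : Omega -> cluster M R) : Prop :=
  forall (A : set Omega) (s : seq (label * nat)) (t : label -> 'I_M)
      (B : label * nat -> set R),
    typed_tree_sigma G setT A ->
    uniq s -> (forall v, v \in s -> measurable (B v)) ->
    let C := A `&` [set w | forall v, v \in s ->
                      tp (G w) v.1 = Some (t v.1) /\
                      tp (G w) (rcons v.1 v.2) = Some (t (rcons v.1 v.2))] in
    P (C `&` [set w | forall v, v \in s ->
                B v (bd (G w) (rcons v.1 v.2) - bd (G w) v.1)%R]) =
    P C * \prod_(v <- s) delay_law (h (t v.1) (t (rcons v.1 v.2))) (B v).

Record is_random_cluster (R : realType) (d : measure_display)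
    (Omega : measurableType d) (P : probability Omega R) (M : nat)
    (h : 'I_M -> 'I_M -> R -> R) (m0 : 'I_M) (t0 : R)
    (G : Omega -> cluster M R) : Prop := IsRandomCluster {
  cluster_measurable : measurable_fun setT (G : Omega -> cluster_space M R) ;
  cluster_tree : forall w, is_tree (G w) ;
  cluster_root : forall w, G w [::] = Some (m0, t0) ;
  cluster_offspring : poisson_offspring P (L1_matrix h) G ;
  cluster_delays : independent_delays P h G
}.

(* The independent sources of randomness are the enumerations [pt m] of the
   Poisson processes, one for each type m, and the clusters [G m k]. *)
Definition source_sigma (R : realType) (d : measure_display)
    (Omega : measurableType d) (M : nat)
    (pt : 'I_M -> nat -> Omega -> \bar R)
    (G : 'I_M -> nat -> Omega -> cluster M R)
    (i : 'I_M + 'I_M * nat) : set (set Omega) :=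
  match i with
  | inl m => <<s \bigcup_k g_sigma_algebra_preimage (pt m k) >>
  | inr p => g_sigma_algebra_preimage
               (G p.1 p.2 : Omega -> cluster_space M R)
  end.

(* A cluster born at x is the translate by x of a cluster born at 0.  Hence
   independent clusters, conditionally on the Poisson points, are obtained by
   attaching to the k-th point of type m the cluster [G m k] born at time 0, the
   family of the [G m k] being independent and independent of the points. *)
Record is_cluster_construction (R : realType) (d : measure_display)
    (Omega : measurableType d) (P : probability Omega R) (M : nat)
    (mu : 'I_M -> R) (h : 'I_M -> 'I_M -> R -> R)
    (pt : 'I_M -> nat -> Omega -> \bar R)
    (G : 'I_M -> nat -> Omega -> cluster M R) : Prop := IsClusterConstruction {
  roots_enum : forall m, measurable_enum (pt m) ;
  roots_poisson : forall m, poisson_process P (mu m) (points (pt m)) ;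
  clusters_law : forall m k, is_random_cluster P h m 0%R (G m k) ;
  sources_independent : mutually_independent P (source_sigma pt G)
}.

(* Birth dates of all the individuals of type m in the clusters [G m0 k]
   translated by the points [pt m0 k]. *)
Definition cluster_births (R : realType) (Omega : Type) (M : nat)
    (pt : 'I_M -> nat -> Omega -> \bar R)
    (G : 'I_M -> nat -> Omega -> cluster M R) (w : Omega) : point_config M R :=
  fun m => [set t | exists (m0 : 'I_M) (k : nat) (x : R) (u : label) (s : R),
    [/\ pt m0 k w = x%:E, G m0 k w u = Some (m, s) & t = (x + s)%R]].

(* A stationary Hawkes process is a family of point processes with the law of
   the cluster construction, which may live on another probability space. *)
Definition stationary_hawkes (R : realType) (d : measure_display)
    (Omega : measurableType d) (P : probability Omega R) (M : nat)
    (mu : 'I_M -> R) (h : 'I_M -> 'I_M -> R -> R)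
    (N : Omega -> point_config M R) : Prop :=
  point_processes P N /\
  exists (d' : measure_display) (Omega' : measurableType d')
      (P' : probability Omega' R)
      (pt : 'I_M -> nat -> Omega' -> \bar R)
      (G : 'I_M -> nat -> Omega' -> cluster M R),
    [/\ is_cluster_construction P' mu h pt G,
        point_processes P' (cluster_births pt G) &
        same_law P P' N (cluster_births pt G)].

Definition linear_stat (R : realType) (M : nat) (f : R -> R)
    (c : point_config M R) : \bar R :=
  \sum_(m < M) \esum_(x in c m) (f x)%:E.

Definition norm_1_infty (R : realType) (T : R) (f : R -> R) : \bar R :=
  ereal_sup [set \esum_(n in [set: int]) (f (t + n%:~R * T)%R)%:E | t in [set: R]].

Definition C_rK (R : realType) (r K : R) : R := (1 + 2 * K / (1 - r))%R.

Definition xi_rK (R : realType) (r K : R) : R :=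
  ((C_rK r K)^-1 * ln ((1 + r) / (2 * r)))%R.

(* Main.v *)
(** Only the individuals of the first generations with small labels are counted;
    the theorem is their monotone limit.  Integrating out one generation after
    another, last one first, bounds the exponential moment of a truncated cluster
    with root of type m born at y by [expR (psi j m y)], where
      psi 0 m y = F y,
      psi j.+1 m y = F y + sum_m' H m m' * E (expR (psi j m' (y + S)) - 1),
    with F = xi f and S a delay; the sum is the log-Laplace transform of the
    Poisson offspring.  The Poisson exponential formula for the roots then reduces
    the theorem to bounding the integral of [expR (psi j m) - 1] over R.

    Since exp - 1 is superadditive on the nonnegative half-line, a bound on the
    sums of [psi j m'] over the translates of y by multiples of T goes through the
    recursion without loss: the sums of [psi j m] are at most [v j m] as soon as
      theta <= v 0 m,  theta + sum_m' H m m' * (expR (v j m') - 1) <= v j.+1 m,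
    with theta = xi |f|.  For rho = (1 + r) / (2 r), exp v - 1 <= rho v as long as
    exp v <= rho, so that v j = theta sum_(k <= j) rho^k H^k 1 is a solution; it is
    at most theta C, because rho r = (1 + r) / 2 < 1.  Cutting R in intervals of
    length T, the integral of [expR (psi j m) - 1] is at most
    T (exp (theta C) - 1). *)

Require Import Defs.
From HB Require Import structures.
From mathcomp Require Import all_boot all_order all_algebra.
From mathcomp Require Import finmap.
From mathcomp Require Import all_classical all_reals all_analysis measurable_realfun.
From mathcomp Require Import ring lra.
Import Order.TTheory GRing.Theory Num.Theory.
Import numFieldNormedType.Exports.

Set Implicit Arguments.
Unset Strict Implicit.
Unset Printing Implicit Defensive.
Local Open Scope classical_set_scope.
Local Open Scope ring_scope.
Local Open Scope ereal_scope.

(** * Integration *)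

(** The law of a cluster is given by probabilities of events only, while types, birth dates and the
    shape of the tree are all random; the obstacle is to condition on part of the tree without
    conditional expectations. A finite set of labels has finitely many typings, so an inequality
    between integrals can be checked on each event where the typing is frozen; birth dates are then
    functions of the delays alone. The factor to integrate out is separated from the rest by
    comparing finite measures on a pi-system. Delays are integrated out with the types of both ends
    frozen; numbers of children with the types frozen only up to the parents. Older delays are
    independent of these numbers, which belong to the typed tree.

    Any [rho] with [1 < rho < 1 / r] would give a bound of this kind. The choice [(1 + r) / (2 * r)]
    puts [rho * r] halfway between [r] and 1, whence the term [2 * K / (1 - r)] of [C_rK]. As
    [xi_rK] is [ln rho / C_rK], the hypothesis on [xi] says that [theta * C_rK <= ln rho], which
    keeps [expR (v j m)] below [rho] at every step. *)

Lemma ge0_integral_mrestr (R : realType) d (T : measurableType d)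
    (mu : {measure set T -> \bar R}) (D : set T) (mD : measurable D)
    (f : T -> \bar R) : measurable_fun setT f -> (forall x, 0 <= f x) ->
  \int[mrestr mu mD]_x f x = \int[mu]_(x in D) f x.
Proof.
move=> mf f0; rewrite -(setUv D) ge0_integral_setU//=; last 3 first.
- exact: measurableC.
- by rewrite setUv.
- by apply/disj_set2P; rewrite setICr.
rewrite [X in _ + X](_ : _ = 0) ?adde0.
  apply: eq_measure_integral => A mA AD.
  by rewrite /= /mrestr setIidl.
rewrite -[RHS](integral_measure_zero (~` D) f).
apply: eq_measure_integral => A mA AD.
rewrite /= /mrestr /mzero (_ : A `&` D = set0) ?measure0//.
by rewrite -subset0 => x [/AD].
Qed.

(** Restriction to the whole space leaves the values unchanged and carries the structure of a finite
    measure. *)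
Lemma measure_to_finite (R : realType) d (T : measurableType d)
    (m : {measure set T -> \bar R}) : fin_num_fun m ->
  exists m' : {finite_measure set T -> \bar R}, forall A, m' A = m A.
Proof.
move=> mfin; have moo : m setT < +oo by rewrite -ge0_fin_numE// mfin.
exists [the {finite_measure set T -> \bar R} of mfrestr measurableT moo] => A.
by rewrite /= /mfrestr /mrestr setIT.
Qed.

Lemma pushforward_finite (R : realType) d1 d2 (T1 : measurableType d1)
    (T2 : measurableType d2) (Q : {finite_measure set T1 -> \bar R}) (f : T1 -> T2)
    (mf : measurable_fun setT f) :
  exists m : {finite_measure set T2 -> \bar R},
    (forall A, m A = Q (f @^-1` A)) /\
    forall g : T2 -> \bar R, measurable_fun setT g -> (forall y, 0 <= g y) ->
      \int[m]_y g y = \int[Q]_x g (f x).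
Proof.
pose m0 := measure_function_pushforward__canonical__measure_function_Measure Q mf.
have m0f : fin_num_fun m0.
  move=> A mA; apply: fin_num_measure; rewrite -[X in measurable X]setTI.
  exact: (mf _ _ mA).
have [m mE] := measure_to_finite m0f; exists m; split=> [A|g mg g0]; first exact: mE.
rewrite -[RHS](ge0_integral_pushforward mf _ measurableT)//.
by apply: eq_measure_integral => A mA _; exact: mE.
Qed.

(** * Independence from a sigma-algebra generated by a pi-system *)

Section sub_sigma_algebra.
Context (R : realType) d (Om : measurableType d).
Variable GG : set (set Om).
Hypotheses (GGm : GG `<=` measurable) (GGI : setI_closed GG) (GGT : GG setT).

(** The set [Om] with the smaller sigma-algebra: being measurable for the information in [GG]
    becomes being measurable as a function on [OG]. *)
Let OG := g_sigma_algebraType GG.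

Lemma measurable_sub_id : measurable_fun setT (id : Om -> OG).
Proof.
by move=> _ B mB; rewrite setTI; apply: (smallest_sub (@sigma_algebra_measurable _ Om) GGm).
Qed.

Lemma measurable_fun_sub d' (T : measurableType d') (f : OG -> T) :
  measurable_fun setT f -> measurable_fun setT (f : Om -> T).
Proof. by move=> mf; exact: (measurableT_comp mf measurable_sub_id). Qed.

Lemma eq_measure_sub (m1 m2 : {finite_measure set Om -> \bar R}) :
  (forall A, GG A -> m1 A = m2 A) -> forall A, <<s GG >> A -> m1 A = m2 A.
Proof.
move=> m12; apply: (@g_sigma_algebra_measure_unique _ _ _ GG GGm (fun=> setT)) => //.
  by rewrite bigcup_const.
by move=> _; rewrite -ge0_fin_numE//; exact: fin_num_measure.
Qed.

Lemma eq_integral_sub (m1 m2 : {finite_measure set Om -> \bar R}) (V : OG -> \bar R) :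
  (forall A, GG A -> m1 A = m2 A) -> measurable_fun setT V -> (forall x, 0 <= V x) ->
  \int[m1]_x V x = \int[m2]_x V x.
Proof.
move=> m12 mV V0.
have [p1 [p1E <-//]] := pushforward_finite m1 measurable_sub_id.
have [p2 [p2E <-//]] := pushforward_finite m2 measurable_sub_id.
apply: eq_measure_integral => A mA _.
by rewrite [LHS]p1E [RHS]p2E; exact: eq_measure_sub.
Qed.

(* If X has law kappa independently of the sigma-algebra generated by GG, then X
   can be integrated out with the rest of the integrand kept frozen. *)
Lemma freeze d' (T : measurableType d') (Q : {finite_measure set Om -> \bar R})
    (X : Om -> T) (kappa : {finite_measure set T -> \bar R})
    (Phi : OG * T -> \bar R) : measurable_fun setT X ->
  (forall E B, GG E -> measurable B -> Q (E `&` X @^-1` B) = Q E * kappa B) ->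
  measurable_fun setT Phi -> (forall z, 0 <= Phi z) ->
  \int[Q]_w Phi (w, X w) = \int[Q]_w \int[kappa]_s Phi (w, s).
Proof.
move=> mX XI mPhi Phi0.
pose J := (fun w => (w, X w)) : Om -> OG * T.
have mJ : measurable_fun setT J by apply: measurable_fun_pair => //; exact: measurable_sub_id.
have [QG [QGE QGi]] := pushforward_finite Q measurable_sub_id.
have [QJ [QJE QJi]] := pushforward_finite Q mJ.
rewrite -(QJi Phi)//.
have -> : \int[QJ]_z Phi z = \int[QG \x kappa]_z Phi z.
  apply: eq_measure_integral => A mA _.
  symmetry; refine (product_measure_unique (m1 := QG) (m2 := kappa) (m' := QJ) _ mA) => E B mE mB.
  rewrite [LHS]QJE; transitivity (Q E * kappa B); last first.
    by congr (_ * _); exact/esym/QGE.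
  have -> : J @^-1` (E `*` B) = E `&` X @^-1` B by [].
  have mXB : measurable (X @^-1` B) by rewrite -[X in measurable X]setTI; exact: mX.
  (* With [B] fixed, both sides are finite measures in [E] that agree on the pi-system [GG], hence
     on all of its sigma-algebra; [kappa B] is made a nonnegative real in order to scale [Q]. *)
  pose m1 := [the {finite_measure set Om -> \bar R} of mrestr Q mXB].
  pose k := fine (kappa B).
  have k0 : (0 <= k)%R by apply: fine_ge0.
  have kE : kappa B = k%:E by rewrite fineK// fin_num_measure.
  have [|m2 m2E] := @measure_to_finite _ _ _ [the {measure set Om -> \bar R} of mscale (NngNum k0) Q].
    by move=> C mC; rewrite /= /mscale fin_numM// fin_num_measure.
  have := @eq_measure_sub m1 m2.
  rewrite /m1 /= /mrestr => -> //; first by rewrite m2E /= /mscale /= muleC kE.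
  by move=> C GC; rewrite XI// m2E kE muleC.
rewrite fubini_tonelli1//.
rewrite -(QGi (fun w => \int[kappa]_s Phi (w, s)))//.
  exact: measurable_fun_fubini_tonelli_F.
by move=> w; apply: integral_ge0.
Qed.

End sub_sigma_algebra.

Lemma emeasurable_prod d (T : measurableType d) (R : realType) (I : Type)
    (s : seq I) (P : pred I) (f : I -> T -> \bar R) (D : set T) :
  measurable D ->
  (forall i, P i -> measurable_fun D (f i)) ->
  measurable_fun D (fun x => \prod_(i <- s | P i) f i x).
Proof.
move=> mD mf; elim: s => [|i s IH].
  by apply: eq_measurable_fun (measurable_cst (1 : \bar R)) => x _; rewrite big_nil.
rewrite (_ : (fun x => _) = (fun x => if P i then f i x * \prod_(j <- s | P j) f j x
    else \prod_(j <- s | P j) f j x)); last by apply/funext => x; rewrite big_cons.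
by have [Pi|//] := boolP (P i); apply: emeasurable_funM => //; exact: mf.
Qed.

Lemma prode_ge0 (R : realType) (I : Type) (s : seq I) (P : pred I) (f : I -> \bar R) :
  (forall i, P i -> 0 <= f i) -> 0 <= \prod_(i <- s | P i) f i.
Proof. by move=> f0; apply: (big_ind (fun x => 0 <= x)) => // x y; exact: mule_ge0. Qed.

Lemma nneseriesZl_ereal (R : realType) (x : \bar R) (f : nat -> \bar R) :
  0 <= x -> (forall k, 0 <= f k) -> \sum_(k <oo) x * f k = x * \sum_(k <oo) f k.
Proof.
move=> x0 f0; rewrite -!ge0_integral_count//; last by move=> k; exact: mule_ge0.
by rewrite ge0_integralZl.
Qed.

(** * Families of discrete random variables with a product law *)

Section discrete_family.
Context (R : realType) d (Om : measurableType d) (mu : {measure set Om -> \bar R}).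
Context (I : eqType) (Y : I -> Om -> \bar R) (a : I -> nat -> Om -> \bar R)
  (p : I -> nat -> \bar R) (VV : set (Om -> \bar R)).
Hypothesis mY : forall i, measurable_fun setT (Y i).
Hypothesis ma : forall i k, measurable_fun setT (a i k).
Hypothesis a0 : forall i k w, 0 <= a i k w.
Hypothesis p0 : forall i k, 0 <= p i k.
Hypothesis mVV : forall V, VV V -> measurable_fun setT V.
Hypothesis VV0 : forall V, VV V -> forall w, 0 <= V w.
Hypothesis VVM : forall V i k, VV V -> VV (fun w => V w * a i k w).

(** This is [a i (Y i w) w], written as a series so that it is measurable and can be integrated term
    by term. It is 0 where [Y i] is not a natural number; a count can be infinite. *)
Definition on_values (i : I) (w : Om) : \bar R :=
  \sum_(k <oo) a i k w * (\1_(Y i @^-1` [set k%:R%:E]) w)%:E.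

Lemma measurable_value i (k : nat) : measurable (Y i @^-1` [set k%:R%:E]).
Proof. by rewrite -[X in measurable X]setTI; exact: mY. Qed.
Hint Resolve measurable_value : core.

Let term_meas i k : measurable_fun setT
  (fun w => a i k w * (\1_(Y i @^-1` [set k%:R%:E]) w)%:E).
Proof.
apply: emeasurable_funM => //; apply/measurable_EFinP.
exact: measurable_indic.
Qed.

Let term_ge0 i k w : 0 <= a i k w * (\1_(Y i @^-1` [set k%:R%:E]) w)%:E.
Proof. by rewrite mule_ge0// lee_fin. Qed.

Lemma measurable_on_values i : measurable_fun setT (on_values i).
Proof. exact: ge0_emeasurable_sum. Qed.

Lemma on_values_ge0 i w : 0 <= on_values i w.
Proof. by apply: nneseries_ge0 => k _ _; exact: term_ge0. Qed.

(* The joint law of the Y i, i in l, is the product of the p i, independently of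
   the density V; the set A0 and the constant c leave room for the induction,
   where A is cut by events on the Y i already treated. *)
Lemma integral_discrete_family (l : seq I) (A A0 : set Om) (c : \bar R) :
  uniq l -> measurable A -> measurable A0 -> 0 <= c ->
  (forall (k : I -> nat) V, VV V ->
     \int[mu]_(w in A `&` [set w | forall i, i \in l -> Y i w = (k i)%:R%:E]) V w =
     c * \prod_(i <- l) p i (k i) * \int[mu]_(w in A0) V w) ->
  forall V, VV V ->
  \int[mu]_(w in A) (V w * \prod_(i <- l) on_values i w) =
  c * \int[mu]_(w in A0) (V w * \prod_(i <- l) \sum_(k <oo) a i k w * p i k).
Proof.
move=> + + mA0; elim: l A c => [|i l IH] A c /=.
  move=> _ mA c0 H V VVV.
  under eq_integral do rewrite big_nil mule1.
  under [in RHS]eq_integral do rewrite big_nil mule1.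
  have := H (fun=> 0%N) V VVV; rewrite big_nil mule1 => <-.
  by congr (integral _ _ _); apply/seteqP; split=> w // [].
move=> /andP[il ul] mA c0 H V VVV.
have prod0 w : 0 <= \prod_(j <- l) on_values j w.
  by apply: prode_ge0 => j _; exact: on_values_ge0.
have mprod D : measurable D -> measurable_fun D (fun w => \prod_(j <- l) on_values j w).
  move=> mD; apply: emeasurable_prod => // j _; apply: measurable_funTS.
  exact: measurable_on_values.
have prodp0 w : 0 <= \prod_(j <- l) \sum_(k <oo) a j k w * p j k.
  apply: prode_ge0 => j _; apply: nneseries_ge0 => k _ _; exact: mule_ge0.
have mprodp D : measurable D ->
    measurable_fun D (fun w => \prod_(j <- l) \sum_(k <oo) a j k w * p j k).
  move=> mD; apply: emeasurable_prod => // j _; apply: measurable_funTS.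
  apply: ge0_emeasurable_sum => k //.
    by move=> w _ _; exact: mule_ge0.
  move=> _; exact: emeasurable_funM.
transitivity (\sum_(k <oo) \int[mu]_(w in A)
   ((V w * a i k w * \prod_(j <- l) on_values j w) *
    (\1_(Y i @^-1` [set k%:R%:E]) w)%:E)).
  rewrite -integral_nneseries//; last 2 first.
  - move=> k; apply: emeasurable_funM; last first.
      by apply: measurable_funTS; apply/measurable_EFinP; exact: measurable_indic.
    apply: emeasurable_funM; last exact: mprod.
    by apply: emeasurable_funM; apply: measurable_funTS => //; exact: mVV.
  - by move=> k w _; rewrite !mule_ge0// ?VV0// lee_fin.
  apply: eq_integral => w _; rewrite big_cons {1}/on_values muleCA muleC.
  rewrite -nneseriesZl_ereal; [|by rewrite mule_ge0// VV0|by []].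
  apply: eq_eseriesr => k _.
  by rewrite muleA; congr (_ * _); rewrite muleAC.
(* For each [k], the induction hypothesis is used with the event [Y i = k] absorbed into [A], its
   weight [p i k] into [c] and the factor [a i k] into the density; this is what the stability [VVM]
   is for. *)
transitivity (\sum_(k <oo) c * (p i k * \int[mu]_(w in A0)
     (V w * a i k w * \prod_(j <- l) \sum_(k <oo) a j k w * p j k))).
  apply: eq_eseriesr => k _.
  rewrite -__deprecated__integral_setI_indic//.
  rewrite muleA (IH _ (c * p i k))//.
  - exact: measurableI.
  - exact: mule_ge0.
  - move=> k' W VW.
    pose k'' j := if j == i then k else k' j.
    have k''i : k'' i = k by rewrite /k'' eqxx.
    have k''l j : j \in l -> k'' j = k' j.
      by move=> jl; rewrite /k''; case: eqP => // ji; rewrite -ji jl in il.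
    have := H k'' W VW; rewrite big_cons k''i !muleA.
    rewrite (eq_big_seq (fun j => p j (k' j))); last by move=> j jl; rewrite k''l.
    move=> <-; congr (integral _ _ _); apply/seteqP; split => w /=.
      move=> [[Aw Yk] Yk']; split => // j; rewrite inE => /orP[/eqP ->|jl].
        by rewrite k''i.
      by rewrite k''l// Yk'.
    move=> [Aw Yk]; split; first by split => //; rewrite Yk ?mem_head// k''i.
    by move=> j jl; rewrite Yk ?inE ?jl ?orbT// k''l.
  - exact: VVM.
rewrite nneseriesZl_ereal//; last first.
  move=> k; rewrite mule_ge0//; apply: integral_ge0 => w _.
  by rewrite !mule_ge0// VV0.
congr (_ * _); under eq_eseriesr => k _.
  rewrite -ge0_integralZl//; last 2 first.
  - apply: emeasurable_funM; last exact: mprodp.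
    by apply: measurable_funTS; apply: emeasurable_funM => //; exact: mVV.
  - by move=> w _; rewrite !mule_ge0// VV0.
  over.
rewrite /= -integral_nneseries//; last 2 first.
- move=> k; apply: measurable_funTS; apply: measurable_funeM.
  apply: emeasurable_funM; last exact: mprodp.
  by apply: emeasurable_funM => //; exact: mVV.
- by move=> k w _; rewrite !mule_ge0// VV0.
apply: eq_integral => w _; rewrite big_cons muleCA muleC.
rewrite -nneseriesZl_ereal; [|by rewrite mule_ge0// VV0|by move=> k; rewrite mule_ge0].
apply: eq_eseriesr => k _.
rewrite [in LHS]muleC -!muleA; congr (_ * _).
rewrite [RHS]muleCA; congr (_ * _); exact: muleC.
Qed.

End discrete_family.

(** * Poisson weights and their generating function *)

Lemma poisson_weightE (R : realType) (rate : R) k : (0 <= rate)%R ->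
  poisson_weight rate k = (rate ^+ k * k`!%:R^-1 * expR (- rate))%:E.
Proof.
rewrite le_eqVlt /poisson_weight /poisson_prob => /predU1P[<-|rate0].
  (* At rate 0 the weight is the Dirac mass at 0, and the formula agrees with it because
     [0 ^+ 0 = 1]. *)
  rewrite ltxx oppr0 expR0 mulr1 diracE; case: k => [|k].
    by rewrite mem_set// expr0 fact0 invr1 mulr1.
  by rewrite memNset// exprS !mul0r.
by rewrite rate0 esum_set1 /poisson_pmf rate0// lee_fin !mulr_ge0// ?exprn_ge0// ?expR_ge0// ltW.
Qed.

Lemma poisson_weight_ge0 (R : realType) (rate : R) k : (0 <= rate)%R ->
  0 <= poisson_weight rate k.
Proof.
by move=> r0; rewrite poisson_weightE// lee_fin !mulr_ge0// ?exprn_ge0// ?expR_ge0.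
Qed.

Lemma poisson_pgf (R : realType) (rate b : R) : (0 <= rate)%R -> (0 <= b)%R ->
  \sum_(k <oo) (b ^+ k)%:E * poisson_weight rate k = (expR (rate * (b - 1)))%:E.
Proof.
move=> r0 b0.
under eq_eseriesr => k _.
  rewrite poisson_weightE// -EFinM.
  rewrite (_ : (b ^+ k * (rate ^+ k * k`!%:R^-1 * expR (- rate)) =
      expR (- rate) * ((k`!)%:R^-1 * (rate * b) ^+ k))%R); last by rewrite exprMn; ring.
  rewrite EFinM; over.
rewrite /= nneseriesZl/=; last first.
  by move=> k _; rewrite lee_fin mulr_ge0// exprn_ge0// mulr_ge0.
rewrite mulrBr mulr1 addrC expRD EFinM; congr (_ * _).
rewrite expRE -EFin_lim; last first.
  rewrite /pseries/=; under eq_fun do rewrite mulrC.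
  exact: is_cvg_series_exp_coeff.
by apply/congr_lim/funext => n/=; rewrite /pseries/= /series/= -sumEFin.
Qed.

Lemma poisson_weight_sum1 (R : realType) (rate : R) : (0 <= rate)%R ->
  \sum_(k <oo) poisson_weight rate k = 1.
Proof.
move=> r0; transitivity (\sum_(k <oo) (1 ^+ k)%:E * poisson_weight rate k).
  by apply: eq_eseriesr => k _; rewrite expr1n mul1e.
by rewrite poisson_pgf// subrr mulr0 expR0.
Qed.

Lemma nneseries_indic_eq (R : realType) (x : nat -> \bar R) (n : nat) : 0 <= x n ->
  \sum_(k <oo) x k * (\1_[set k%:R%:E] (n%:R%:E : \bar R))%:E = x n.
Proof.
move=> xn.
rewrite (@eq_eseriesr _ _ (fun k => x n * \d_n [set k])); last first.
  move=> k _; rewrite indicE diracE; case: (eqVneq n k) => [->|nk].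
    by rewrite !mem_set.
  have nk' : (k == n) = false by rewrite eq_sym (negbTE nk).
  rewrite !memNset ?mule0//= => -[] /eqP; rewrite ?eqr_nat; by rewrite ?nk' ?(negbTE nk).
rewrite nneseriesZl_ereal//.
rewrite (_ : \sum_(k <oo) \d_n [set k] = 1) ?mule1//.
rewrite (@eq_eseriesr _ _ (fun k => \d_k [set n] : \bar R)); last first.
  by move=> k _; rewrite !diracE; congr ((nat_of_bool _)%:R%:E); apply/idP/idP; rewrite !inE => ->.
rewrite -counting_dirac /counting asboolT//.
by rewrite fset_set1 finmap.cardfs1.
Qed.

Lemma on_values_nat (R : realType) d (Om : measurableType d) (I : eqType)
    (Y : I -> Om -> \bar R) (a : I -> nat -> Om -> \bar R) i w (n : nat) :
  0 <= a i n w -> Y i w = n%:R%:E -> on_values Y a i w = a i n w.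
Proof.
move=> a0 Yn; rewrite -[RHS](@nneseries_indic_eq _ (fun k => a i k w) n)//.
by apply: eq_eseriesr => k _; rewrite -Yn !indicE.
Qed.

Lemma on_values0 (R : realType) d (Om : measurableType d) (I : eqType)
    (Y : I -> Om -> \bar R) (a : I -> nat -> Om -> \bar R) i w :
  (forall k : nat, Y i w <> k%:R%:E) -> on_values Y a i w = 0.
Proof.
move=> Yn; rewrite /on_values eseries0// => k _ _.
by rewrite indicE memNset ?mule0//; exact: Yn.
Qed.

Section values_ae.
Context (R : realType) d (Om : measurableType d) (mu : {measure set Om -> \bar R}).
Context (I : choiceType) (Y : I -> Om -> \bar R) (p : I -> nat -> \bar R).
Hypothesis mY : forall i, measurable_fun setT (Y i).
Hypothesis p0 : forall i k, 0 <= p i k.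
Hypothesis p1 : forall i, \sum_(k <oo) p i k = 1.

(** The weights [p i] have total mass 1, so the product formula with all factors equal to 1 gives
    the event that every [Y i] is a natural number the full mass of [A]. *)
Lemma values_ae (l : seq I) (A : set Om) : uniq l -> measurable A -> mu A < +oo ->
  (forall k : I -> nat,
     mu (A `&` [set w | forall i, i \in l -> Y i w = (k i)%:R%:E]) =
     \prod_(i <- l) p i (k i) * mu A) ->
  mu.-negligible (A `&` [set w | exists2 i, i \in l & forall k : nat, Y i w <> k%:R%:E]).
Proof.
move=> ul mA muA H.
pose N := \bigcap_(i in [set` l]) \bigcup_k (Y i @^-1` [set k%:R%:E]).
have mN : measurable N.
  apply: fin_bigcap_measurable => // i _; apply: bigcup_measurable => k _.
  by rewrite -[X in measurable X]setTI; exact: mY.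
have muAN : mu A <= mu (A `&` N).
  have H1 (k : I -> nat) V : [set cst 1] V ->
      \int[mu]_(w in A `&` [set w | forall i, i \in l -> Y i w = (k i)%:R%:E]) V w =
      1 * \prod_(i <- l) p i (k i) * \int[mu]_(w in A) V w.
    move=> ->; rewrite !integral_cst ?mul1e//; apply: measurableI => //.
    rewrite (_ : [set w | _] = \bigcap_(i in [set` l]) (Y i @^-1` [set (k i)%:R%:E]))//.
    apply: fin_bigcap_measurable => // i _.
    by rewrite -[X in measurable X]setTI; exact: mY.
  pose a (i : I) (k : nat) (w : Om) : \bar R := 1.
  have ma i k : measurable_fun setT (a i k) by exact: measurable_cst.
  have a0 i k w : 0 <= a i k w by exact: lee01.
  have := integral_discrete_family mY ma a0 p0 _ _ _ ul mA mA lee01 H1.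
  (* A single [Y i] outside the natural numbers makes its factor, hence the product, vanish. *)
  have mon w : \prod_(i <- l) on_values Y a i w <= (\1_N w)%:E.
    rewrite indicE; case: (boolP (w \in N)) => [/set_mem wN|/negP wN].
      rewrite big1_seq// => i /andP[_ il]; have [k _ Yk] := wN i il.
      by rewrite (on_values_nat (n := k)).
    have [i il Yi] : exists2 i, i \in l & forall k : nat, Y i w <> k%:R%:E.
      apply: contrapT => /forall2NP H'; apply: wN; apply/mem_set => i /= il.
      by have [//|/existsNP[k /contrapT Yk]] := H' i; exists k.
    by rewrite (big_rem i)//= on_values0// mul0e.
  move=> /(_ _ _ _ (cst 1)) H2.
  have {}H2 : \int[mu]_(w in A) (\prod_(i <- l) on_values Y a i w) = mu A.
    transitivity (\int[mu]_(w in A) (cst 1 w * \prod_(i <- l) on_values Y a i w)).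
      by apply: eq_integral => w _; rewrite mul1e.
    rewrite H2//; last 3 first.
    - by move=> _ ->.
    - by move=> _ -> w; rewrite lee01.
    - by move=> _ i k ->; apply/funext => w /=; rewrite mule1.
    rewrite mul1e -[RHS]mul1e -integral_cst//; apply: eq_integral => w _.
    rewrite mul1e big1// => i _; rewrite -[RHS](p1 i).
    by apply: eq_eseriesr => k _; rewrite mul1e.
  rewrite -{1}H2 setIC -integral_indic//; apply: ge0_le_integral => //.
  - by move=> w _; apply: prode_ge0 => i _; apply: nneseries_ge0 => k _ _; rewrite mule_ge0// lee_fin.
  - apply: emeasurable_prod => // i _; apply: measurable_funTS.
    exact: measurable_on_values.
  - by apply/measurable_EFinP; exact: measurable_indic.
exists (A `&` ~` N); split.
- by apply: measurableI => //; exact: measurableC.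
- apply/eqP; rewrite eq_le measure_ge0 andbT -setDE measureD//.
  by rewrite sube_le0.
- move=> w [Aw [i il Yi]]; split => // /(_ i il)[k _ Yk].
  exact: (Yi k).
Qed.
End values_ae.

(** * Superadditivity, translation and periodization *)

Lemma sum_expRB1_le (R : realType) (I : Type) (s : seq I) (a : I -> R) :
  (forall i, 0 <= a i)%R ->
  (\sum_(i <- s) (expR (a i) - 1) <= expR (\sum_(i <- s) a i) - 1)%R.
Proof.
move=> a0; elim: s => [|i s IH]; first by rewrite !big_nil expR0 subrr.
rewrite !big_cons expRD; set x := expR (a i); set y := expR _ in IH *.
have x1 : (1 <= x)%R by rewrite -expR0 ler_expR.
have y1 : (1 <= y)%R by rewrite -expR0 ler_expR sumr_ge0.
(* This is [(x - 1) * (y - 1) >= 0]. *)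
by nra.
Qed.

Lemma lebesgue_measureD (R : realType) (c : R) (A : set R) : measurable A ->
  pushforward lebesgue_measure ((fun x => x + c)%R : _ -> measurableTypeR R) A =
  lebesgue_measure A.
Proof.
have mc : measurable_fun setT ((fun x => x + c)%R : measurableTypeR R -> measurableTypeR R).
  exact: measurable_funD.
move=> mA; apply/esym.
apply: (@lebesgue_measure_unique _ (measure_function_pushforward__canonical__measure_function_Measure
  lebesgue_measure mc)) => //= _ [[a b]] _ <-.
rewrite /pushforward /=.
rewrite (_ : _ @^-1` _ = `](a - c)%R, (b - c)%R]%classic); last first.
  by apply/seteqP; split=> x /=; rewrite !in_itv /= ltrBlDr lerBrDr.
by rewrite !lebesgue_measure_itv/= !lte_fin ltrD2r; case: ifP => // _; rewrite -!EFinD; congr EFin; ring.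
Qed.

Lemma ge0_integral_shift (R : realType) (a b c : R) (g : R -> \bar R) :
  measurable_fun setT g -> (forall x, 0 <= g x) ->
  \int[lebesgue_measure]_(x in `[(a + c)%R, (b + c)%R[) g x =
  \int[lebesgue_measure]_(x in `[a, b[) g (x + c)%R.
Proof.
move=> mg g0.
have mc : measurable_fun setT ((fun x => x + c)%R : measurableTypeR R -> measurableTypeR R).
  exact: measurable_funD.
rewrite (_ : `[a, b[%classic = (fun x => x + c)%R @^-1` `[(a + c)%R, (b + c)%R[%classic); last first.
  by apply/seteqP; split=> x /=; rewrite !in_itv /= lerD2r ltrD2r.
rewrite -(ge0_integral_pushforward mc lebesgue_measure)//; last exact: measurable_funTS.
apply: eq_measure_integral => A mA AS; exact/esym/lebesgue_measureD.
Qed.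

(** Translating the [k] cells of length [T] back to the first one turns the integral into that of
    the sum of the translates, at most [c]. The bound does not depend on [k], so that windows can
    later grow to the whole line. *)
Lemma integral_periodization_le (R : realType) (T c a : R) (k : nat) (g : R -> R) :
  (0 < T)%R -> measurable_fun setT g -> (forall x, 0 <= g x)%R ->
  (forall x, \sum_(i < k) g (x + i%:R * T) <= c)%R ->
  \int[lebesgue_measure]_(x in `[a, (a + k%:R * T)%R[) (g x)%:E <= (T * c)%:E.
Proof.
move=> T0 mg g0 gc.
have mgE : measurable_fun setT (fun x => (g x)%:E) by exact/measurable_EFinP.
have -> : \int[lebesgue_measure]_(x in `[a, (a + k%:R * T)%R[) (g x)%:E =
    \sum_(i < k) \int[lebesgue_measure]_(x in `[a, (a + T)%R[) (g (x + i%:R * T))%:E.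
  clear gc; elim: k => [|k IH].
    by rewrite big_ord0 mul0r addr0 set_itvco0 integral_set0.
  rewrite big_ord_recr /= -IH.
  rewrite (_ : `[a, (a + k.+1%:R * T)%R[%classic = `[a, (a + k%:R * T)%R[ `|`
     `[(a + k%:R * T)%R, (a + T + k%:R * T)%R[%classic); last first.
    rewrite (_ : a + T + k%:R * T = a + k.+1%:R * T)%R; last by rewrite -natr1; ring.
    have H1 : (a <= a + k%:R * T)%R by rewrite lerDl mulr_ge0// ltW.
    have H2 : (a + k%:R * T <= a + k.+1%:R * T)%R by rewrite lerD2l ler_pM2r// ler_nat.
    apply/seteqP; split=> x /=; rewrite !in_itv /=.
      by move=> /andP[ax xk]; case: (ltP x (a + k%:R * T)%R) => xk'; [left|right]; apply/andP.
    by move=> [/andP[x1 x2]|/andP[x1 x2]]; apply/andP; split=> //; lra.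
  rewrite ge0_integral_setU//=.
  - by rewrite (ge0_integral_shift _ _ _ mgE)//= => x; rewrite lee_fin.
  - exact: measurable_funTS.
  - by move=> x _; rewrite lee_fin.
  - apply/disj_set2P; rewrite -subset0 => x /= []; rewrite !in_itv /=.
    by move=> /andP[_ x1] /andP[x2 _]; move: (lt_le_trans x1 x2); rewrite ltxx.
have mgi (i : nat) : measurable_fun setT (fun x : R => (g (x + i%:R * T)%R)%:E).
  apply/measurable_EFinP; apply: (measurableT_comp mg); exact: measurable_funD.
rewrite -ge0_integral_sum//; last 2 first.
- by move=> i; exact: (measurable_funTS (mgi i)).
- by move=> i x _; rewrite lee_fin.
apply: (@le_trans _ _ (\int[lebesgue_measure]_(x in `[a, (a + T)%R[) (cst c%:E x))).
  apply: ge0_le_integral => //.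
  - by move=> x _; apply: sume_ge0 => i _; rewrite lee_fin.
  - by apply: emeasurable_sum => i; exact: (measurable_funTS (mgi i)).
  - by move=> x _; rewrite sumEFin lee_fin.
rewrite integral_cst//= lebesgue_measure_itv /= lte_fin ltrDl T0 -EFinD -EFinM lee_fin.
by rewrite addrAC subrr add0r mulrC.
Qed.

(** * Log-Laplace transform of a cluster *)

Section log_laplace.
Context (R : realType) (M : nat) (H : 'I_M -> 'I_M -> R)
  (kap : 'I_M -> 'I_M -> {finite_measure set R -> \bar R}) (F : R -> R) (T theta : R)
  (v : nat -> 'I_M -> R).
Hypothesis H0 : forall m m', (0 <= H m m')%R.
Hypothesis kap1 : forall m m', kap m m' setT <= 1.
Hypothesis F0 : forall y, (0 <= F y)%R.
Hypothesis mF : measurable_fun setT F.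

(** [fine] loses nothing here: the bounds by [v] assumed below make the integrals finite, see
    [born_fin_num]. *)
Fixpoint psi (j : nat) (m : 'I_M) (y : R) : R :=
  if j is j'.+1 then
    (F y + \sum_(m' < M) H m m' *
       fine (\int[kap m m']_s (expR (psi j' m' (y + s)) - 1)%:E))%R
  else F y.

Definition born (j : nat) (m m' : 'I_M) (y : R) : \bar R :=
  \int[kap m m']_s (expR (psi j m' (y + s)) - 1)%:E.

Hypothesis FT : forall k y, (\sum_(i < k) F (y + i%:R * T) <= theta)%R.
Hypothesis v0 : forall m, (theta <= v 0%N m)%R.
Hypothesis vS : forall j m,
  (theta + \sum_(m' < M) H m m' * (expR (v j m') - 1) <= v j.+1 m)%R.

Let expRB1_ge0 (x : R) : (0 <= x)%R -> (0 <= expR x - 1)%R.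
Proof. by move=> x0; rewrite subr_ge0 -expR0 ler_expR. Qed.

(** The three properties go through the induction together: the first two make the next integral
    meaningful, and the third, already for [k = 1], makes it finite. *)
Lemma psi_spec j m : [/\ measurable_fun setT (psi j m),
  forall y, (0 <= psi j m y)%R &
  forall k y, (\sum_(i < k) psi j m (y + i%:R * T) <= v j m)%R].
Proof.
elim: j m => [|j IH] m.
  by split => // k y; rewrite (le_trans (FT k y)).
have mg m' : measurable_fun setT (fun z : R * R => (expR (psi j m' (z.1 + z.2)%R) - 1)%:E).
  have [mp _ _] := IH m'.
  apply/measurable_EFinP; apply: measurable_funB => //.
  apply: measurableT_comp => //; apply: measurableT_comp => //.
  exact: measurable_funD.
have g0 m' (z : R) : 0 <= (expR (psi j m' z) - 1)%:E.
  by have [_ p0 _] := IH m'; rewrite lee_fin expRB1_ge0.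
have mgy m' (y : R) : measurable_fun setT (fun s : R => (expR (psi j m' (y + s)%R) - 1)%:E).
  exact: (measurableT_comp (mg m') (measurable_pair1 y)).
(* The sum over translates enters the integral, then the exponential by superadditivity, and there
   the induction hypothesis applies at [y + s]. The mass of [kap m m'], at most 1, is lost. *)
have Jk m' k y : \sum_(i < k) born j m m' (y + i%:R * T)%R <= (expR (v j m') - 1)%:E.
  have [mp p0 pv] := IH m'.
  have vj : (0 <= v j m')%R by have := pv 0%N 0%R; rewrite big_ord0.
  rewrite /born -ge0_integral_sum//.
  apply: (@le_trans _ _ (\int[kap m m']_s (cst (expR (v j m') - 1)%:E s))).
    apply: ge0_le_integral => //.
    - by move=> s _; apply: sume_ge0 => i _; exact: g0.
    - by apply: emeasurable_sum => i.
    - move=> s _; rewrite sumEFin lee_fin.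
      apply: (le_trans (sum_expRB1_le _ _)) => [i|]; first exact: p0.
      rewrite lerD2r ler_expR; apply: le_trans (pv k (y + s)%R).
      by apply: ler_sum => i _; rewrite addrAC.
  rewrite integral_cst// -[leRHS]mule1; apply: lee_pmul => //; last exact: kap1.
  by rewrite lee_fin expRB1_ge0.
have J0 m' y : 0 <= born j m m' y.
  by rewrite /born; apply: integral_ge0 => s _; apply: g0.
have Jfin m' y : born j m m' y \is a fin_num.
  rewrite ge0_fin_numE//; apply: (@le_lt_trans _ _ (expR (v j m') - 1)%:E).
    by have := Jk m' 1%N y; rewrite big_ord1 mul0r addr0.
  by rewrite ltry.
split => /=.
- apply: measurable_funD => //; apply: measurable_sum => m'.
  apply: measurable_funM => //; apply: measurableT_comp => //.
  apply: (@measurable_fun_fubini_tonelli_F _ _ _ _ _ (kap m m') _ (mg m')) => z; exact: g0.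
- by move=> y; apply: addr_ge0 => //; apply: sumr_ge0 => m' _; rewrite mulr_ge0// fine_ge0//; exact: J0.
- move=> k y; rewrite big_split/= exchange_big/=.
  apply: le_trans (vS j m); apply: lerD; first exact: FT.
  apply: ler_sum => m' _.
  rewrite -mulr_sumr ler_wpM2l// -lee_fin; apply: le_trans (Jk m' k y).
  by rewrite -sumEFin; apply: lee_sum => i _; rewrite fineK//; exact: Jfin.
Qed.

Lemma born_fin_num j m m' y : born j m m' y \is a fin_num.
Proof.
have [mp p0 pv] := psi_spec j m'.
have bd (z : R) : (expR (psi j m' z) - 1 <= expR (v j m') - 1)%R.
  by rewrite lerD2r ler_expR; have := pv 1%N z; rewrite big_ord1 mul0r addr0.
rewrite ge0_fin_numE; last first.
  by apply: integral_ge0 => s _; rewrite lee_fin expRB1_ge0.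
apply: (@le_lt_trans _ _ (\int[kap m m']_s (cst (expR (v j m') - 1)%:E s))).
  apply: ge0_le_integral => //.
  - by move=> s _; rewrite lee_fin expRB1_ge0.
  - apply/measurable_EFinP; apply: measurable_funB => //.
    apply: measurableT_comp => //; apply: measurableT_comp => //; exact: measurable_funD.
  - by move=> s _; rewrite lee_fin.
rewrite integral_cst// ltey_eq fin_numM// fin_num_measure//.
Qed.

Lemma integral_psi_le j m a (k : nat) : (0 < T)%R ->
  \int[lebesgue_measure]_(x in `[a, (a + k%:R * T)%R[) (expR (psi j m x) - 1)%:E <=
  (T * (expR (v j m) - 1))%:E.
Proof.
move=> T0; have [mp p0 pv] := psi_spec j m.
apply: integral_periodization_le => //.
- by apply: measurable_funB => //; exact: measurableT_comp.
- by move=> x; exact: expRB1_ge0.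
- move=> x; apply: (le_trans (sum_expRB1_le _ _)) => [i|]; first exact: p0.
  by rewrite lerD2r ler_expR.
Qed.

End log_laplace.

(** * Row sums of the powers of the matrix and the sequence [v] *)

Section row_sums.
Local Open Scope ring_scope.
Context (R : realType) (M : nat) (A : 'M[R]_M) (r K theta : R).
Hypothesis A0 : forall m m', 0 <= A m m'.
Hypotheses (r0 : 0 < r) (r1 : r < 1) (K0 : 0 <= K) (theta0 : 0 <= theta).
Hypothesis AK : forall n, (1 <= n)%N -> opnorm_infty (A ^+ n) <= K * r ^+ n.
Hypothesis theta_le : theta * C_rK r K <= ln ((1 + r) / (2 * r)).

Let rho := (1 + r) / (2 * r).

Definition row_sum (k : nat) (m : 'I_M) : R := \sum_m' (A ^+ k) m m'.

(** The solution of the linear recursion in which [rho * v] replaces [expR v - 1]. *)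
Definition potential (j : nat) (m : 'I_M) : R :=
  theta * \sum_(k < j.+1) rho ^+ k * row_sum k m.

Lemma row_sum0 m : row_sum 0 m = 1.
Proof.
rewrite /row_sum expr0 (bigD1 m)//= big1 ?addr0; first by rewrite mxE eqxx.
by move=> i im; rewrite mxE eq_sym (negbTE im).
Qed.

Lemma row_sumS k m : row_sum k.+1 m = \sum_m' A m m' * row_sum k m'.
Proof.
rewrite /row_sum; under eq_bigr do rewrite exprS -mulmxE mxE.
by rewrite exchange_big; apply: eq_bigr => i _; rewrite mulr_sumr.
Qed.

Lemma row_sum_ge0 k m : 0 <= row_sum k m.
Proof.
elim: k m => [|k IH] m; first by rewrite row_sum0.
by rewrite row_sumS sumr_ge0// => i _; rewrite mulr_ge0.
Qed.

Lemma row_sum_le k m : row_sum k.+1 m <= K * r ^+ k.+1.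
Proof.
apply: le_trans (AK (ltn0Sn k)); rewrite /opnorm_infty.
apply: le_trans (le_bigmax _ _ m).
by apply: ler_sum => i _; exact: ler_norm.
Qed.

Let rho_gt1 : 1 < rho.
Proof.
by rewrite /rho ltr_pdivlMr ?mulr_gt0// mul1r mulr_natl mulr2n ltrD2r.
Qed.

(** The term [k = 0], not covered by the bound on the powers, is the 1 in [C_rK]; the others are
    dominated by [K] times a geometric series of ratio [rho * r = (1 + r) / 2]. *)
Lemma potential_le j m : potential j m <= theta * C_rK r K.
Proof.
rewrite /potential ler_wpM2l//.
have r0' := r0; have r1' := r1.
have geo n : \sum_(k < n) ((1 + r) / 2) ^+ k.+1 <= 2 / (1 - r) :> R.
  (* The factor [(1 - r) / 2] is 1 minus the ratio; the right-hand side is then bounded by 1, which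
     gives [2 / (1 - r)]. *)
  have E : (1 - r) / 2 * \sum_(k < n) ((1 + r) / 2) ^+ k.+1 =
      (1 + r) / 2 * (1 - ((1 + r) / 2) ^+ n) :> R.
    elim: n => [|n IH]; first by rewrite big_ord0 expr0 subrr !mulr0.
    by rewrite big_ord_recr /= mulrDr IH !exprS; field.
  rewrite ler_pdivlMr ?subr_gt0// mulrC.
  suff : (1 - r) / 2 * \sum_(k < n) ((1 + r) / 2) ^+ k.+1 <= 1 :> R by lra.
  rewrite E; have : 0 <= ((1 + r) / 2) ^+ n :> R by rewrite exprn_ge0//; lra.
  set x := _ ^+ n; nra.
rewrite big_ord_recl expr0 mul1r row_sum0 /C_rK lerD2l.
apply: (@le_trans _ _ (K * \sum_(k < j) ((1 + r) / 2) ^+ k.+1)).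
  rewrite mulr_sumr; apply: ler_sum => k _; rewrite lift0.
  rewrite (_ : (1 + r) / 2 = rho * r); last by rewrite /rho; field; rewrite gt_eqF.
  rewrite [in leRHS]exprMn [leRHS]mulrCA ler_wpM2l ?exprn_ge0//; last exact: row_sum_le.
  by rewrite ltW// (lt_trans ltr01).
by apply: le_trans (ler_wpM2l K0 (geo j)) _; rewrite mulrCA mulrA.
Qed.

Lemma potential0 m : theta <= potential 0 m.
Proof. by rewrite /potential big_ord1 expr0 mul1r row_sum0 mulr1. Qed.

(** By the equation for [potential j.+1], it remains to see that [expR x - 1 <= rho * x] at
    [x = potential j m']. This follows from [expR x - 1 <= x * expR x], a form of
    [1 - x <= expR (- x)], and from [expR x <= rho], which is where the smallness of [theta]
    enters. *)
Lemma potentialS j m :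
  theta + \sum_(m' < M) A m m' * (expR (potential j m') - 1) <= potential j.+1 m.
Proof.
rewrite {2}/potential big_ord_recl expr0 mul1r row_sum0 mulrDr mulr1 lerD2l.
under [X in theta * X]eq_bigr do rewrite row_sumS.
under [X in theta * X]eq_bigr do rewrite mulr_sumr.
rewrite exchange_big mulr_sumr; apply: ler_sum => m' _ /=.
rewrite (_ : theta * _ = A m m' * (rho * potential j m')); last first.
  rewrite /potential (mulrCA rho theta) (mulrCA (A m m') theta); congr (theta * _).
  by rewrite !mulr_sumr; apply: eq_bigr => k _; rewrite /bump leq0n add1n exprS; ring.
rewrite ler_wpM2l//; set x := potential j m'.
have x0 : 0 <= x.
  rewrite /x /potential mulr_ge0// sumr_ge0// => k _.
  by rewrite mulr_ge0 ?row_sum_ge0// exprn_ge0// ltW// (lt_trans ltr01).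
have xr : expR x <= rho.
  rewrite -(@lnK _ rho) ?posrE ?(lt_trans ltr01)// ler_expR.
  exact: le_trans (potential_le j m') theta_le.
have e0 := expR_gt0 x.
have xe : expR x * (1 - x) <= 1.
  by rewrite -ler_pdivlMl// mulr1 -expRN expR_ge1Dx.
have : x * expR x <= x * rho by rewrite ler_wpM2l.
by nra.
Qed.

End row_sums.

(** * Exponential moments of a cluster *)

Section labels.
Variable k : nat.

Fixpoint gen (n : nat) : seq label :=
  if n is n'.+1 then [seq rcons u j | u <- gen n', j <- iota 0 k] else [:: [::]].

Fixpoint below (n : nat) : seq label :=
  if n is n'.+1 then below n' ++ gen n' else [::].

Lemma mem_gen n u : (u \in gen n) = (size u == n) && all (fun j => j < k)%N u.
Proof.
elim: n u => [|n IH] u /=; first by rewrite inE; case: u.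
apply/allpairsP/idP => [[[v j] /= [vg]]|].
  rewrite mem_iota add0n /= => jk ->; move: vg; rewrite IH => /andP[/eqP <- va].
  by rewrite size_rcons eqxx all_rcons jk va.
case/lastP: u => // v j; rewrite size_rcons eqSS all_rcons => /and3P[vn jk va].
by exists (v, j); split => //=; rewrite ?mem_iota// IH vn va.
Qed.

Lemma mem_below n u : (u \in below n) = (size u < n)%N && all (fun j => j < k)%N u.
Proof.
elim: n => //= n IH; rewrite mem_cat IH mem_gen -andb_orl.
by rewrite [in RHS]ltnS [in RHS]leq_eqVlt orbC.
Qed.

Lemma rcons_pair_inj : injective (fun p : label * nat => rcons p.1 p.2).
Proof. by move=> [u i] [v j] /= /rcons_inj[-> ->]. Qed.

Lemma gen_uniq n : uniq (gen n).
Proof.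
elim: n => //= n IH; apply: allpairs_uniq => //; first exact: iota_uniq.
by move=> [u i] [v j] _ _ /= /rcons_inj[-> ->].
Qed.

Lemma below_uniq n : uniq (below n).
Proof.
elim: n => //= n IH; rewrite cat_uniq IH gen_uniq andbT /=.
apply/hasPn => u; rewrite mem_gen mem_below => /andP[/eqP -> _].
by rewrite ltnn.
Qed.

Lemma prefix_below n u v : u ++ v \in below n -> u \in below n.
Proof.
rewrite !mem_below size_cat all_cat => /andP[un /andP[-> _]].
by rewrite andbT (leq_ltn_trans _ un)// leq_addr.
Qed.

End labels.

(** * Measurability on the space of clusters *)

Section cluster_measurability.
Context (R : realType) (M : nat).

(** A label outside the tree gives the neutral factor 1, so that products run over a fixed list of
    labels; the shift by [x] moves to [x] a cluster born at 0. *)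
Definition val (g : 'I_M -> R -> R) (x : R) (o : option ('I_M * R)) : R :=
  if o is Some (m, s) then g m (x + s)%R else 1%R.

Lemma measurable_tp (u : label) (m : 'I_M) :
  measurable [set c : cluster_space M R | tp c u = Some m].
Proof.
apply: sub_sigma_algebra; exists u, m, setT; split => //.
apply/seteqP; split => c /=; rewrite /tp.
  by case: (c u) => [[m' y]|//] /= [->]; exists y.
by move=> [y _ ->].
Qed.

Lemma measurable_tp_eq (u : label) (m : 'I_M) :
  measurable_fun setT (fun c : cluster_space M R => tp c u == Some m).
Proof.
apply: (measurable_fun_bool true); rewrite setTI.
rewrite (_ : _ @^-1` _ = [set c : cluster_space M R | tp c u = Some m]).
  exact: measurable_tp.
by apply/seteqP; split => c /= /eqP.
Qed.

(** Stated for any measurable space [T], so as to serve both on the space of clusters and for the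
    sigma-algebra of the typed tree. *)
Lemma measurable_None d (T : measurableType d) (C : T -> Defs.cluster M R) (u : label) :
  (forall m, measurable [set t | tp (C t) u = Some m]) ->
  measurable [set t | tp (C t) u = None].
Proof.
move=> mtp.
rewrite (_ : [set t | _] = ~` \bigcup_(m in [set: 'I_M]) [set t | tp (C t) u = Some m]).
  by apply: measurableC; apply: fin_bigcup_measurable.
apply/seteqP; split => c /= H; first by move=> [m _ /=]; rewrite H.
by case E : (tp (C c) u) => [m|//]; exfalso; apply: H; exists m.
Qed.

Lemma measurable_tp_None (u : label) :
  measurable [set c : cluster_space M R | tp c u = None].
Proof. by apply: measurable_None => m; exact: measurable_tp. Qed.

Lemma measurable_bd (u : label) :
  measurable_fun setT (fun c : cluster_space M R => bd c u).
Proof.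
move=> _ B mB; rewrite setTI.
rewrite (_ : _ @^-1` B = (\bigcup_(m in [set: 'I_M])
     [set c : cluster_space M R | exists2 y, B y & c u = Some (m, y)]) `|`
   ([set c : cluster_space M R | tp c u = None] `&` [set c | B 0%R])).
  apply: measurableU.
    apply: fin_bigcup_measurable => // m _; apply: sub_sigma_algebra.
    by exists u, m, B.
  apply: measurableI; first exact: measurable_tp_None.
  have [B0|B0] := pselect (B 0%R).
    rewrite (_ : [set c : cluster_space M R | B 0%R] = setT); first exact: measurableT.
    by apply/seteqP; split.
  rewrite (_ : [set c : cluster_space M R | B 0%R] = set0); first exact: measurable0.
  by apply/seteqP; split.
apply/seteqP; split => c /=; rewrite /bd /tp.
  by case E : (c u) => [[m y]|] /= By; [left; exists m => //; exists y|right].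
by move=> [[m _ [y By ->]]|[]]//; case: (c u) => [[m y]|].
Qed.

(** Separates the type of [u] from its birth date, each of which is known to be measurable. *)
Lemma valE (g : 'I_M -> R -> R) (x : R) (c : Defs.cluster M R) (u : label) :
  val g x (c u) = (\prod_(m < M) (if tp c u == Some m then g m (x + bd c u) else 1))%R.
Proof.
rewrite /tp /bd; case: (c u) => [[m s]|] /=; last by rewrite big1.
rewrite (bigD1 m)//= eqxx big1 ?mulr1// => i im.
by rewrite ifF//; apply/eqP => -[mi]; rewrite mi eqxx in im.
Qed.

Lemma measurable_val d (T : measurableType d) (g : 'I_M -> R -> R) (x : T -> R)
    (C : T -> cluster_space M R) (u : label) :
  (forall m, measurable_fun setT (g m)) -> measurable_fun setT x ->
  measurable_fun setT C -> measurable_fun setT (fun t => val g (x t) (C t u)).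
Proof.
move=> mg mx mC; under eq_fun do rewrite valE.
apply: measurable_prod => m _; apply: measurable_fun_ifT => //.
  exact: (measurableT_comp (measurable_tp_eq u m) mC).
apply: measurableT_comp => //; apply: measurable_funD => //.
exact: (measurableT_comp (measurable_bd u) mC).
Qed.

(* The contribution of the child [rcons u j] of u once its delay is integrated. *)
Definition edge_val (g : 'I_M -> 'I_M -> R -> R) (x : R) (c : Defs.cluster M R)
    (u : label) (j : nat) : R :=
  if tp c (rcons u j) is Some m then val (g^~ m) x (c u) else 1%R.

Lemma measurable_edge_val d (T : measurableType d) (g : 'I_M -> 'I_M -> R -> R)
    (x : R) (C : T -> cluster_space M R) (u : label) (j : nat) :
  (forall m m', measurable_fun setT (g m m')) ->
  measurable_fun setT C -> measurable_fun setT (fun t => edge_val g x (C t) u j).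
Proof.
move=> mg mC.
rewrite (_ : (fun t => _) = (fun t => \prod_(m < M)
   (if tp (C t) (rcons u j) == Some m then val (g^~ m) x (C t u) else 1))%R).
  apply: measurable_prod => m _; apply: measurable_fun_ifT => //.
    exact: (measurableT_comp (measurable_tp_eq (rcons u j) m) mC).
  exact: measurable_val.
apply/funext => t; rewrite /edge_val; case: (tp (C t) (rcons u j)) => [m|]; last by rewrite big1.
rewrite (bigD1 m)//= eqxx big1 ?mulr1// => i im.
by rewrite ifF//; apply/eqP => -[mi]; rewrite mi eqxx in im.
Qed.

(** A countable sum of indicators of type events, hence measurable for any sigma-algebra that
    contains them, that of the typed tree in particular. *)
Lemma measurable_nb_children d (T : measurableType d) (C : T -> Defs.cluster M R)
    (u : label) (m : 'I_M) :
  (forall v, measurable [set t | tp (C t) v = Some m]) ->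
  measurable_fun setT (fun t => nb_children (C t) u m).
Proof.
move=> mtp.
rewrite (_ : (fun t => _) = (fun t =>
    \sum_(n <oo) (\1_[set t | tp (C t) (rcons u n) = Some m] t)%:E)).
  apply: ge0_emeasurable_sum => [n c _ _|n _]; first by rewrite lee_fin.
  by apply/measurable_EFinP; exact: measurable_indic.
apply/funext => c; rewrite /nb_children counting_dirac; apply: eq_eseriesr => n _.
by rewrite diracE indicE; congr ((nat_of_bool _)%:R%:E); apply/idP/idP => /set_mem H; apply/mem_set.
Qed.

Lemma nb_children_ge (c : Defs.cluster M R) (u : label) (m : 'I_M) (k : nat) :
  (\sum_(j < k) (tp c (rcons u j) == Some m))%N%:R%:E <= nb_children c u m.
Proof.
rewrite /nb_children counting_dirac.
apply: le_trans (nneseries_lim_ge k _) => //.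
rewrite big_mkord natr_sum -sumEFin; apply: lee_sum => j _.
rewrite diracE lee_fin ler_nat; case: eqP => // tpj.
by rewrite mem_set.
Qed.

End cluster_measurability.

(** * Typed tree and delays of one random cluster *)

Section random_cluster.
Context (R : realType) (M : nat) d (Om : measurableType d) (P : probability Om R)
  (h : 'I_M -> 'I_M -> R -> R) (m0 : 'I_M) (G : Om -> Defs.cluster M R).
Hypothesis HG : is_random_cluster P h m0 0%R G.
Context (kap : 'I_M -> 'I_M -> {finite_measure set R -> \bar R}).
Hypothesis kapE : forall m m' B, measurable B -> kap m m' B = delay_law (h m m') B.

Definition types_on (l : seq label) (s : label -> option 'I_M) : set Om :=
  [set w | forall u, u \in l -> tp (G w) u = s u].

Definition delta (e : label * nat) (w : Om) : R :=
  (bd (G w) (rcons e.1 e.2) - bd (G w) e.1)%R.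

(** A pi-system generating the sigma-algebra of the delays along the edges of [s]; on it the
    independence of delays is directly available. *)
Definition delay_rects (s : seq (label * nat)) : set (set Om) :=
  [set E | exists B : label * nat -> set R, (forall e, measurable (B e)) /\
     E = [set w | forall e, e \in s -> B e (delta e w)]].

Let mG : measurable_fun setT (G : Om -> cluster_space M R) := cluster_measurable HG.

Lemma measurable_tree_tp u o : measurable [set w | tp (G w) u = o].
Proof.
case: o => [m|]; rewrite -[X in measurable X]setTI.
  exact: (mG measurableT (measurable_tp u m)).
exact: (mG measurableT (@measurable_tp_None R M u)).
Qed.

Lemma types_onE l s :
  types_on l s = \bigcap_(u in [set` l]) [set w | tp (G w) u = s u].
Proof. by []. Qed.

Lemma measurable_types_on l s : measurable (types_on l s).
Proof.
by rewrite types_onE; apply: fin_bigcap_measurable => // u _; exact: measurable_tree_tp.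
Qed.

Lemma measurable_delta e : measurable_fun setT (delta e).
Proof.
by apply: measurable_funB; exact: (measurableT_comp (@measurable_bd R M _) mG).
Qed.

(* There are finitely many typings of l, so that the types can be taken as fixed. *)
Lemma typed_split (l : seq label) (F F' : Om -> \bar R) :
  uniq l -> measurable_fun setT F -> measurable_fun setT F' ->
  (forall w, 0 <= F w) -> (forall w, 0 <= F' w) ->
  (forall s, \int[P]_(w in types_on l s) F w <= \int[P]_(w in types_on l s) F' w) ->
  \int[P]_w F w <= \int[P]_w F' w.
Proof.
move=> ul mF mF' F0 F'0 H.
suff: forall A, measurable A ->
    (forall s, \int[P]_(w in A `&` types_on l s) F w <=
               \int[P]_(w in A `&` types_on l s) F' w) ->
    \int[P]_(w in A) F w <= \int[P]_(w in A) F' w.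
  by apply=> // s; rewrite setTI.
elim: l ul {H} => [_ A mA /(_ (fun=> None))|u l IH /= /andP[ul unl] A mA H].
  by rewrite (_ : _ `&` _ = A)//; apply/seteqP; split=> // w [].
pose D (o : option 'I_M) := A `&` [set w | tp (G w) u = o].
have mD o : measurable (D o) by apply: measurableI => //; exact: measurable_tree_tp.
have AD : A = \big[setU/set0]_(o <- enum {: option 'I_M}) D o.
  rewrite -bigcup_seq; apply/seteqP; split => [w Aw|w [a _ [Aw _]]]; last exact: Aw.
  by exists (tp (G w) u) => //=; rewrite mem_enum.
have tD : trivIset [set` enum {: option 'I_M}] D.
  by move=> o o' _ _ [w [[_ /= <-] [_ /= <-]]].
rewrite AD !ge0_integral_bigsetU//; last 4 first.
- exact: enum_uniq.
- exact: measurable_funTS.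
- exact: enum_uniq.
- exact: measurable_funTS.
apply: lee_sum => o _; apply: IH => // s.
have := H (fun v => if v == u then o else s v).
suff -> : A `&` types_on (u :: l) (fun v => if v == u then o else s v) =
    D o `&` types_on l s by [].
rewrite -setIA; congr (A `&` _); apply/seteqP; split => w /=.
- move=> Hw; split; first by have := Hw u (mem_head _ _); rewrite eqxx.
  move=> v vl; have := Hw v; rewrite inE vl orbT => /(_ isT).
  by case: eqP vl => // ->; rewrite (negbTE ul).
- move=> [Hu Hw] v; rewrite inE; case: eqP => [-> //|vu /= vl]; exact: Hw.
Qed.

Lemma delay_rects_measurable s : delay_rects s `<=` measurable.
Proof.
move=> _ [B [mB ->]].
rewrite (_ : [set w | _] = \bigcap_(e in [set` s]) (delta e @^-1` B e))//.
apply: fin_bigcap_measurable => // e _.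
rewrite -[X in measurable X]setTI; exact: measurable_delta.
Qed.

Lemma delay_rectsI s : setI_closed (delay_rects s).
Proof.
move=> _ _ [B [mB ->]] [B' [mB' ->]]; exists (fun e => B e `&` B' e); split.
  by move=> e; exact: measurableI.
apply/seteqP; split => w /= H; first by move=> e es; split; [exact: H.1|exact: H.2].
by split=> e es; have [] := H e es.
Qed.

Lemma delay_rectsT s : delay_rects s setT.
Proof. by exists (fun=> setT); split => //; apply/seteqP. Qed.

Lemma measurable_delta_sub s e : e \in s ->
  measurable_fun setT (delta e : g_sigma_algebraType (delay_rects s) -> R).
Proof.
move=> es _ B mB; rewrite setTI; apply: sub_sigma_algebra.
exists (fun e' => if e' == e then B else setT); split => [e'|].
  by case: eqP.
apply/seteqP; split => w /= H; last by have := H e es; rewrite eqxx.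
by move=> e' _; case: eqP => [->|].
Qed.

Lemma bd_root w : bd (G w) [::] = 0%R.
Proof. by rewrite /bd (cluster_root HG). Qed.

(** The root is born at 0, so the birth date of [u] is the sum of the delays along the path from the
    root; the hypothesis says that all edges of this path are in [s]. *)
Lemma measurable_bd_sub s u :
  (forall v j t, u = rcons v j ++ t -> (v, j) \in s) ->
  measurable_fun setT ((fun w => bd (G w) u) : g_sigma_algebraType (delay_rects s) -> R).
Proof.
elim/last_ind: u => [_|u j IH H].
  by under eq_fun do rewrite bd_root; exact: measurable_cst.
rewrite (_ : (fun w => _) = (fun w => bd (G w) u + delta (u, j) w)%R); last first.
  by apply/funext => w; rewrite /delta /= addrCA subrr addr0.
apply: measurable_funD; last by apply: measurable_delta_sub; apply: (H u j [::]); rewrite cats0.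
by apply: IH => v i t ut; apply: (H v i (rcons t j)); rewrite ut rcons_cat.
Qed.


Let typed (D : set label) : set (set Om) :=
  [set A | exists (u : label) (m : 'I_M), D u /\ A = [set w | tp (G w) u = Some m]].

Lemma typed_tp (D : set label) u m : D u ->
  measurable ([set w | tp (G w) u = Some m] : set (g_sigma_algebraType (typed D))).
Proof. by move=> Du; apply: sub_sigma_algebra; exists u, m. Qed.

Lemma typed_types_on (D : set label) l s : (forall u, u \in l -> D u) ->
  typed_tree_sigma G D (types_on l s).
Proof.
move=> lD.
have : measurable (types_on l s : set (g_sigma_algebraType (typed D))).
  rewrite types_onE; apply: fin_bigcap_measurable => // u /= /lD Du.
  case: (s u) => [m|]; first exact: typed_tp.
  by apply: (@measurable_None _ _ _ (g_sigma_algebraType (typed D))) => m; exact: typed_tp.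
by [].
Qed.

(** Numbers of children are functions of the typed tree; hence delays are still independent once
    these numbers are prescribed. *)
Lemma typed_nb_children (l : seq label) (k : label -> 'I_M -> nat) :
  typed_tree_sigma G setT [set w | forall u, u \in l ->
     forall m, nb_children (G w) u m = (k u m)%:R%:E].
Proof.
pose TS := g_sigma_algebraType (typed setT).
have : measurable (\bigcap_(u in [set` l]) \bigcap_(m in [set: 'I_M])
    ((fun w : TS => nb_children (G w) u m) @^-1` [set (k u m)%:R%:E]) : set TS).
  apply: fin_bigcap_measurable => // u _; apply: fin_bigcap_measurable => // m _.
  rewrite -[X in measurable X]setTI.
  by apply: (measurable_nb_children (T := TS)) => // v; exact: typed_tp.
congr (measurable _); apply/seteqP; split => w H u ul m; first exact: H.
by move=> _; exact: H.
Qed.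

Lemma tree_prefix g u t : is_tree g -> in_tree g (u ++ t) -> @in_tree M R g u.
Proof.
move=> [_ tg]; elim/last_ind: t => [|t i IH]; first by rewrite cats0.
by rewrite -rcons_cat => /tg[/IH].
Qed.

Section truncation.
Variables (k N : nat) (s : label -> option 'I_M).

(** The edges of the tree under the typing [s]. Testing the child suffices, since in a tree the
    parent of an individual is an individual; see [types_on_alive]. *)
Definition alive_edges : seq (label * nat) :=
  [seq e <- [seq (u, j) | u <- below k N, j <- iota 0 k] |
     (rcons e.1 e.2 \in below k N) && (s (rcons e.1 e.2) != None)].

Lemma alive_edges_uniq : uniq alive_edges.
Proof.
apply: filter_uniq; apply: allpairs_uniq; [exact: below_uniq|exact: iota_uniq|].
by move=> [u i] [v j].
Qed.

Lemma mem_alive_edges e : (e \in alive_edges) =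
  (rcons e.1 e.2 \in below k N) && (s (rcons e.1 e.2) != None).
Proof.
case: e => u j; rewrite mem_filter /= andb_idr// => /andP[uj _].
apply/allpairsP; exists (u, j); split => //=.
  by apply: (@prefix_below k N u [:: j]); rewrite cats1.
by move: uj; rewrite mem_below all_rcons mem_iota add0n => /and3P[].
Qed.

(** A total typing, the form in which the laws of offspring and delays take the types; the default
    [m0] concerns only labels outside the tree. *)
Definition ty (u : label) : 'I_M := odflt m0 (s u).

Lemma types_on_alive w u t : types_on (below k N) s w -> u ++ t \in below k N ->
  s (u ++ t) != None -> [/\ u \in below k N, tp (G w) u = s u & s u = Some (ty u)].
Proof.
move=> Aw utb su; have ub := prefix_below utb.
have := tree_prefix (cluster_tree HG w) (u := u) (t := t).
rewrite /in_tree; move: (Aw _ utb) (Aw _ ub) su; rewrite /tp /ty => <- <- su H.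
split => //; case: (G w u) H => [//|]; rewrite /in_tree => H.
by exfalso; apply: H => // H; rewrite H in su.
Qed.

(** Inside a frozen typing the type conditions of [cluster_delays] hold automatically on alive
    edges, so they drop out of both sides. *)
Lemma delays_indep (A : set Om) (es : seq (label * nat)) (B : label * nat -> set R) :
  typed_tree_sigma G setT A -> A `<=` types_on (below k N) s ->
  uniq es -> {subset es <= alive_edges} -> (forall e, measurable (B e)) ->
  P (A `&` [set w | forall e, e \in es -> B e (delta e w)]) =
  P A * \prod_(e <- es) kap (ty e.1) (ty (rcons e.1 e.2)) (B e).
Proof.
move=> tA As ues eses mB.
have := cluster_delays HG ty tA ues (fun e _ => mB e) => /=.
rewrite (_ : A `&` [set w | forall v, v \in es -> _ /\ _] = A); last first.
  apply/seteqP; split => [w []//|w Aw]; split => // e /eses; rewrite mem_alive_edges.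
  move=> /andP[eb se].
  have [|| _ -> ->] := @types_on_alive w (rcons e.1 e.2) [::] (As _ Aw); rewrite ?cats0//.
  by have [|| _ -> ->] := @types_on_alive w e.1 [:: e.2] (As _ Aw); rewrite ?cats1.
move=> ->; congr (_ * _); by apply: eq_bigr => e _; rewrite kapE.
Qed.

End truncation.

End random_cluster.

(** * Integrating out the delays of one generation *)

Section delays_step.
Context (R : realType) (M : nat) d (Om : measurableType d) (P : probability Om R)
  (h : 'I_M -> 'I_M -> R -> R) (m0 : 'I_M) (G : Om -> Defs.cluster M R).
Hypothesis HG : is_random_cluster P h m0 0%R G.
Context (kap : 'I_M -> 'I_M -> {finite_measure set R -> \bar R}).
Hypothesis kapE : forall m m' B, measurable B -> kap m m' B = delay_law (h m m') B.
Variables (k n : nat) (x : R) (fw g : 'I_M -> R -> R) (ghat : 'I_M -> 'I_M -> R -> R).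
Hypothesis mfw : forall m, measurable_fun setT (fw m).
Hypothesis fw0 : forall m y, (0 <= fw m y)%R.
Hypothesis mg : forall m, measurable_fun setT (g m).
Hypothesis g0 : forall m y, (0 <= g m y)%R.
Hypothesis mghat : forall m m', measurable_fun setT (ghat m m').
Hypothesis ghat0 : forall m m' y, (0 <= ghat m m' y)%R.
Hypothesis ghatE : forall m m' y,
  \int[kap m m']_s (g m' (y + s)%R)%:E <= (ghat m m' y)%:E.

Let mG : measurable_fun setT (G : Om -> cluster_space M R) := cluster_measurable HG.

Definition kids : seq (label * nat) := [seq (u, j) | u <- gen k n, j <- iota 0 k].

Lemma gen_kids : gen k n.+1 = [seq rcons e.1 e.2 | e <- kids].
Proof. by rewrite /kids /= map_allpairs. Qed.

Lemma kids_uniq : uniq kids.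
Proof.
apply: allpairs_uniq; [exact: gen_uniq|exact: iota_uniq|].
by move=> [u i] [v j].
Qed.

Lemma mem_kids e : e \in kids -> e.1 \in gen k n /\ rcons e.1 e.2 \in gen k n.+1.
Proof.
move=> ek; split; last by rewrite gen_kids; exact: (map_f (fun e => rcons e.1 e.2)).
by case/allpairsP: ek => -[u j] [/= ug _ ->].
Qed.

Section frozen_types.
Variable s : label -> option 'I_M.
Let tys := ty m0 s.
Let A := types_on G (below k n.+2) s.
Let edges := alive_edges k n.+2 s.

(** [at_label] and [at_edge] are [val] and [edge_val] with the types read in [s]: what remains
    random is a birth date, a function of the delays. *)
Let at_label (phi : 'I_M -> R -> R) (u : label) (w : Om) : R :=
  if s u is Some m then phi m (x + bd (G w) u)%R else 1%R.
Let at_edge (e : label * nat) (w : Om) : R :=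
  if (s e.1, s (rcons e.1 e.2)) is (Some m, Some m') then
    ghat m m' (x + bd (G w) e.1)%R else 1%R.

Let mA : measurable A. Proof. exact: (measurable_types_on HG). Qed.

(** The birth date of [u] ignores the delay of [e] when [u] is neither the child in [e] nor one of
    its descendants. A point of [A] is used to know that the path to [u] consists of alive edges. *)
Let measurable_at e u (phi : R -> R) : A !=set0 ->
  u \in below k n.+2 -> s u != None -> (forall t, u <> rcons e.1 e.2 ++ t) ->
  measurable_fun setT phi ->
  measurable_fun setT ((fun w => phi (x + bd (G w) u)%R) :
    g_sigma_algebraType (delay_rects G (rem e edges)) -> R).
Proof.
move=> [w0 Aw0] ub su une mphi; apply: measurableT_comp => //.
apply: measurable_funD => //; apply: (measurable_bd_sub HG) => v j t uE.
rewrite mem_rem_uniq ?alive_edges_uniq// inE; apply/andP; split.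
  by apply/eqP => vje; apply: (une t); rewrite -vje.
rewrite mem_alive_edges /=.
have ub' : rcons v j ++ t \in below k n.+2 by rewrite -uE.
have su' : s (rcons v j ++ t) != None by rewrite -uE.
by have [-> _ ->] := types_on_alive HG Aw0 ub' su'.
Qed.

(** On [A] the delay of [e] is independent of the other delays, on which both [Y] and the birth date
    of the parent depend. Freezing them leaves a [kap]-integral of [g], bounded by [ghat]. *)
Lemma delay_out e m (Y : Om -> R) : A !=set0 ->
  e \in edges -> s (rcons e.1 e.2) = Some m ->
  measurable_fun setT (Y : g_sigma_algebraType (delay_rects G (rem e edges)) -> R) ->
  (forall w, 0 <= Y w)%R ->
  \int[P]_(w in A) (Y w * g m (x + bd (G w) (rcons e.1 e.2)))%:E <=
  \int[P]_(w in A) (Y w * ghat (tys e.1) m (x + bd (G w) e.1))%:E.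
Proof.
move=> A0 eE se mY Y0; have [w0 Aw0] := A0.
pose GG := delay_rects G (rem e edges).
have GGm : GG `<=` measurable by exact: (delay_rects_measurable HG).
have eb : rcons e.1 e.2 \in below k n.+2 by move: eE; rewrite mem_alive_edges => /andP[].
have [e1b e1A e1s] : [/\ e.1 \in below k n.+2, tp (G w0) e.1 = s e.1 & s e.1 = Some (tys e.1)].
  by apply: (types_on_alive HG Aw0 (t := [:: e.2])); rewrite cats1 ?se.
have mphi (phi : R -> R) : measurable_fun setT phi ->
    measurable_fun setT ((fun w => phi (x + bd (G w) e.1)%R) : g_sigma_algebraType GG -> R).
  apply: measurable_at => //; first by rewrite e1s.
  (* The parent is too short a label to descend from its child. *)
  by move=> t /(congr1 size); rewrite size_cat size_rcons => /eqP; rewrite eqn_leq addSn ltnNge leq_addr andbF.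
pose Phi (z : g_sigma_algebraType GG * R) : \bar R :=
  (Y z.1 * g m (x + bd (G z.1) e.1 + z.2))%:E.
have mPhi : measurable_fun setT Phi.
  apply/measurable_EFinP; apply: measurable_funM.
    exact: (measurableT_comp mY measurable_fst).
  apply: measurableT_comp => //; apply: measurable_funD => //.
  exact: (measurableT_comp (mphi id (@measurable_id _ _ setT)) measurable_fst).
have Phi0 z : 0 <= Phi z by rewrite lee_fin mulr_ge0.
pose Q : {finite_measure set Om -> \bar R} := [the {finite_measure set Om -> \bar R} of mrestr P mA].
have mbd u : measurable_fun setT (fun w => bd (G w) u).
  exact: (measurableT_comp (@measurable_bd R M u) mG).
have mYO : measurable_fun setT Y by exact: (measurable_fun_sub GGm).
have mgO m' u : measurable_fun setT (fun w => g m' (x + bd (G w) u)%R).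
  by apply: measurableT_comp => //; exact: measurable_funD.
have bdE w : (x + bd (G w) (rcons e.1 e.2) = x + bd (G w) e.1 + delta G e w)%R.
  by rewrite /delta -addrA [X in (_ = _ + X)%R]addrCA subrr addr0.
have mdel : measurable_fun setT (delta G e) := measurable_delta HG e.
have -> : \int[P]_(w in A) (Y w * g m (x + bd (G w) (rcons e.1 e.2)))%:E =
    \int[Q]_w Phi (w, delta G e w).
  rewrite (ge0_integral_mrestr P mA).
  - by apply: eq_integral => w _; rewrite bdE.
  - under eq_fun => w do rewrite /Phi /= -bdE.
    by apply/measurable_EFinP; exact: measurable_funM.
  - by move=> w; exact: Phi0.
have -> : \int[P]_(w in A) (Y w * ghat (tys e.1) m (x + bd (G w) e.1))%:E =
    \int[Q]_w (Y w * ghat (tys e.1) m (x + bd (G w) e.1))%:E.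
  rewrite (ge0_integral_mrestr P mA)//.
    apply/measurable_EFinP; apply: measurable_funM => //.
    by apply: measurableT_comp => //; exact: measurable_funD.
  by move=> w; rewrite lee_fin mulr_ge0.
(* Joint independence is used twice, for all alive edges with [B] imposed at [e], and for all edges
   but [e]; the two products differ by the factor at [e]. *)
have XI : forall E B, GG E -> measurable B ->
    Q (E `&` delta G e @^-1` B) = Q E * kap (tys e.1) m B.
  move=> _ B [B' [mB' ->]] mB.
  have tA : typed_tree_sigma G setT A by exact: typed_types_on.
  have sub : {subset rem e edges <= edges} by move=> e'; exact: mem_rem.
  pose B2 e' := if e' == e then B else B' e'.
  have mB2 e' : measurable (B2 e') by rewrite /B2; case: eqP.
  have := delays_indep HG kapE tA (fun _ h => h) (alive_edges_uniq _ _ _) (fun _ h => h) mB2.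
  have tysm : tys (rcons e.1 e.2) = m by rewrite /tys /ty se.
  have B2e : B2 e = B by rewrite /B2 eqxx.
  rewrite (big_rem e eE) /= B2e -/tys tysm.
  rewrite (eq_big_seq (fun e' => kap (tys e'.1) (tys (rcons e'.1 e'.2)) (B' e'))); last first.
    move=> e' e'E; rewrite /B2; case: eqP e'E => // ->.
    by rewrite mem_rem_uniq ?alive_edges_uniq// !inE eqxx.
  rewrite /Q /= /mrestr.
  have := delays_indep HG kapE tA (fun _ h => h) (rem_uniq e (alive_edges_uniq _ _ _)) sub mB'.
  rewrite -/edges -/A -/tys => H1 H2.
  rewrite [X in _ = P X * _]setIC H1 -muleA [X in _ = _ * X]muleC -H2.
  congr (P _); apply/seteqP; split => w.
    move=> [[/= Hr eB] Aw]; split => // e'; have [-> _|e'e e'E] := eqVneq e' e.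
      by rewrite B2e.
    by rewrite /B2 (negbTE e'e); apply: Hr; rewrite mem_rem_uniq ?alive_edges_uniq// inE e'e.
  move=> [Aw /= He]; split => //; split => /=; last by rewrite -B2e; exact: He.
  move=> e' e'r; have := He e' (sub _ e'r); rewrite /B2; case: eqP e'r => // ->.
  by rewrite mem_rem_uniq ?alive_edges_uniq// !inE eqxx.
rewrite (freeze GGm (delay_rectsI (s := rem e edges)) (delay_rectsT G _) mdel XI mPhi Phi0).
apply: ge0_le_integral => //.
- by move=> w _; apply: integral_ge0.
- apply: (measurable_fun_sub GGm).
  exact: (@measurable_fun_fubini_tonelli_F _ _ _ _ _ (kap (tys e.1) m) _ mPhi).
- apply/measurable_EFinP; apply: measurable_funM => //.
  by apply: measurableT_comp => //; exact: measurable_funD.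
- move=> w _; rewrite /Phi /=; under eq_integral do rewrite EFinM.
  rewrite ge0_integralZl//; last 3 first.
  + by apply/measurable_EFinP; apply: measurableT_comp => //; exact: measurable_funD.
  + by move=> y _; rewrite lee_fin.
  + by rewrite lee_fin.
  by rewrite EFinM; apply: lee_wpmul2l; [rewrite lee_fin|exact: ghatE].
Qed.

Let gen_below i N u : (i < N)%N -> u \in gen k i -> u \in below k N.
Proof. by move=> iN; rewrite mem_gen mem_below => /andP[/eqP -> ->]; rewrite iN. Qed.

Let B (w : Om) : R := (\prod_(u <- below k n.+1) at_label fw u w)%R.

Let at_label_ge0 phi u w : (forall m y, 0 <= phi m y)%R -> (0 <= at_label phi u w)%R.
Proof. by move=> p0; rewrite /at_label; case: (s u). Qed.

Let at_edge_ge0 e w : (0 <= at_edge e w)%R.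
Proof. by rewrite /at_edge; case: (s e.1) => // m; case: (s _). Qed.

Let measurable_at_label e phi u : A !=set0 ->
  u \in below k n.+2 -> (forall t, u <> rcons e.1 e.2 ++ t) ->
  (forall m, measurable_fun setT (phi m)) ->
  measurable_fun setT (at_label phi u : g_sigma_algebraType (delay_rects G (rem e edges)) -> R).
Proof.
move=> A0 ub ue mphi; rewrite /at_label; case E : (s u) => [m|].
  by apply: measurable_at => //; rewrite E.
exact: measurable_cst.
Qed.

Let measurable_at_edge e e' : A !=set0 -> e \in kids -> e' \in kids ->
  measurable_fun setT (at_edge e' : g_sigma_algebraType (delay_rects G (rem e edges)) -> R).
Proof.
move=> A0 /mem_kids[_ ek] /mem_kids[e'k _]; rewrite /at_edge.
case E : (s e'.1) => [m|]; last exact: measurable_cst.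
case: (s (rcons e'.1 e'.2)) => [m'|]; last exact: measurable_cst.
apply: (measurable_at (phi := ghat m m')) => //; last 2 first.
- by rewrite E.
- move=> t /(congr1 size); rewrite size_cat size_rcons.
  move: ek e'k; rewrite !mem_gen size_rcons => /andP[/eqP[->] _] /andP[/eqP -> _] /eqP.
  by rewrite eqn_leq addSn ltnNge leq_addr andbF.
exact: (gen_below _ e'k).
Qed.

(** Kids are treated one at a time: those of [l0] are already replaced by their edge factors. All
    remaining factors ignore the delay of the next kid, as they involve earlier generations or its
    siblings and cousins. *)
Lemma kids_out l0 l1 : A !=set0 -> l0 ++ l1 = kids ->
  \int[P]_(w in A) (B w * \prod_(e <- l0) at_edge e w *
                    \prod_(e <- l1) at_label g (rcons e.1 e.2) w)%:E <=
  \int[P]_(w in A) (B w * \prod_(e <- l0 ++ l1) at_edge e w)%:E.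
Proof.
move=> A0; have [w0 Aw0] := A0; elim: l1 l0 => [|e l1 IH] l0 lk.
  by rewrite cats0; under eq_integral do rewrite big_nil mulr1.
rewrite -cat_rcons; rewrite -cat_rcons in lk.
apply: le_trans (IH (rcons l0 e) lk).
have ek : e \in kids by rewrite -lk mem_cat mem_rcons mem_head.
have [e1k eck] := mem_kids ek.
have eb : rcons e.1 e.2 \in below k n.+2 by exact: (gen_below _ eck).
case E : (s (rcons e.1 e.2)) => [m|]; last first.
  (* A kid absent under [s] contributes 1 on both sides. *)
  rewrite le_eqVlt; apply/orP; left; apply/eqP; apply: eq_integral => w _.
  have a1 : at_label g (rcons e.1 e.2) w = 1%R by rewrite /at_label E.
  have a2 : at_edge e w = 1%R by rewrite /at_edge E; case: (s e.1).
  by rewrite -cats1 big_cat big_seq1 big_cons a1 a2 /= !(mul1r, mulr1).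
have eE : e \in edges by rewrite mem_alive_edges eb E.
have [e1b e1A e1s] : [/\ e.1 \in below k n.+2, tp (G w0) e.1 = s e.1 & s e.1 = Some (tys e.1)].
  by apply: (types_on_alive HG Aw0 (t := [:: e.2])); rewrite cats1 ?E.
pose Y w := (B w * \prod_(e <- l0) at_edge e w * \prod_(e <- l1) at_label g (rcons e.1 e.2) w)%R.
have := delay_out (Y := Y) A0 eE E.
rewrite (_ : \int[P]_(w in A) (Y w * g m (x + bd (G w) (rcons e.1 e.2)))%:E =
  \int[P]_(w in A) (B w * \prod_(e <- l0) at_edge e w *
     \prod_(e <- e :: l1) at_label g (rcons e.1 e.2) w)%:E); last first.
  apply: eq_integral => w _; congr EFin.
  have a1 : at_label g (rcons e.1 e.2) w = g m (x + bd (G w) (rcons e.1 e.2))%R.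
    by rewrite /at_label E.
  by rewrite big_cons a1 /Y; ring.
rewrite (_ : \int[P]_(w in A) (Y w * ghat (tys e.1) m (x + bd (G w) e.1))%:E =
  \int[P]_(w in A) (B w * \prod_(e <- rcons l0 e) at_edge e w *
     \prod_(e <- l1) at_label g (rcons e.1 e.2) w)%:E); last first.
  apply: eq_integral => w _; congr EFin.
  have a2 : at_edge e w = ghat (tys e.1) m (x + bd (G w) e.1)%R.
    by rewrite /at_edge e1s E.
  by rewrite -cats1 big_cat big_seq1 a2 /Y /=; ring.
apply.
  have uk : uniq (rcons l0 e ++ l1) by rewrite lk; exact: kids_uniq.
  have sub e' : e' \in l0 ++ l1 -> e' \in kids.
    move=> e'l; rewrite -lk mem_cat mem_rcons inE; move: e'l; rewrite mem_cat.
    by move=> /orP[->|->]; rewrite ?orbT.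
  apply: measurable_funM; first apply: measurable_funM.
  - apply: measurable_prod => u ub; apply: measurable_at_label => //.
      move: ub; rewrite !mem_below => /andP[un ->].
      by rewrite andbT (leq_trans un).
    move=> t /(congr1 size) ue; move: ub; rewrite mem_below ue size_cat => /andP[+ _].
    move: eck; rewrite mem_gen => /andP[/eqP -> _].
    by rewrite ltnNge leq_addr.
  - apply: measurable_prod => e' e'l; apply: measurable_at_edge => //.
    by apply: sub; rewrite mem_cat e'l.
  - apply: measurable_prod => e' e'l; have e'k : e' \in kids by apply: sub; rewrite mem_cat e'l orbT.
    have [_ e'ck] := mem_kids e'k.
    apply: measurable_at_label => //; first exact: (gen_below _ e'ck).
    (* Two labels of the same generation, one extending the other, are equal, and [kids] has no
       repetition. *)
    move=> t te; have : size (rcons e'.1 e'.2) = size (rcons e.1 e.2 ++ t) by rewrite te.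
    move: eck e'ck; rewrite !mem_gen size_cat => /andP[/eqP -> _] /andP[/eqP -> _].
    move=> /eqP; rewrite -{1}[n.+1]addn0 eqn_add2l eq_sym => /nilP t0.
    move: te; rewrite t0 cats0 => /(@rcons_pair_inj e' e) e'e.
    by move: uk; rewrite cat_rcons cat_uniq /= -e'e => /and3P[_ _ /andP[]]; rewrite e'l.
by move=> w; rewrite !mulr_ge0//; apply: prodr_ge0 => // *; exact: at_label_ge0.
Qed.

Let val_at_label phi u w : A w -> u \in below k n.+2 -> val phi x (G w u) = at_label phi u w.
Proof.
move=> Aw ub; rewrite /at_label -(Aw u ub) /tp /bd /val.
by case: (G w u) => [[m y]|].
Qed.

Let edge_val_at_edge e w : A w -> e \in kids ->
  edge_val ghat x (G w) e.1 e.2 = at_edge e w.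
Proof.
move=> Aw /mem_kids[e1 e2]; rewrite /edge_val /at_edge.
rewrite -(Aw _ (gen_below (ltnSn _) e2)) -(Aw _ (gen_below (ltnW (ltnSn _)) e1)).
rewrite /val {2}/tp /bd; case: (tp (G w) (rcons e.1 e.2)) => [m|].
  by case: (G w e.1) => [[m' y]|].
by case: (G w e.1) => [[m' y]|].
Qed.

Lemma frozen_delays_step :
  \int[P]_(w in A) (\prod_(u <- below k n.+1) val fw x (G w u) *
                     \prod_(v <- gen k n.+1) val g x (G w v))%:E <=
  \int[P]_(w in A) (\prod_(u <- below k n.+1) val fw x (G w u) *
                     \prod_(e <- kids) edge_val ghat x (G w) e.1 e.2)%:E.
Proof.
have [->|/set0P A0] := eqVneq A set0; first by rewrite !integral_set0.
have := @kids_out [::] kids A0 erefl.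
congr (_ <= _); apply: eq_integral => w /set_mem Aw; congr EFin.
  rewrite big_nil mulr1 gen_kids big_map; congr (_ * _)%R.
    apply: eq_big_seq => u ub; rewrite val_at_label//.
    by move: ub; rewrite !mem_below => /andP[un ->]; rewrite andbT (leq_trans un).
  by apply: eq_big_seq => e /mem_kids[_ eg]; rewrite val_at_label// (gen_below _ eg).
congr (_ * _)%R.
  apply: eq_big_seq => u ub; rewrite val_at_label//.
  by move: ub; rewrite !mem_below => /andP[un ->]; rewrite andbT (leq_trans un).
by apply: eq_big_seq => e ek; rewrite edge_val_at_edge.
Qed.

End frozen_types.

Lemma val_ge0 (phi : 'I_M -> R -> R) y o : (forall m z, 0 <= phi m z)%R -> (0 <= val phi y o)%R.
Proof. by move=> p0; rewrite /val; case: o => [[m s]|]. Qed.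

Lemma delays_step :
  \int[P]_w (\prod_(u <- below k n.+1) val fw x (G w u) *
              \prod_(v <- gen k n.+1) val g x (G w v))%:E <=
  \int[P]_w (\prod_(u <- below k n.+1) val fw x (G w u) *
              \prod_(e <- kids) edge_val ghat x (G w) e.1 e.2)%:E.
Proof.
(* Generation [n.+1] is included: the types of the kids must be frozen for their delay laws to be
   determined. *)
apply: (typed_split HG (l := below k n.+2)).
- exact: below_uniq.
- apply/measurable_EFinP; apply: measurable_funM; apply: measurable_prod => u _;
    exact: measurable_val.
- apply/measurable_EFinP; apply: measurable_funM; apply: measurable_prod => u _.
    exact: measurable_val.
  exact: measurable_edge_val.
- by move=> w; rewrite lee_fin mulr_ge0//; apply: prodr_ge0 => u _; exact: val_ge0.
- move=> w; rewrite lee_fin mulr_ge0//; apply: prodr_ge0 => u _; first exact: val_ge0.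
  by rewrite /edge_val; case: (tp _ _) => // m; exact: val_ge0.
- move=> s; exact: frozen_delays_step.
Qed.

End delays_step.

(** * Integrating out the numbers of children of one generation *)

Section offspring_step.
Context (R : realType) (M : nat) d (Om : measurableType d) (P : probability Om R)
  (h : 'I_M -> 'I_M -> R -> R) (m0 : 'I_M) (G : Om -> Defs.cluster M R).
Hypothesis HG : is_random_cluster P h m0 0%R G.
Context (kap : 'I_M -> 'I_M -> {finite_measure set R -> \bar R}).
Hypothesis kapE : forall m m' B, measurable B -> kap m m' B = delay_law (h m m') B.
Variables (k n : nat) (x : R) (fw : 'I_M -> R -> R) (ghat : 'I_M -> 'I_M -> R -> R).
Hypothesis mfw : forall m, measurable_fun setT (fw m).
Hypothesis fw0 : forall m y, (0 <= fw m y)%R.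
Hypothesis mghat : forall m m', measurable_fun setT (ghat m m').
Hypothesis ghat1 : forall m m' y, (1 <= ghat m m' y)%R.

Let H := L1_matrix h.
Hypothesis H0 : forall m m', (0 <= H m m')%R.

Definition offspring_val (m : 'I_M) (y : R) : R :=
  (fw m y * expR (\sum_(m' < M) H m m' * (ghat m m' y - 1)))%R.

Let mG : measurable_fun setT (G : Om -> cluster_space M R) := cluster_measurable HG.

Let ghat0 m m' y : (0 <= ghat m m' y)%R.
Proof. exact: le_trans ler01 (ghat1 _ _ _). Qed.

Lemma measurable_offspring_val m : measurable_fun setT (offspring_val m).
Proof.
apply: measurable_funM => //; apply: measurableT_comp => //.
apply: measurable_sum => m'; apply: measurable_funM => //.
exact: measurable_funB.
Qed.

Section frozen_types.
Variable s : label -> option 'I_M.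
Let tys := ty m0 s.
Let A := types_on G (below k n.+1) s.
Let edges := alive_edges k n.+1 s.
Let alive := [seq u <- gen k n | s u != None].
Let idx : seq (label * 'I_M) := [seq (u, m) | u <- alive, m <- enum 'I_M].

Let at_label (phi : 'I_M -> R -> R) (u : label) (w : Om) : R :=
  if s u is Some m then phi m (x + bd (G w) u)%R else 1%R.

(** The factor brought by each child of type [i.2] of the individual [i.1]; it depends only on the
    delays of earlier edges. *)
Let b (i : label * 'I_M) (w : Om) : R :=
  if i.1 \in alive then ghat (tys i.1) i.2 (x + bd (G w) i.1)%R else 1%R.
Let p (i : label * 'I_M) (q : nat) : \bar R := poisson_weight (H (tys i.1) i.2) q.
Let Y (i : label * 'I_M) (w : Om) : \bar R := nb_children (G w) i.1 i.2.
Let V (w : Om) : \bar R := (\prod_(u <- below k n.+1) at_label fw u w)%:E.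

Let mA : measurable A. Proof. exact: (measurable_types_on HG). Qed.
Let GGm : delay_rects G edges `<=` measurable.
Proof. exact: (delay_rects_measurable HG). Qed.

Let measurable_at u (phi : R -> R) : A !=set0 ->
  u \in below k n.+1 -> s u != None -> measurable_fun setT phi ->
  measurable_fun setT ((fun w => phi (x + bd (G w) u)%R) :
    g_sigma_algebraType (delay_rects G edges) -> R).
Proof.
move=> [w0 Aw0] ub su mphi; apply: measurableT_comp => //.
apply: measurable_funD => //; apply: (measurable_bd_sub HG) => v j t uE.
rewrite mem_alive_edges /=.
have ub' : rcons v j ++ t \in below k n.+1 by rewrite -uE.
have su' : s (rcons v j ++ t) != None by rewrite -uE.
by have [-> _ ->] := types_on_alive HG Aw0 ub' su'.
Qed.

Let mY i : measurable_fun setT (Y i).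
Proof.
apply: measurable_nb_children => v; exact: (measurable_tree_tp HG v (Some i.2)).
Qed.

Let p0 i q : 0 <= p i q. Proof. exact: poisson_weight_ge0. Qed.
Let p1 i : \sum_(q <oo) p i q = 1. Proof. exact: poisson_weight_sum1. Qed.

Let alive_below u : u \in alive -> [/\ u \in below k n.+1, u \in gen k n & s u != None].
Proof.
rewrite mem_filter => /andP[-> ug]; split=> //.
by move: ug; rewrite mem_gen mem_below => /andP[/eqP -> ->]; rewrite ltnSn.
Qed.

Let alive_ty u : u \in alive -> s u = Some (tys u).
Proof. by move=> /alive_below[_ _]; rewrite /tys /ty; case: (s u). Qed.

Let on_idx (c : label * 'I_M -> nat) :=
  [set w | forall i, i \in idx -> Y i w = (c i)%:R%:E].

Let on_idxE c : on_idx c =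
  [set w | forall u, u \in alive -> forall m, nb_children (G w) u m = (c (u, m))%:R%:E].
Proof.
apply/seteqP; split => w Hw.
  by move=> u ua m; apply: (Hw (u, m)); apply/allpairsP; exists (u, m); rewrite /= mem_enum.
by move=> _ /allpairsP[[u m] [/= ua _ ->]]; exact: Hw.
Qed.

Let P_on_idx c : P (A `&` on_idx c) = P A * \prod_(i <- idx) p i (c i).
Proof.
have tA : typed_tree_sigma G [set u | (size u <= n)%N] A.
  by apply: typed_types_on => u; rewrite mem_below => /andP[].
have ua : uniq alive by apply: filter_uniq; exact: gen_uniq.
have sz u : u \in alive -> size u = n.
  by move=> /alive_below[_ + _]; rewrite mem_gen => /andP[/eqP].
have off := cluster_offspring HG.
have := off n A alive tys (fun u m => c (u, m)) tA ua sz => /=.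
rewrite (_ : A `&` [set w | forall u, u \in alive -> _ = _] = A); last first.
  apply/seteqP; split => [w []//|w Aw]; split => // u ul.
  by have [ub _ _] := alive_below ul; rewrite (Aw u ub) alive_ty.
rewrite on_idxE => ->; congr (_ * _); rewrite big_allpairs.
by apply: eq_bigr => u _; rewrite big_enum.
Qed.

Let typed_on_idx c : typed_tree_sigma G setT (A `&` on_idx c).
Proof.
have mI := @measurableI _ (g_sigma_algebraType [set A | exists (u : label) (m : 'I_M),
         setT u /\ A = [set w | tp (G w) u = Some m]]).
apply: mI; first exact: typed_types_on.
by rewrite on_idxE; exact: typed_nb_children.
Qed.

(** Densities that are functions of the delays up to generation [n]; the factors [b] and their
    powers can be absorbed into them. *)
Let VV : set (Om -> \bar R) := [set W |
  measurable_fun setT (W : g_sigma_algebraType (delay_rects G edges) -> \bar R) /\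
  forall w, 0 <= W w].

Let m_on_idx c : measurable (on_idx c).
Proof.
rewrite (_ : on_idx c = \bigcap_(i in [set` idx]) (Y i @^-1` [set (c i)%:R%:E]))//.
apply: fin_bigcap_measurable => // i _.
by rewrite -[X in measurable X]setTI; exact: mY.
Qed.

(** Prescribing the numbers of children multiplies the mass of [A] by the Poisson weights and, being
    an event of the typed tree, leaves the law of the delays unchanged. The two measures thus agree
    on delay rectangles. *)
Let integral_on_idx c (W : Om -> \bar R) : VV W ->
  \int[P]_(w in A `&` on_idx c) W w =
  1 * \prod_(i <- idx) p i (c i) * \int[P]_(w in A) W w.
Proof.
move=> [mW W0]; rewrite mul1e.
have pr_ge0 : 0 <= \prod_(i <- idx) p i (c i) by apply: prode_ge0.
have prE : \prod_(i <- idx) p i (c i) =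
    (\prod_(i <- idx) fine (p i (c i)))%R%:E.
  rewrite -prodEFin; apply: eq_bigr => i _.
  by rewrite fineK// /p poisson_weightE.
set pr := (\prod_(i <- idx) _)%R in prE.
have pr0 : (0 <= pr)%R by rewrite -lee_fin -prE.
have mAN : measurable (A `&` on_idx c) by apply: measurableI.
have mWO : measurable_fun setT W by exact: (measurable_fun_sub GGm).
rewrite -(ge0_integral_mrestr P mAN)// -(ge0_integral_mrestr P mA)//.
have [|m2 m2E] := @measure_to_finite _ _ _
  [the {measure set Om -> \bar R} of mscale (NngNum pr0) (mrestr P mA)].
  by move=> B mB; rewrite /= /mscale /mrestr fin_numM// fin_num_measure//; exact: measurableI.
transitivity (\int[m2]_w W w).
  apply: (@eq_integral_sub _ _ _ _ GGm (@delay_rectsI _ _ _ _ _ edges) (delay_rectsT G _)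
    [the {finite_measure set Om -> \bar R} of mrestr P mAN]) => //.
  move=> _ [B [mB ->]]; rewrite m2E /= /mscale /= /mrestr.
  set E := [set w | forall e, e \in edges -> _].
  rewrite (setIC E (A `&` on_idx c)) (setIC E A).
  rewrite (delays_indep HG kapE (typed_on_idx c) _ (alive_edges_uniq k n.+1 s) (fun _ h => h) mB)//.
  have tA : typed_tree_sigma G setT A by exact: typed_types_on.
  rewrite (delays_indep HG kapE tA (fun _ h => h) (alive_edges_uniq k n.+1 s) (fun _ h => h) mB).
  by rewrite P_on_idx prE (muleC (P A) pr%:E) -muleA.
transitivity (\int[mscale (NngNum pr0) (mrestr P mA)]_w W w).
  by apply: eq_measure_integral => B mB _; exact: m2E.
by rewrite prE ge0_integral_mscale.
Qed.

Let uniq_idx : uniq idx.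
Proof.
apply: allpairs_uniq; [by apply: filter_uniq; exact: gen_uniq|exact: enum_uniq|].
by move=> [u i] [v j].
Qed.

Let b1 i w : (1 <= b i w)%R. Proof. by rewrite /b; case: ifP. Qed.

Let a (i : label * 'I_M) (q : nat) (w : Om) : \bar R := (b i w ^+ q)%:E.

Let a0 i q w : 0 <= a i q w.
Proof. by rewrite lee_fin exprn_ge0// (le_trans ler01). Qed.

Let measurable_a i q : A !=set0 ->
  measurable_fun setT (a i q : g_sigma_algebraType (delay_rects G edges) -> \bar R).
Proof.
move=> A0; apply/measurable_EFinP; apply: measurable_funX; rewrite /b.
have [ia|_] := boolP (i.1 \in alive); last exact: measurable_cst.
by have [ub _ su] := alive_below ia; exact: (measurable_at (phi := ghat (tys i.1) i.2)).
Qed.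

Let measurable_at_label phi u : A !=set0 -> u \in below k n.+1 ->
  (forall m, measurable_fun setT (phi m)) ->
  measurable_fun setT (at_label phi u : g_sigma_algebraType (delay_rects G edges) -> R).
Proof.
move=> A0 ub mphi; rewrite /at_label; case E : (s u) => [m|].
  by apply: measurable_at => //; rewrite E.
exact: measurable_cst.
Qed.

Let at_label_ge0 phi u w : (forall m y, 0 <= phi m y)%R -> (0 <= at_label phi u w)%R.
Proof. by move=> p0'; rewrite /at_label; case: (s u). Qed.

Let VV_V : A !=set0 -> VV V.
Proof.
move=> A0; split; last by move=> w; rewrite lee_fin prodr_ge0// => u _; exact: at_label_ge0.
apply/measurable_EFinP; apply: measurable_prod => u ub; exact: measurable_at_label.
Qed.

Let val_at_label phi u w : A w -> u \in below k n.+1 -> val phi x (G w u) = at_label phi u w.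
Proof.
move=> Aw ub; rewrite /at_label -(Aw u ub) /tp /bd /val.
by case: (G w u) => [[m y]|].
Qed.

Let kids_le w (q : label * 'I_M -> nat) : A w ->
  (forall i, i \in idx -> Y i w = (q i)%:R%:E) ->
  (\prod_(e <- kids k n) edge_val ghat x (G w) e.1 e.2 <= \prod_(i <- idx) b i w ^+ q i)%R.
Proof.
move=> Aw Yq; rewrite /kids /idx !big_allpairs /= big_filter.
rewrite [leRHS]big_mkcond [leLHS]big_seq [leRHS]big_seq.
apply: ler_prod => u ug.
have ub : u \in below k n.+1.
  by move: ug; rewrite mem_gen mem_below => /andP[/eqP -> ->]; rewrite ltnSn.
have Au := Aw u ub; apply/andP; split.
  apply: prodr_ge0 => j _; rewrite /edge_val; case: (tp _ _) => // m.
  exact: val_ge0.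
case: ifPn => su; last first.
  rewrite big1// => j _; rewrite /edge_val; case: (tp _ _) => // m.
  by move: Au su; rewrite /tp /val; case: (G w u) => [[m' y]|]//= <-.
have ua : u \in alive by rewrite mem_filter su.
have uE m : val (ghat^~ m) x (G w u) = b (u, m) w.
  rewrite /b /= ua; move: Au; rewrite (alive_ty ua) /tp /val /bd.
  by case: (G w u) => [[m' y]|]//= [->].
rewrite big_enum /=.
(* Children of the same parent and type bring the same factor, so the product collects into powers
   whose exponents count the children of rank below [k]. *)
apply: (@le_trans _ _ (\prod_(m < M) b (u, m) w ^+ \sum_(j < k) (tp (G w) (rcons u j) == Some m))%R).
  rewrite (_ : \prod_(j <- iota 0 k) _ = \prod_(m < M) b (u, m) w ^+ \sum_(j < k) (tp (G w) (rcons u j) == Some m))%R//.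
  under [RHS]eq_bigr do rewrite expr_sum.
  rewrite exchange_big /= -[k in iota 0 k]subn0 big_mkord; apply: eq_bigr => j _.
  rewrite /edge_val; case: (tp _ _) => [m|]; last by rewrite big1// => m _; rewrite expr0.
  rewrite (bigD1 m)//= eqxx expr1 big1 ?mulr1 ?uE// => m' mm'.
  by rewrite (_ : (_ == _) = false)// eqE /= eq_sym (negbTE mm').
apply: ler_prod => m _; apply/andP; split.
  by rewrite exprn_ge0// (le_trans ler01).
rewrite ler_weXn2l// -(ler_nat R) -lee_fin.
apply: le_trans (nb_children_ge _ _ _ _) _.
by have := Yq (u, m); rewrite /Y /= => ->//; apply/allpairsP; exists (u, m); rewrite /= mem_enum.
Qed.

Lemma frozen_offspring_step :
  \int[P]_(w in A) (\prod_(u <- below k n.+1) val fw x (G w u) *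
                     \prod_(e <- kids k n) edge_val ghat x (G w) e.1 e.2)%:E <=
  \int[P]_(w in A) (\prod_(u <- below k n) val fw x (G w u) *
                     \prod_(u <- gen k n) val offspring_val x (G w u))%:E.
Proof.
have [->|/set0P A0] := eqVneq A set0; first by rewrite !integral_set0.
have mVV W : VV W -> measurable_fun setT W by move=> [mW _]; exact: (measurable_fun_sub GGm).
have VV0 W : VV W -> forall w, 0 <= W w by move=> [].
have VVM W i q : VV W -> VV (fun w => W w * a i q w).
  move=> [mW W0]; split; last by move=> w; rewrite mule_ge0.
  by apply: emeasurable_funM => //; exact: measurable_a.
have ma i q : measurable_fun setT (a i q).
  by apply: (measurable_fun_sub GGm); exact: measurable_a.
have E := integral_discrete_family mY ma a0 p0 mVV VV0 VVM uniq_idx mA mA lee01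
  integral_on_idx (VV_V A0).
have PA : P A < +oo by rewrite -ge0_fin_numE// fin_num_measure.
(* The comparison can only hold almost everywhere: where some number of children is infinite,
   [on_values] vanishes. *)
have [Z [mZ PZ ZN]] := values_ae mY p0 p1 uniq_idx mA PA
  (fun c => etrans (P_on_idx c) (muleC _ _)).
apply: (@le_trans _ _ (\int[P]_(w in A) (V w * \prod_(i <- idx) on_values Y a i w))).
  apply: ae_ge0_le_integral => //.
  - move=> w _; rewrite lee_fin mulr_ge0//; apply: prodr_ge0 => u _; first exact: val_ge0.
    by rewrite /edge_val; case: (tp _ _) => // m; exact: val_ge0.
  - apply: measurable_funTS; apply/measurable_EFinP; apply: measurable_funM;
      apply: measurable_prod => u _; [exact: measurable_val|exact: measurable_edge_val].
  - move=> w _; rewrite mule_ge0//; first exact: (VV0 _ (VV_V A0)).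
    by apply: prode_ge0 => i _; exact: on_values_ge0.
  - apply: measurable_funTS; apply: emeasurable_funM; first exact: (mVV _ (VV_V A0)).
    by apply: emeasurable_prod => // i _; exact: measurable_on_values.
  exists Z; split => // w /= H1; apply: ZN; split.
    by apply: contrapT => nA; apply: H1.
  apply: contrapT => H2; apply: H1 => Aw.
  have {}H2 i : exists q : nat, i \in idx -> Y i w = q%:R%:E.
    have [il|il] := pselect (i \in idx); last by exists 0%N.
    apply: contrapT => H3; apply: H2; exists i => // q Yq; apply: H3; exists q => _.
    exact: Yq.
  have [q Yq] := choice H2.
  rewrite (eq_big_seq (fun i => (b i w ^+ q i)%:E)); last first.
    by move=> i il; rewrite (on_values_nat (n := q i)) ?Yq.
  rewrite prodEFin -EFinM lee_fin /V.
  rewrite (eq_big_seq (fun u => at_label fw u w)); last by move=> u ub; exact: val_at_label.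
  apply: ler_wpM2l; first by apply: prodr_ge0 => u _; exact: at_label_ge0.
  exact: kids_le.
rewrite E mul1e le_eqVlt; apply/orP; left; apply/eqP; apply: eq_integral => w /set_mem Aw.
rewrite (eq_bigr (fun i => (expR (H (tys i.1) i.2 * (b i w - 1)))%:E)); last first.
  by move=> i _; rewrite poisson_pgf// (le_trans ler01).
rewrite prodEFin /V -EFinM; congr EFin.
rewrite /= big_cat /= -mulrA; congr (_ * _)%R.
  apply: eq_big_seq => u ub; rewrite val_at_label//.
  by move: ub; rewrite !mem_below => /andP[un ->]; rewrite andbT (leq_trans un).
rewrite /idx big_allpairs big_filter [X in (_ * X)%R]big_mkcond -big_split /=.
apply: eq_big_seq => u ug.
have ub : u \in below k n.+1.
  by move: ug; rewrite mem_gen mem_below => /andP[/eqP -> ->]; rewrite ltnSn.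
rewrite val_at_label// /at_label.
case: ifPn => su; last by move: su; rewrite negbK => /eqP ->; rewrite mulr1.
have ua : u \in alive by rewrite mem_filter su.
rewrite (alive_ty ua) /offspring_val; congr (_ * _)%R.
rewrite expR_sum big_enum /=; apply: eq_bigr => m _.
by rewrite /b /= ua.
Qed.

End frozen_types.

(* The number of children is Poisson, with generating function
   b |-> exp (H (b - 1)), where b is the factor contributed by each child; since
   1 <= b, ignoring the children with labels >= k is harmless. *)
Lemma offspring_step :
  \int[P]_w (\prod_(u <- below k n.+1) val fw x (G w u) *
              \prod_(e <- kids k n) edge_val ghat x (G w) e.1 e.2)%:E <=
  \int[P]_w (\prod_(u <- below k n) val fw x (G w u) *
              \prod_(u <- gen k n) val offspring_val x (G w u))%:E.
Proof.
have ov0 m y : (0 <= offspring_val m y)%R by rewrite mulr_ge0// expR_ge0.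
(* Types are frozen up to generation [n] only, so that the children of this generation stay
   random. *)
apply: (typed_split HG (l := below k n.+1)).
- exact: below_uniq.
- apply/measurable_EFinP; apply: measurable_funM; apply: measurable_prod => u _.
    exact: measurable_val.
  exact: measurable_edge_val.
- apply/measurable_EFinP; apply: measurable_funM; apply: measurable_prod => u _.
    exact: measurable_val.
  by apply: measurable_val => // m; exact: measurable_offspring_val.
- move=> w; rewrite lee_fin mulr_ge0//; apply: prodr_ge0 => u _; first exact: val_ge0.
  by rewrite /edge_val; case: (tp _ _) => // m; exact: val_ge0.
- by move=> w; rewrite lee_fin mulr_ge0//; apply: prodr_ge0 => u _; exact: val_ge0.
- move=> s; exact: frozen_offspring_step.
Qed.

End offspring_step.

(** * Exponential moment of a truncated cluster *)

Section cluster_bound.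
Context (R : realType) (M : nat) (h : 'I_M -> 'I_M -> R -> R)
  (kap : 'I_M -> 'I_M -> {finite_measure set R -> \bar R}) (F : R -> R) (T theta : R)
  (v : nat -> 'I_M -> R).
Hypothesis kapE : forall m m' B, measurable B -> kap m m' B = delay_law (h m m') B.
Hypothesis kap1 : forall m m', kap m m' setT <= 1.
Hypothesis F0 : forall y, (0 <= F y)%R.
Hypothesis mF : measurable_fun setT F.

Let H (m m' : 'I_M) : R := L1_matrix h m m'.
Hypothesis H0 : forall m m', (0 <= H m m')%R.
Hypothesis FT : forall k y, (\sum_(i < k) F (y + i%:R * T) <= theta)%R.
Hypothesis v0 : forall m, (theta <= v 0%N m)%R.
Hypothesis vS : forall j m,
  (theta + \sum_(m' < M) H m m' * (expR (v j m') - 1) <= v j.+1 m)%R.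

Let spec j m := psi_spec H0 kap1 F0 mF FT v0 vS j m.
Let bornfin j m m' y := born_fin_num H0 kap1 F0 mF FT v0 vS j m m' y.

Let g j (m : 'I_M) (y : R) : R := expR (psi H kap F j m y).
(** Bounds the integral of [g j m'] by putting 1 in place of the mass of [kap m m']. Then [ghat - 1]
    is exactly the integral in [psi], and [ghat] is at least 1 even for a null delay law. *)
Let ghat j (m m' : 'I_M) (y : R) : R := (1 + fine (born H kap F j m m' y))%R.

Let mpsi j m : measurable_fun setT (psi H kap F j m). Proof. by have [] := spec j m. Qed.
Let psi0 j m y : (0 <= psi H kap F j m y)%R. Proof. by have [] := spec j m. Qed.

Let mgB j m' : measurable_fun setT (fun z : R * R => (expR (psi H kap F j m' (z.1 + z.2)%R) - 1)%:E).
Proof.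
apply/measurable_EFinP; apply: measurable_funB => //.
apply: measurableT_comp => //; apply: measurableT_comp => //.
exact: measurable_funD.
Qed.

Let gB0 j m' (y : R) : 0 <= (expR (psi H kap F j m' y) - 1)%:E.
Proof. by rewrite lee_fin subr_ge0 -expR0 ler_expR. Qed.

Let mghat j m m' : measurable_fun setT (ghat j m m').
Proof.
apply: measurable_funD => //; apply: measurableT_comp => //.
apply: (@measurable_fun_fubini_tonelli_F _ _ _ _ _ (kap m m') _ (mgB j m')) => z.
exact: gB0.
Qed.

Let ghat1 j m m' y : (1 <= ghat j m m' y)%R.
Proof. by rewrite lerDl fine_ge0// /born; apply: integral_ge0 => s _; exact: gB0. Qed.

Let ghatE j m m' y : \int[kap m m']_s (g j m' (y + s)%R)%:E <= (ghat j m m' y)%:E.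
Proof.
rewrite /ghat EFinD fineK; last exact: bornfin.
rewrite (eq_integral (fun s => cst 1 s + (expR (psi H kap F j m' (y + s)%R) - 1)%:E)); last first.
  by move=> s _; rewrite /g /= -EFinD addrCA subrr addr0.
rewrite ge0_integralD//.
- by apply: leeD => //; rewrite integral_cst// mul1e; exact: kap1.
exact: (measurableT_comp (mgB j m') (measurable_pair1 y)).
Qed.

Lemma cluster_bound d (Om : measurableType d) (P : probability Om R) (m0 : 'I_M)
    (G : Om -> Defs.cluster M R) (k n : nat) (x : R) :
  is_random_cluster P h m0 0%R G ->
  \int[P]_w (\prod_(u <- below k n.+1) val (fun _ y => expR (F y)) x (G w u))%:E <=
  (expR (psi H kap F n m0 x))%:E.
Proof.
move=> HG.
have mfw : measurable_fun setT (fun y => expR (F y)) by exact: measurableT_comp.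
(* Generation [i] carries the transform of its truncated descendants, [g j]. Each round removes one
   generation and adds one step to [psi], so that [j + i] is invariant. *)
suff: forall i j, \int[P]_w (\prod_(u <- below k i) val (fun _ y => expR (F y)) x (G w u) *
     \prod_(u <- gen k i) val (g j) x (G w u))%:E <= (expR (psi H kap F (j + i)%N m0 x))%:E.
  move=> /(_ n 0%N); rewrite add0n; congr (_ <= _); apply: eq_integral => w _.
  by rewrite /= big_cat.
elim=> [|i IH] j.
  rewrite (eq_integral (cst (expR (psi H kap F j m0 x))%:E)); last first.
    by move=> w _; rewrite /= big_nil big_seq1 mul1r (cluster_root HG) /= addr0.
  rewrite addn0 integral_cst//.
  by rewrite [X in _ * X](_ : _ = 1) ?mule1//; exact: probability_setT.
rewrite addnS -addSn; apply: le_trans (IH j.+1).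
have fw0 (m : 'I_M) y : (0 <= expR (F y))%R by exact: expR_ge0.
have mg m : measurable_fun setT (g j m) by exact: measurableT_comp.
have g0 m y : (0 <= g j m y)%R by exact: expR_ge0.
have ghat0 m m' y : (0 <= ghat j m m' y)%R by exact: le_trans ler01 (ghat1 _ _ _ _).
have := delays_step HG kapE k i x (fun _ => mfw) fw0 mg g0 (mghat j) ghat0 (ghatE j).
move=> /le_trans; apply.
have := offspring_step HG kapE k i x (fun _ => mfw) fw0 (mghat j) (ghat1 j) H0.
move=> /le_trans; apply.
rewrite le_eqVlt; apply/orP; left; apply/eqP; apply: eq_integral => w _; congr ((_ * _)%:E).
apply: eq_bigr => u _; congr (val _ _ _).
apply/funext => m; apply/funext => y; rewrite /g /= expRD /offspring_val /ghat.
congr (_ * expR _)%R; apply: eq_bigr => m' _; congr (_ * _)%R.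
by rewrite addrAC subrr add0r.
Qed.

End cluster_bound.

(** * Roots and Poisson processes *)

Section sources.
Context (R : realType) (M : nat) d (Om : measurableType d) (P : probability Om R)
  (mu : 'I_M -> R) (h : 'I_M -> 'I_M -> R -> R)
  (pt : 'I_M -> nat -> Om -> \bar R) (G : 'I_M -> nat -> Om -> Defs.cluster M R).
Hypothesis HC : is_cluster_construction P mu h pt G.

Notation source := ('I_M + 'I_M * nat)%type.

Let mpt m k : measurable_fun setT (pt m k). Proof. exact: (roots_enum HC m).1. Qed.
Let mG m k : measurable_fun setT (G m k : Om -> cluster_space M R).
Proof. exact: (cluster_measurable (clusters_law HC m k)). Qed.

Lemma source_sigma_measurable i : source_sigma pt G i `<=` measurable.
Proof.
case: i => [m|[m k]] /=; last first.
  by move=> _ [B mB <-]; exact: mG.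
apply: (smallest_sub (@sigma_algebra_measurable _ Om)) => _ [k _ [B mB <-]].
exact: mpt.
Qed.

Lemma source_sigmaI i : setI_closed (source_sigma pt G i).
Proof.
case: i => [m|[m k]] A B /=.
  exact: (@measurableI _ (g_sigma_algebraType (\bigcup_k g_sigma_algebra_preimage (pt m k)))).
by move=> [A' mA <-] [B' mB <-]; exists (A' `&` B'); rewrite ?setTI//; exact: measurableI.
Qed.

Lemma source_sigmaT i : source_sigma pt G i setT.
Proof.
case: i => [m|[m k]] /=; last by exists setT => //; rewrite setTI.
exact: (@measurableT _ (g_sigma_algebraType (\bigcup_k g_sigma_algebra_preimage (pt m k)))).
Qed.

Lemma source_pt m k B : measurable B -> source_sigma pt G (inl m) (pt m k @^-1` B).
Proof.
move=> mB /=; apply: sub_sigma_algebra; exists k => //; exists B => //.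
by rewrite setTI.
Qed.

Lemma source_cluster p (B : set (cluster_space M R)) : measurable B ->
  source_sigma pt G (inr p) (G p.1 p.2 @^-1` B).
Proof. by move=> mB; exists B => //; rewrite setTI. Qed.

(** A pi-system for all sources but [i0]: mutual independence speaks of finitely many sources at a
    time, and finite intersections are enough for [freeze]. *)
Definition other_sources (i0 : source) : set (set Om) :=
  [set E | exists (s : seq source) (F : source -> set Om),
    [/\ uniq s, i0 \notin s, forall i, source_sigma pt G i (F i) &
        E = \bigcap_(i in [set` s]) F i]].

Lemma other_sources_measurable i0 : other_sources i0 `<=` measurable.
Proof.
move=> _ [s [F [_ _ mF ->]]]; apply: fin_bigcap_measurable => // i _.
exact: source_sigma_measurable.
Qed.

Lemma other_sourcesI i0 : setI_closed (other_sources i0).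
Proof.
move=> _ _ [s [F [us is0 mF ->]]] [s' [F' [us' is0' mF' ->]]].
exists (undup (s ++ s')), (fun i => (if i \in s then F i else setT) `&`
  (if i \in s' then F' i else setT)); split.
- exact: undup_uniq.
- by rewrite mem_undup mem_cat negb_or is0.
- by move=> i; apply: source_sigmaI; case: ifP => // _; exact: source_sigmaT.
apply/seteqP; split => w /= H.
  by move=> i _; split; case: ifP => // ii; [exact: H.1|exact: H.2].
have H' i : (i \in s) || (i \in s') -> (if i \in s then F i else setT) w /\
    (if i \in s' then F' i else setT) w.
  by move=> ii; apply: H; rewrite /= mem_undup mem_cat.
split=> i /= ii; first by have := H' i; rewrite ii => /(_ isT)[].
by have := H' i; rewrite ii orbT => /(_ isT)[].
Qed.

Lemma other_sourcesT i0 : other_sources i0 setT.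
Proof.
exists [::], (fun=> setT); split => //; first by move=> i; exact: source_sigmaT.
by apply/seteqP.
Qed.

Lemma other_source i0 i (E : set Om) : i != i0 -> source_sigma pt G i E ->
  other_sources i0 E.
Proof.
move=> ii0 sE; exists [:: i], (fun j => if j == i then E else setT); split => //.
- by rewrite inE eq_sym.
- by move=> j; case: eqP => [->//|_]; exact: source_sigmaT.
- apply/seteqP; split => w H; first by move=> j /=; rewrite inE => /eqP ->; rewrite eqxx.
  by have := H i (mem_head _ _); rewrite eqxx.
Qed.

Lemma source_indep i0 E B : other_sources i0 E -> source_sigma pt G i0 B ->
  P (E `&` B) = P E * P B.
Proof.
move=> [s [F [us is0 mF ->]]] sB.
have ind := sources_independent HC.
have H1 := ind s F us (fun i _ => mF i).
have us0 : uniq (i0 :: s) by rewrite /= is0.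
pose F' i := if i == i0 then B else F i.
have mF' i : i \in i0 :: s -> source_sigma pt G i (F' i).
  by move=> _; rewrite /F'; case: eqP => [->|].
have H2 := ind (i0 :: s) F' us0 mF'.
have F's i : i \in s -> F' i = F i.
  by move=> ii; rewrite /F'; case: eqP => // ii0; rewrite -ii0 ii in is0.
have F'0 : F' i0 = B by rewrite /F' eqxx.
rewrite H1 muleC.
transitivity (P (\bigcap_(i in [set` i0 :: s]) F' i)).
  congr (P _); apply/seteqP; split => w.
    move=> [H Bw] i /=; rewrite inE => /orP[/eqP ->|ii]; first by rewrite F'0.
    by rewrite F's//; exact: H.
  move=> H; split; last by rewrite -F'0; apply: H; exact: mem_head.
  by move=> i /= ii; rewrite -F's//; apply: H; rewrite /= inE ii orbT.
rewrite H2 big_cons F'0; congr (_ * _).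
by apply: eq_big_seq => i ii; rewrite F's.
Qed.

End sources.

(** * Integrating out the clusters given their roots *)

Section clusters_out.
Context (R : realType) (M : nat) d (Om : measurableType d) (P : probability Om R)
  (mu : 'I_M -> R) (h : 'I_M -> 'I_M -> R -> R)
  (pt : 'I_M -> nat -> Om -> \bar R) (G : 'I_M -> nat -> Om -> Defs.cluster M R).
Hypothesis HC : is_cluster_construction P mu h pt G.
Variables (fw : 'I_M -> R -> R) (L : seq label) (psi : 'I_M -> R -> R).
Hypothesis mfw : forall m, measurable_fun setT (fw m).
Hypothesis fw0 : forall m y, (0 <= fw m y)%R.
Hypothesis mpsi : forall m, measurable_fun setT (psi m).
Hypothesis cluster_le : forall m i x,
  \int[P]_w (\prod_(u <- L) val fw x (G m i w u))%:E <= (expR (psi m x))%:E.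

(* An infinite root stands for an absent cluster and contributes a factor 1. *)
Definition cluster_val (X : \bar R) (c : Defs.cluster M R) : R :=
  if X \is a fin_num then (\prod_(u <- L) val fw (fine X) (c u))%R else 1%R.

Definition root_val (m : 'I_M) (X : \bar R) : R :=
  if X \is a fin_num then expR (psi m (fine X)) else 1%R.

Let mpt m k : measurable_fun setT (pt m k). Proof. exact: (roots_enum HC m).1. Qed.
Let mG m k : measurable_fun setT (G m k : Om -> cluster_space M R).
Proof. exact: (cluster_measurable (clusters_law HC m k)). Qed.

Lemma measurable_fin_num_test d' (T : measurableType d') (X : T -> \bar R) :
  measurable_fun setT X -> measurable_fun setT (fun t => X t \is a fin_num).
Proof.
move=> mX; apply: (measurable_fun_bool true); rewrite setTI.
rewrite (_ : _ @^-1` _ = setT `&` [set t | X t \is a fin_num]).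
  exact: emeasurable_fin_num.
by rewrite setTI; apply/seteqP; split => t /=; [move=> ->|case: (X t \is a fin_num)].
Qed.

Lemma measurable_cluster_val d' (T : measurableType d') (X : T -> \bar R)
    (C : T -> cluster_space M R) : measurable_fun setT X -> measurable_fun setT C ->
  measurable_fun setT (fun t => cluster_val (X t) (C t)).
Proof.
move=> mX mC; apply: measurable_fun_ifT => //; first exact: measurable_fin_num_test.
apply: measurable_prod => u _; apply: measurable_val => //.
exact: measurableT_comp.
Qed.

Lemma measurable_root_val d' (T : measurableType d') m (X : T -> \bar R) :
  measurable_fun setT X -> measurable_fun setT (fun t => root_val m (X t)).
Proof.
move=> mX; apply: measurable_fun_ifT => //; first exact: measurable_fin_num_test.
apply: measurableT_comp => //; apply: measurableT_comp => //; exact: measurableT_comp.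
Qed.

Lemma cluster_val_ge0 X c : (0 <= cluster_val X c)%R.
Proof.
by rewrite /cluster_val; case: ifP => // _; apply: prodr_ge0 => u _; exact: val_ge0.
Qed.

Lemma root_val_ge0 m X : (0 <= root_val m X)%R.
Proof. by rewrite /root_val; case: ifP => // _; exact: expR_ge0. Qed.

(** One cluster at a time: it is independent of the roots and of the other clusters, and once these
    are frozen [cluster_le] applies at its root. The clusters in [l0] are already integrated out. *)
Lemma integral_clusters_le (l : seq ('I_M * nat)) : uniq l ->
  \int[P]_w (\prod_(p <- l) cluster_val (pt p.1 p.2 w) (G p.1 p.2 w))%:E <=
  \int[P]_w (\prod_(p <- l) root_val p.1 (pt p.1 p.2 w))%:E.
Proof.
suff: forall l0, uniq (l0 ++ l) ->
  \int[P]_w (\prod_(p <- l0) root_val p.1 (pt p.1 p.2 w) *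
             \prod_(p <- l) cluster_val (pt p.1 p.2 w) (G p.1 p.2 w))%:E <=
  \int[P]_w (\prod_(p <- l0 ++ l) root_val p.1 (pt p.1 p.2 w))%:E.
  move=> /(_ [::]) /= H ul; have := H ul; congr (_ <= _).
  by apply: eq_integral => w _; rewrite big_nil mul1r.
elim: l => [|p l IH] l0 ul.
  by rewrite cats0; under eq_integral do rewrite big_nil mulr1.
rewrite -cat_rcons in ul *; apply: le_trans (IH _ ul).
pose GG := other_sources pt G (inr p).
have GGm : GG `<=` measurable by exact: (other_sources_measurable HC).
have GGI : setI_closed GG by exact: other_sourcesI.
have GGT : GG setT by exact: other_sourcesT.
pose OG := g_sigma_algebraType GG.
have sub_pt m k : measurable_fun setT (pt m k : OG -> \bar R).
  move=> _ B mB; rewrite setTI; apply: sub_sigma_algebra.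
  by apply: (@other_source _ _ _ _ _ _ _ (inl m)) => //; exact: source_pt.
have sub_G q : q != p -> measurable_fun setT (G q.1 q.2 : OG -> cluster_space M R).
  move=> qp _ B mB; rewrite setTI; apply: sub_sigma_algebra.
  by apply: (@other_source _ _ _ _ _ _ _ (inr q)) => //; exact: source_cluster.
pose Y (w : OG) : R := (\prod_(p <- l0) root_val p.1 (pt p.1 p.2 w) *
  \prod_(p <- l) cluster_val (pt p.1 p.2 w) (G p.1 p.2 w))%R.
have Y0 w : (0 <= Y w)%R.
  by rewrite mulr_ge0//; apply: prodr_ge0 => q _; [exact: root_val_ge0|exact: cluster_val_ge0].
have mY : measurable_fun setT Y.
  apply: measurable_funM; apply: measurable_prod => q ql.
    exact: measurable_root_val.
  apply: measurable_cluster_val => //; apply: sub_G.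
  (* By uniqueness the cluster [p] does not occur again among the remaining ones. *)
  apply: contraTneq ul => qp; rewrite cat_uniq !negb_and negbK; apply/orP; right.
  by apply/orP; left; apply/hasP; exists q => //; rewrite qp mem_rcons mem_head.
pose X : Om -> cluster_space M R := G p.1 p.2.
have [kappa [kE kI]] := pushforward_finite P (mG p.1 p.2).
pose Phi (z : OG * cluster_space M R) : \bar R :=
  (Y z.1 * cluster_val (pt p.1 p.2 z.1) z.2)%:E.
have mPhi : measurable_fun setT Phi.
  apply/measurable_EFinP; apply: measurable_funM.
    exact: (measurableT_comp mY measurable_fst).
  apply: measurable_cluster_val; last exact: measurable_snd.
  exact: (measurableT_comp (sub_pt _ _) measurable_fst).
have Phi0 z : 0 <= Phi z by rewrite lee_fin mulr_ge0// cluster_val_ge0.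
have XI E B : GG E -> measurable B -> P (E `&` X @^-1` B) = P E * kappa B.
  move=> GE mB; rewrite kE.
  by rewrite (source_indep HC GE (source_cluster pt G p mB)).
have -> : \int[P]_w (\prod_(p0 <- l0) root_val p0.1 (pt p0.1 p0.2 w) *
     \prod_(p0 <- p :: l) cluster_val (pt p0.1 p0.2 w) (G p0.1 p0.2 w))%:E =
   \int[P]_w Phi (w, X w).
  by apply: eq_integral => w _; rewrite /Phi /Y /= big_cons; congr EFin; ring.
rewrite (freeze GGm GGI GGT (mG p.1 p.2) XI mPhi Phi0).
have -> : \int[P]_w (\prod_(p0 <- rcons l0 p) root_val p0.1 (pt p0.1 p0.2 w) *
    \prod_(p0 <- l) cluster_val (pt p0.1 p0.2 w) (G p0.1 p0.2 w))%:E =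
  \int[P]_w (Y w * root_val p.1 (pt p.1 p.2 w))%:E.
  by apply: eq_integral => w _; rewrite -cats1 big_cat big_seq1 /Y /=; congr EFin; ring.
apply: ge0_le_integral => //.
- by move=> w _; apply: integral_ge0.
- apply: (measurable_fun_sub GGm).
  exact: (@measurable_fun_fubini_tonelli_F _ _ _ _ _ kappa _ mPhi).
- apply/measurable_EFinP; apply: measurable_funM; first exact: (measurable_fun_sub GGm).
  exact: (measurable_root_val p.1 (mpt p.1 p.2)).
move=> w _; rewrite /Phi /=; under eq_integral do rewrite EFinM.
rewrite ge0_integralZl//; last 3 first.
- apply/measurable_EFinP.
  exact: (measurable_cluster_val (X := fun=> pt p.1 p.2 w) (C := id)).
- by move=> c _; rewrite lee_fin cluster_val_ge0.
- by rewrite lee_fin.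
rewrite [leRHS]EFinM; apply: lee_wpmul2l; first by rewrite lee_fin.
rewrite (kI (fun c => (cluster_val (pt p.1 p.2 w) c)%:E)); last 2 first.
- apply/measurable_EFinP.
  exact: (measurable_cluster_val (X := fun=> pt p.1 p.2 w) (C := id)).
- by move=> c; rewrite lee_fin cluster_val_ge0.
rewrite /cluster_val /root_val; case: ifP => _; first exact: cluster_le.
by rewrite integral_cst// mul1e; exact: probability_le1.
Qed.

End clusters_out.

(** * Counting the points of an enumerated random set *)

Lemma counting_inj_image (R : realType) (T1 T2 : choiceType) (f : T1 -> T2) (A : set T1) :
  {in A &, injective f} -> counting (f @` A) = counting A :> \bar R.
Proof.
move=> finj; rewrite /counting.
have fin_iff : finite_set (f @` A) = finite_set A.
  exact/eq_finite_set/inj_card_eq.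
rewrite fin_iff; case: ifPn => // /asboolP fA.
rewrite fset_set_image//; congr (_%:R%:E).
apply: finmap.card_in_imfset => x y; rewrite !in_fset_set// => xA yA; exact: finj.
Qed.

Section hits.
Context (R : realType) (Om : Type) (pt : nat -> Om -> \bar R).
Hypothesis pt_inj : forall w k l, pt k w \is a fin_num -> pt k w = pt l w -> k = l.

Lemma counting_points (B : set R) w :
  counting (points pt w `&` B) = counting [set k | (EFin @` B) (pt k w)] :> \bar R.
Proof.
rewrite -(@counting_inj_image _ _ _ (fun k => fine (pt k w))); last first.
  move=> k l /set_mem[x _ xk] /set_mem[y _ yl]; rewrite -xk -yl /= => xy.
  by apply: (pt_inj (w := w)); rewrite -xk// -yl xy.
congr counting; apply/seteqP; split => x /=.
  by move=> [[k kx] Bx]; exists k; rewrite kx//; exists x.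
by move=> [k [y By yk] <-]; rewrite -yk /=; split => //; exists k.
Qed.

Lemma counting_points_ge (B : set R) w n :
  ((\sum_(k < n) \1_(EFin @` B) (pt k w))%R : R)%:E <= counting (points pt w `&` B).
Proof.
rewrite counting_points counting_dirac.
apply: le_trans (nneseries_lim_ge n _) => //.
rewrite big_mkord -sumEFin; apply: lee_sum => k _.
rewrite diracE indicE lee_fin ler_nat; case: (boolP (_ \in _)) => // /set_mem Bk.
by rewrite mem_set.
Qed.

End hits.

Lemma measurable_counting_points (R : realType) d (T : measurableType d)
    (pt : nat -> T -> \bar R) (B : set R) :
  (forall w k l, pt k w \is a fin_num -> pt k w = pt l w -> k = l) ->
  (forall k, measurable_fun setT (pt k)) -> measurable B ->
  measurable_fun setT (fun t => counting (points pt t `&` B) : \bar R).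
Proof.
move=> pt_inj mpt mB.
rewrite (_ : (fun t => _) = (fun t => \sum_(n <oo) (\1_(pt n @^-1` (EFin @` B)) t)%:E)).
  apply: ge0_emeasurable_sum => [n t _ _|n _]; first by rewrite lee_fin.
  apply/measurable_EFinP; apply: measurable_indic; rewrite -[X in measurable X]setTI.
  by apply: mpt => //; exact: measurable_image_EFin.
apply/funext => t; rewrite (counting_points pt_inj) counting_dirac.
apply: eq_eseriesr => n _; rewrite diracE indicE; congr ((nat_of_bool _)%:R%:E).
Qed.

(** * The exponential formula for step functions *)

Section poisson_simple.
Context (R : realType) (M : nat) d (Om : measurableType d) (P : probability Om R)
  (mu : 'I_M -> R) (h : 'I_M -> 'I_M -> R -> R)
  (pt : 'I_M -> nat -> Om -> \bar R) (G : 'I_M -> nat -> Om -> Defs.cluster M R).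
Hypothesis HC : is_cluster_construction P mu h pt G.
Hypothesis mu0 : forall m, (0 <= mu m)%R.
Variables (ys : 'I_M -> seq R) (B : 'I_M -> R -> set R).
Hypothesis ys_uniq : forall m, uniq (ys m).
Hypothesis mB : forall m y, measurable (B m y).
Hypothesis Bfin : forall m y, lebesgue_measure (B m y) < +oo.
Hypothesis Bdisj : forall m, trivIset [set` ys m] (B m).
Hypothesis ys0 : forall m y, y \in ys m -> (0 <= y)%R.

Let pt_inj m := (roots_enum HC m).2.
Let mpt m k : measurable_fun setT (pt m k). Proof. exact: (roots_enum HC m).1. Qed.

Let idx : seq ('I_M * R) := [seq (m, y) | m <- enum 'I_M, y <- ys m].
Let Y (i : 'I_M * R) (w : Om) : \bar R := counting (points (pt i.1) w `&` B i.1 i.2).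
Let rate (i : 'I_M * R) : R := (mu i.1 * fine (lebesgue_measure (B i.1 i.2)))%R.
Let p (i : 'I_M * R) (q : nat) : \bar R := poisson_weight (rate i) q.

Let rate0 i : (0 <= rate i)%R.
Proof. by rewrite mulr_ge0// fine_ge0. Qed.

Let mY i : measurable_fun setT (Y i).
Proof. by apply: measurable_counting_points => //; exact: pt_inj. Qed.

Let type_event (c : 'I_M * R -> nat) (m : 'I_M) : set Om :=
  [set w | forall y, y \in ys m -> Y (m, y) w = (c (m, y))%:R%:E].

Let source_type_event c m : source_sigma pt G (inl m) (type_event c m).
Proof.
pose T := g_sigma_algebraType (\bigcup_k g_sigma_algebra_preimage (pt m k)).
have mptT k : measurable_fun setT (pt m k : T -> \bar R).
  move=> _ C mC; rewrite setTI.
  have : source_sigma pt G (inl m) (pt m k @^-1` C) by exact: source_pt.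
  by [].
have mYT y : measurable_fun setT (fun w : T => counting (points (pt m) w `&` B m y) : \bar R).
  by apply: measurable_counting_points => //; exact: pt_inj.
suff : measurable (\bigcap_(y in [set` ys m])
    ((fun w : T => counting (points (pt m) w `&` B m y) : \bar R) @^-1`
      [set (c (m, y))%:R%:E]) : set T) by [].
apply: fin_bigcap_measurable => // y _; rewrite -[X in measurable X]setTI.
exact: mYT.
Qed.

Let P_type_event c m : P (type_event c m) = \prod_(y <- ys m) p (m, y) (c (m, y)).
Proof.
have [cnt ind] := roots_poisson HC m.
pose BB (i : 'I_(size (ys m))) := B m (tnth (in_tuple (ys m)) i).
have tBB : trivIset setT BB.
  move=> i j _ _ ne; have : tnth (in_tuple (ys m)) i = tnth (in_tuple (ys m)) j.
    by apply: (Bdisj (m := m)); rewrite /= ?mem_tnth.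
  by rewrite !(tnth_nth 0%R) /= => /eqP; rewrite nth_uniq// => /eqP /val_inj.
have H := ind _ BB (fun i => mB _ _) tBB (enum 'I_(size (ys m)))
  (fun i => [set w | Y (m, tnth (in_tuple (ys m)) i) w = (c (m, tnth (in_tuple (ys m)) i))%:R%:E])
  (enum_uniq _).
transitivity (\prod_(i <- enum 'I_(size (ys m)))
    P [set w | Y (m, tnth (in_tuple (ys m)) i) w = (c (m, tnth (in_tuple (ys m)) i))%:R%:E]).
  rewrite -H; last first.
    move=> i _; exists [set (c (m, tnth (in_tuple (ys m)) i))%:R%:E] => //.
    by rewrite setTI.
  congr (P _); apply/seteqP; split => w Hw.
    by move=> i _ /=; apply: Hw; exact: mem_tnth.
  move=> y /(tnthP (in_tuple (ys m)))[i ->]; apply: (Hw i).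
  by rewrite /= mem_enum.
rewrite big_enum /= [RHS]big_tnth; apply: eq_bigr => i _.
exact: cnt.
Qed.

(** Within a type the counts are independent by the definition of a Poisson process, across types by
    independence of the sources. *)
Let P_idx (c : 'I_M * R -> nat) :
  P [set w | forall i, i \in idx -> Y i w = (c i)%:R%:E] = \prod_(i <- idx) p i (c i).
Proof.
pose F (i : 'I_M + 'I_M * nat) := if i is inl m then type_event c m else setT.
have us : uniq [seq (inl m : 'I_M + 'I_M * nat) | m <- enum 'I_M].
  by rewrite map_inj_uniq ?enum_uniq// => m m' [].
have FE i : i \in [seq (inl m : 'I_M + 'I_M * nat) | m <- enum 'I_M] -> source_sigma pt G i (F i).
  by move=> /mapP[m _ ->]; exact: source_type_event.
have := sources_independent HC us FE.
rewrite big_map big_enum /= /idx big_allpairs_dep big_enum /=.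
under [X in _ = X -> _]eq_bigr do rewrite P_type_event.
move=> <-; congr (P _); apply/seteqP; split => w Hw.
  move=> _ /mapP[m _ ->] y ym; apply: Hw.
  by apply/allpairsPdep; exists m, y; rewrite mem_enum.
move=> _ /allpairsPdep[m [y [_ ym ->]]].
by apply: (Hw (inl m)) => //; apply: map_f; rewrite mem_enum.
Qed.

(** Counts in disjoint sets are independent Poisson variables, so the exponential moment factorizes
    into generating functions at [expR y]. Keeping only the first [n] points of each type makes it
    an inequality, as [y] is nonnegative. *)
Lemma poisson_simple_bound (n : nat) :
  \int[P]_w (expR (\sum_(m < M) \sum_(y <- ys m)
     y * \sum_(k < n) \1_(EFin @` B m y) (pt m k w)))%:E <=
  (expR (\sum_(m < M) mu m *
     \sum_(y <- ys m) fine (lebesgue_measure (B m y)) * (expR y - 1)))%:E.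
Proof.
have uidx : uniq idx.
  apply: allpairs_uniq_dep => //; first exact: enum_uniq.
  by move=> [m y] [m' y'] _ _ /= [-> ->].
pose a (i : 'I_M * R) (q : nat) (w : Om) : \bar R := (expR i.2 ^+ q)%:E.
have a0 i q w : 0 <= a i q w by rewrite lee_fin exprn_ge0// expR_ge0.
have ma i q : measurable_fun setT (a i q) by exact: measurable_cst.
have p0 i q : 0 <= p i q by exact: poisson_weight_ge0.
have p1 i : \sum_(q <oo) p i q = 1 by exact: poisson_weight_sum1.
(* Nothing random is frozen here: densities and factors are constants. *)
pose VV : set (Om -> \bar R) := [set W | exists2 v : R, (0 <= v)%R & W = cst v%:E].
have mVV W : VV W -> measurable_fun setT W by move=> [v _ ->]; exact: measurable_cst.
have VV0 W : VV W -> forall w, 0 <= W w by move=> [v v0 ->] w; rewrite lee_fin.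
have VVM W i q : VV W -> VV (fun w => W w * a i q w).
  move=> [v v0 ->]; exists (v * expR i.2 ^+ q)%R.
    by rewrite mulr_ge0// exprn_ge0// expR_ge0.
  by apply/funext => w; rewrite /= /a EFinM.
have VV1 : VV (cst 1) by exists 1%R.
have PT : P setT = 1 by exact: probability_setT.
have mE c : measurable [set w | forall i, i \in idx -> Y i w = (c i)%:R%:E].
  rewrite (_ : [set w | _] = \bigcap_(i in [set` idx]) (Y i @^-1` [set (c i)%:R%:E]))//.
  apply: fin_bigcap_measurable => // i _.
  by rewrite -[X in measurable X]setTI; exact: mY.
have E1 (c : 'I_M * R -> nat) W : VV W ->
    \int[P]_(w in setT `&` [set w | forall i, i \in idx -> Y i w = (c i)%:R%:E]) W w =
    1 * \prod_(i <- idx) p i (c i) * \int[P]_(w in setT) W w.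
  move=> [v v0 ->]; rewrite setTI !integral_cst// mul1e muleC.
  by congr (_ * _); [exact: P_idx|rewrite [X in _ = _ * X](_ : _ = 1) ?mule1//; exact: PT].
have E := integral_discrete_family mY ma a0 p0 mVV VV0 VVM uidx measurableT measurableT lee01 E1 VV1.
have [Z [mZ PZ ZN]] : P.-negligible (setT `&` [set w | exists2 i, i \in idx & forall k : nat, Y i w <> k%:R%:E]).
  apply: (values_ae mY p0 p1 uidx measurableT) => [|c].
    by rewrite -ge0_fin_numE// fin_num_measure.
  by rewrite setTI [X in _ = _ * X](_ : _ = 1) ?mule1; [exact: P_idx|exact: PT].
have mhit m y k : measurable_fun setT (fun w => \1_(EFin @` B m y) (pt m k w) : R).
  rewrite (_ : (fun w => _) = \1_(pt m k @^-1` (EFin @` B m y)))//.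
  apply: measurable_indic; rewrite -[X in measurable X]setTI.
  by have := mpt m k measurableT (measurable_image_EFin (mB m y)).
apply: (@le_trans _ _ (\int[P]_w (cst 1 w * \prod_(i <- idx) on_values Y a i w))).
  apply: ae_ge0_le_integral => //.
  - apply/measurable_EFinP; apply: measurableT_comp => //.
    apply: measurable_sum => m; apply: measurable_sum => y; apply: measurable_funM => //.
    by apply: measurable_sum => k; exact: mhit.
  - move=> w _; rewrite mul1e; apply: prode_ge0 => i _. exact: (on_values_ge0 _ a0).
  - apply: emeasurable_funM => //; apply: emeasurable_prod => // i _.
    exact: measurable_on_values.
  exists Z; split => // w /= H1; apply: ZN; split => //.
  apply: contrapT => H2; apply: H1 => _.
  have {}H2 i : exists q : nat, i \in idx -> Y i w = q%:R%:E.
    have [il|il] := pselect (i \in idx); last by exists 0%N.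
    apply: contrapT => H3; apply: H2; exists i => // q Yq; apply: H3; exists q => _.
    exact: Yq.
  have [q Yq] := choice H2.
  rewrite mul1e (eq_big_seq (fun i => (expR i.2 ^+ q i)%:E)); last first.
    by move=> i il; rewrite (on_values_nat (n := q i)) ?Yq.
  rewrite prodEFin lee_fin [leRHS](eq_bigr (fun i => expR ((q i)%:R * i.2)%R)); last first.
    by move=> i _; rewrite expRM_natl.
  rewrite -expR_sum ler_expR /idx big_allpairs_dep big_enum /=.
  apply: ler_sum => m _; rewrite big_seq [leRHS]big_seq; apply: ler_sum => y ym.
  rewrite [leRHS]mulrC; apply: ler_wpM2l; first exact: (ys0 ym).
  have myi : (m, y) \in idx by apply/allpairsPdep; exists m, y; rewrite mem_enum.
  rewrite -lee_fin -(Yq _ myi); exact: (counting_points_ge (@pt_inj m)).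
rewrite E mul1e.
rewrite (eq_integral (cst (expR (\sum_(m < M) mu m *
     \sum_(y <- ys m) fine (lebesgue_measure (B m y)) * (expR y - 1)))%:E)); last first.
  move=> w _; rewrite mul1e.
  rewrite (eq_bigr (fun i => (expR (rate i * (expR i.2 - 1)))%:E)); last first.
    by move=> i _; rewrite poisson_pgf// expR_ge0.
  rewrite prodEFin -expR_sum /idx big_allpairs_dep big_enum /=; congr (expR _)%:E.
  by apply: eq_bigr => m _; rewrite mulr_sumr; apply: eq_bigr => y _; rewrite /rate mulrA.
by rewrite integral_cst// [X in _ * X](_ : _ = 1) ?mule1//; exact: PT.
Qed.

End poisson_simple.

(** * The exponential formula by monotone approximation *)

Lemma integral_le_of_lim (R : realType) d (T : measurableType d)
    (mu : {measure set T -> \bar R}) (g : nat -> T -> \bar R) (f : T -> \bar R) (C : \bar R) :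
  (forall n, measurable_fun setT (g n)) -> (forall n x, 0 <= g n x) ->
  (forall x, nondecreasing_seq (g^~ x)) ->
  measurable_fun setT f -> (forall x, 0 <= f x) -> (forall x, f x <= limn (g^~ x)) ->
  (forall n, \int[mu]_x g n x <= C) -> \int[mu]_x f x <= C.
Proof.
move=> mg g0 ndg mf f0 fg gC.
have glim x : g^~ x @ \oo --> limn (g^~ x).
  by apply: ereal_nondecreasing_is_cvgn; exact: ndg.
have mlim : measurable_fun setT (fun x => limn (g^~ x)).
  by apply: (emeasurable_fun_cvg g) => // x _; exact: glim.
apply: (@le_trans _ _ (\int[mu]_x limn (g^~ x))).
  by apply: ge0_le_integral.
rewrite monotone_convergence//.
apply: lime_le; last exact: nearW.
apply: ereal_nondecreasing_is_cvgn => n m nm; apply: ge0_le_integral => //.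
by move=> x _; exact: ndg.
Qed.

Lemma cvg_sum_seq (R : realType) (I : Type) (s : seq I) (u : I -> nat -> R) (l : I -> R) :
  (forall i, u i n @[n --> \oo] --> l i) ->
  (\sum_(i <- s) u i n)%R @[n --> \oo] --> (\sum_(i <- s) l i)%R.
Proof.
move=> ul; elim: s => [|i s IH].
  by rewrite big_nil; under eq_fun do rewrite big_nil; exact: cvg_cst.
rewrite big_cons; under eq_fun do rewrite big_cons.
exact: cvgD.
Qed.

Import HBNNSimple.

Section real_approximation.
Context (R : realType) (f : R -> R) (mf : measurable_fun setT (EFin \o f)).
Hypothesis f0 : forall y, (0 <= f y)%R.

Let s n : {nnsfun R >-> R} := nnsfun_approx measurableT mf n.

Lemma nnsfun_approx_cvg x : s n x @[n --> \oo] --> f x.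
Proof.
have fE0 y : setT y -> (0%R <= (EFin \o f) y) by rewrite lee_fin.
exact: (fine_cvg (cvg_nnsfun_approx measurableT mf fE0 (x := x) Logic.I)).
Qed.

Lemma nnsfun_approx_nd x : nondecreasing_seq (fun n => s n x).
Proof. by move=> i j ij; exact/lefP/nd_nnsfun_approx. Qed.

Lemma nnsfun_approx_le n x : (s n x <= f x)%R.
Proof.
have -> : f x = limn (fun n => s n x) by apply/esym/cvg_lim => //; exact: nnsfun_approx_cvg.
apply: (nondecreasing_cvgn_le (@nnsfun_approx_nd x)).
by apply/cvg_ex; exists (f x); exact: nnsfun_approx_cvg.
Qed.

End real_approximation.

Definition range_seq (R : realType) (s : {nnsfun R >-> R}) : seq R :=
  finmap.enum_fset (fset_set (range s)).

Lemma mem_range_seq (R : realType) (s : {nnsfun R >-> R}) y :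
  (y \in range_seq s) <-> exists x, s x = y.
Proof.
rewrite -[y \in _]/(y \in fset_set (range s)) in_fset_set//.
split=> [/set_mem[x _ <-]|[x <-]]; first by exists x.
by apply/mem_set; exists x.
Qed.

Lemma range_seq_uniq (R : realType) (s : {nnsfun R >-> R}) : uniq (range_seq s).
Proof. exact: finmap.fset_uniq. Qed.

Section poisson_bound.
Context (R : realType) (M : nat) d (Om : measurableType d) (P : probability Om R)
  (mu : 'I_M -> R) (h : 'I_M -> 'I_M -> R -> R)
  (pt : 'I_M -> nat -> Om -> \bar R) (G : 'I_M -> nat -> Om -> Defs.cluster M R).
Hypothesis HC : is_cluster_construction P mu h pt G.
Hypothesis mu0 : forall m, (0 <= mu m)%R.
Variables (psi : 'I_M -> R -> R) (T c : R).
Hypothesis mpsi : forall m, measurable_fun setT (psi m).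
Hypothesis psi0 : forall m y, (0 <= psi m y)%R.
Hypothesis T0 : (0 < T)%R.
Hypothesis psi_le : forall m a k,
  \int[lebesgue_measure]_(x in `[a, (a + k%:R * T)%R[) (expR (psi m x) - 1)%:E <= c%:E.

Let mpsiE m : measurable_fun setT (EFin \o psi m). Proof. exact/measurable_EFinP. Qed.
Let mpt m k : measurable_fun setT (pt m k). Proof. exact: (roots_enum HC m).1. Qed.

Let s m N : {nnsfun R >-> R} := nnsfun_approx measurableT (mpsiE m) N.
(** The window has finite measure, as Poisson counts require, and consists of [N + N] whole periods,
    as [psi_le] requires. *)
Let W N : set R := `[(- (N%:R * T))%R, (N%:R * T)%R[.
Let ys m N : seq R := range_seq (s m N).
Let B m N y : set R := s m N @^-1` [set y] `&` W N.

Let t m N (X : \bar R) : R := if X is x%:E then (s m N x * \1_(W N) x)%R else 0%R.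

Let tE m N (X : \bar R) : t m N X = (\sum_(y <- ys m N) y * \1_(EFin @` B m N y) X)%R.
Proof.
case: X => [x||]; rewrite /t; last 2 first.
- by rewrite big1// => y _; rewrite indicE memNset ?mulr0// => -[].
- by rewrite big1// => y _; rewrite indicE memNset ?mulr0// => -[].
have sx : s m N x \in ys m N by apply/mem_range_seq; exists x.
rewrite (bigD1_seq (s m N x))//= ?big1 ?addr0; last 2 first.
- move=> y ysx; rewrite indicE memNset ?mulr0// => -[z [/= sz _] [zx]].
  by move: ysx; rewrite -sz zx eqxx.
- exact: range_seq_uniq.
congr (_ * _)%R; rewrite !indicE; congr ((nat_of_bool _)%:R).
apply/idP/idP => /set_mem Wx; apply/mem_set; first by exists x.
by case: Wx => z [_ Wz] [<-].
Qed.

Let t_nd m X : {homo (t m)^~ X : i j / (i <= j)%N >-> (i <= j)%R}.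
Proof.
move=> i j ij; case: X => [x||]//=; apply: ler_pM => //.
  exact: nnsfun_approx_nd.
rewrite !indicE ler_nat; case: (boolP (x \in W i)) => // /set_mem Wx.
rewrite mem_set//; move: Wx; rewrite /W /= !in_itv /= => /andP[x1 x2]; apply/andP; split.
  by apply: le_trans x1; rewrite lerN2 ler_pM2r// ler_nat.
by apply: (lt_le_trans x2); rewrite ler_pM2r// ler_nat.
Qed.

Let t_cvg m X : t m n X @[n --> \oo] --> (if X is x%:E then psi m x else 0%R).
Proof.
case: X => [x||] /=; [|exact: cvg_cst|exact: cvg_cst].
rewrite -[X in _ --> X]mulr1; apply: cvgM; first exact: nnsfun_approx_cvg.
apply: cvg_near_cst; near=> n.
rewrite indicE mem_set// /W /= in_itv /=.
have xn : (`|x| < n%:R * T)%R.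
  rewrite -ltr_pdivrMr//; near: n; exact: nbhs_infty_gtr.
by move: xn; rewrite ltr_norml => /andP[/ltW -> ->].
Unshelve. all: by end_near. Qed.

Let mW N : measurable (W N). Proof. exact: measurable_itv. Qed.
Let mB m N y : measurable (B m N y).
Proof.
apply: measurableI; last exact: mW.
rewrite -[X in measurable X]setTI.
exact: (@measurable_funP _ _ _ _ _ (s m N) measurableT _ (measurable_set1 y)).
Qed.

Let m_t m N i : measurable_fun setT (fun w => t m N (pt m i w)).
Proof.
under eq_fun do rewrite tE.
apply: measurable_sum => y; apply: measurable_funM => //.
rewrite (_ : (fun w => _) = \1_(pt m i @^-1` (EFin @` B m N y)))//.
apply: measurable_indic; rewrite -[X in measurable X]setTI.
by have := mpt m i measurableT (measurable_image_EFin (mB m N y)).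
Qed.

Let window_fin m N y : lebesgue_measure (B m N y) < +oo.
Proof.
apply: (@le_lt_trans _ _ (lebesgue_measure (W N))).
  apply: le_measure; rewrite ?inE; [exact: mB|exact: mW|exact: subIsetr].
by rewrite lebesgue_measure_itv /=; case: ifP => _; rewrite ?ltry.
Qed.

Let Bdisj m N : trivIset [set` ys m N] (B m N).
Proof. by move=> y z _ _ [x [[/= <- _] [<- _]]]. Qed.

Let ys0 m N y : y \in ys m N -> (0 <= y)%R.
Proof. by move=> /mem_range_seq[x <-]. Qed.

(** The sum is the integral over the window of [expR - 1] of the step function, which approximates
    [psi m] from below. *)
Let simple_le m N :
  (\sum_(y <- ys m N) fine (lebesgue_measure (B m N y)) * (expR y - 1) <= c)%R.
Proof.
have mexp D : measurable_fun D (fun x => (expR (psi m x) - 1)%:E).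
  apply/measurable_funTS/measurable_EFinP; apply: measurable_funB => //.
  exact: measurableT_comp.
have exp0 x : 0 <= (expR (psi m x) - 1)%:E.
  by rewrite lee_fin subr_ge0 -expR0 ler_expR.
have WE : W N = `[(- (N%:R * T))%R, (- (N%:R * T) + (N + N)%:R * T)%R[%classic.
  by rewrite /W natrD mulrDl addrA addNr add0r.
rewrite -lee_fin; apply: le_trans (psi_le m (- (N%:R * T))%R (N + N)%N); rewrite -WE.
apply: (@le_trans _ _ (\int[lebesgue_measure]_(x in \big[setU/set0]_(y <- ys m N) B m N y)
    (expR (psi m x) - 1)%:E)); last first.
  apply: ge0_subset_integral => //.
  - by apply: bigsetU_measurable => y _; exact: mB.
  - exact: mW.
  - exact: mexp.
  - by rewrite -bigcup_seq => x [y _ [_]].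
rewrite ge0_integral_bigsetU//; [|exact: mB|exact: range_seq_uniq|exact: mexp].
rewrite -sumEFin big_seq [leRHS]big_seq; apply: lee_sum => y yy.
apply: (@le_trans _ _ (\int[lebesgue_measure]_(x in B m N y) cst (expR y - 1)%:E x)).
  rewrite integral_cst; last exact: mB.
  rewrite EFinM fineK; first by rewrite muleC.
  by rewrite ge0_fin_numE.
apply: ge0_le_integral; [exact: mB| |exact: measurable_cst|exact: mexp|].
  by move=> x _; rewrite lee_fin subr_ge0 -expR0 ler_expR (ys0 yy).
by move=> x [/= <- _]; rewrite lee_fin lerD2r ler_expR; exact: nnsfun_approx_le.
Qed.

Lemma poisson_bound (n : nat) :
  \int[P]_w (\prod_(p <- [seq (m, i) | m <- enum 'I_M, i <- iota 0 n])
     root_val psi p.1 (pt p.1 p.2 w))%:E <= (expR (\sum_(m < M) mu m * c))%:E.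
Proof.
pose S N w : R := (\sum_(p <- [seq (m, i) | m <- enum 'I_M, i <- iota 0 n])
  t p.1 N (pt p.1 p.2 w))%R.
have SE N w : S N w = (\sum_(m < M) \sum_(y <- ys m N)
     y * \sum_(i < n) \1_(EFin @` B m N y) (pt m i w))%R.
  rewrite /S big_allpairs big_enum /=; apply: eq_bigr => m _.
  under eq_bigr do rewrite tE.
  rewrite exchange_big /=; apply: eq_bigr => y _.
  by rewrite -mulr_sumr -[n in iota 0 n]subn0 big_mkord.
apply: (@integral_le_of_lim _ _ _ P (fun N w => (expR (S N w))%:E)) => //.
- move=> N; apply/measurable_EFinP; apply: measurableT_comp => //.
  by apply: measurable_sum => p; exact: m_t.
- move=> w i j ij; rewrite lee_fin ler_expR; apply: ler_sum => p _.
  exact: t_nd.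
- apply/measurable_EFinP; apply: measurable_prod => p _.
  exact: (measurable_root_val mpsi p.1 (mpt p.1 p.2)).
- by move=> w; rewrite lee_fin; apply: prodr_ge0 => p _; exact: root_val_ge0.
- move=> w; rewrite le_eqVlt; apply/orP; left; apply/eqP/esym/cvg_lim => //.
  apply: cvg_EFin; first by apply: nearW.
  rewrite (_ : (\prod_(p <- _) _)%R = expR (\sum_(p <- [seq (m, i) | m <- enum 'I_M, i <- iota 0 n])
     (if pt p.1 p.2 w is x%:E then psi p.1 x else 0))%R); last first.
    rewrite expR_sum; apply: eq_bigr => p _; rewrite /root_val.
    by case: (pt p.1 p.2 w) => [x||] //=; rewrite expR0.
  apply: (continuous_cvg _ (@continuous_expR R _)).
  by apply: cvg_sum_seq => p; exact: t_cvg.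
- move=> N; under eq_integral do rewrite SE.
  apply: le_trans (poisson_simple_bound HC mu0 (fun m => range_seq_uniq _)
    (fun m => mB m N) (fun m => window_fin m N) (fun m => @Bdisj m N) (fun m => @ys0 m N) n) _.
  rewrite lee_fin ler_expR; apply: ler_sum => m _; apply: ler_wpM2l => //.
  exact: simple_le.
Qed.

End poisson_bound.

(** * Sums over point configurations *)

Lemma esum_indic (R : realType) (T : choiceType) (A B : set T) (y : R) : (0 <= y)%R ->
  \esum_(x in A) (y * \1_B x)%:E = y%:E * counting (A `&` B).
Proof.
move=> y0; transitivity (\esum_(x in A `&` B) y%:E).
  rewrite esum_mkcondr; apply: eq_esum => x _; rewrite indicE.
  by case: ifP => _; rewrite ?mulr1 ?mulr0.
rewrite /counting; case: ifPn => /asboolP fD.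
  rewrite esum_fset// fsbig_finite//= sumEFin big_const_seq count_predT iter_addr addr0.
  by rewrite -EFinM mulr_natr.
move: y0; rewrite le_eqVlt => /predU1P[<-|y0]; first by rewrite mul0e esum1.
(* Both sides are infinite: a finite subset with more than [r / y] points already gives a sum of at
   least [r]. *)
rewrite gt0_muley ?lte_fin//; apply/eqyP => r r0.
have [X XD Xn] := infinite_set_fset (Num.truncn (r / y)).+1 fD.
apply: esum_ge; exists [set` X]; first by split.
rewrite fsbig_finite//= set_fsetK sumEFin big_const_seq count_predT iter_addr addr0 lee_fin.
rewrite -[(_ *+ _)%R]mulr_natl -ler_pdivrMr//.
apply: (le_trans (ltW (truncnS_gt _))); rewrite ler_nat; exact: Xn.
Qed.

Section linear_stat_measurable.
Context (R : realType) (M : nat) (f : R -> R).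
Hypothesis mf : measurable_fun setT f.
Hypothesis f0 : forall y, (0 <= f y)%R.

Let mfE : measurable_fun setT (EFin \o f). Proof. exact/measurable_EFinP. Qed.
Let s n : {nnsfun R >-> R} := nnsfun_approx measurableT mfE n.

Lemma measurable_config_count (m : 'I_M) (B : set R) : measurable B ->
  measurable_fun setT (fun c : config_space M R => counting (c m `&` B) : \bar R).
Proof.
move=> mB _ E mE; rewrite setTI; apply: sub_sigma_algebra.
by exists m, B, E; split.
Qed.

Let esum_approxE (A : set R) n :
  \esum_(x in A) (s n x)%:E =
  \sum_(y <- range_seq (s n)) y%:E * counting (A `&` s n @^-1` [set y]).
Proof.
transitivity (\sum_(y <- range_seq (s n) | (0 <= y)%R)
    \esum_(x in A) (y * \1_(s n @^-1` [set y]) x)%:E).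
  rewrite -esum_sum; last by move=> x y _ y0; rewrite lee_fin mulr_ge0.
  apply: eq_esum => x _; rewrite fimfunE fsbig_finite//= sumEFin; congr EFin.
  rewrite big_seq [RHS]big_mkcond [RHS]big_seq; apply: eq_bigr => y ys.
  by have [z <-] := (mem_range_seq _ _).1 ys; rewrite ifT.
rewrite big_mkcond big_seq [RHS]big_seq; apply: eq_bigr => y ys.
by have [z <-] := (mem_range_seq _ _).1 ys; rewrite ifT// esum_indic.
Qed.

(** Limits of increasing sums are suprema, and the supremum over [n] commutes with the one over
    finite subsets of [A]. *)
Let esum_approx_cvg (A : set R) :
  \esum_(x in A) (s n x)%:E @[n --> \oo] --> \esum_(x in A) (f x)%:E.
Proof.
have nd : nondecreasing_seq (fun n => \esum_(x in A) (s n x)%:E).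
  by move=> i j ij; apply: le_esum => x _; rewrite lee_fin; exact: nnsfun_approx_nd.
rewrite (_ : \esum_(x in A) (f x)%:E = ereal_sup (range (fun n => \esum_(x in A) (s n x)%:E))).
  exact: ereal_nondecreasing_cvgn.
apply/eqP; rewrite eq_le; apply/andP; split; last first.
  apply: ge_ereal_sup => _ [n _ <-]; apply: le_esum => x _.
  by rewrite lee_fin; exact: nnsfun_approx_le.
apply: ge_ereal_sup => _ [X [finX XA] <-]; rewrite fsbig_finite// sumEFin.
have cv : (\sum_(x <- fset_set X) s n x)%:E @[n --> \oo] --> (\sum_(x <- fset_set X) f x)%:E.
  apply: cvg_EFin; first exact: nearW.
  by apply: cvg_sum_seq => x; exact: nnsfun_approx_cvg.
rewrite -(cvg_lim _ cv)//; apply: lime_le; first by apply/cvg_ex; eexists; exact: cv.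
apply: nearW => n; apply: (@le_trans _ _ (\esum_(x in A) (s n x)%:E)).
  by apply: esum_ge; exists X; rewrite ?fsbig_finite// sumEFin.
by apply: ereal_sup_ubound; exists n.
Qed.

(** For a step function the statistic is a combination of counts, which generate the sigma-algebra
    on configurations; the general case is a limit of these. *)
Lemma measurable_linear_stat :
  measurable_fun setT (linear_stat f : config_space M R -> \bar R).
Proof.
apply: emeasurable_sum => m.
apply: (emeasurable_fun_cvg (fun n (c : config_space M R) => \esum_(x in c m) (s n x)%:E)).
  move=> n; apply: (eq_measurable_fun (fun c : config_space M R =>
      \sum_(y <- range_seq (s n)) y%:E * counting (c m `&` s n @^-1` [set y]))).
    by move=> c _; rewrite esum_approxE.
  apply: emeasurable_sum => y; apply: measurable_funeM.
  apply: measurable_config_count; rewrite -[X in measurable X]setTI.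
  exact: (@measurable_funP _ _ _ _ _ (s n) measurableT _ (measurable_set1 y)).
by move=> c _; exact: esum_approx_cvg.
Qed.

Lemma linear_stat_ge0 (c : point_config M R) : 0 <= linear_stat f c.
Proof. by apply: sume_ge0 => m _; apply: esum_ge0 => x _; rewrite lee_fin. Qed.

End linear_stat_measurable.

Lemma same_law_integral (R : realType) (M : nat)
    d1 (Om1 : measurableType d1) (P1 : probability Om1 R)
    d2 (Om2 : measurableType d2) (P2 : probability Om2 R)
    (N1 : Om1 -> point_config M R) (N2 : Om2 -> point_config M R)
    (F : config_space M R -> \bar R) :
  measurable_fun setT (N1 : Om1 -> config_space M R) ->
  measurable_fun setT (N2 : Om2 -> config_space M R) ->
  same_law P1 P2 N1 N2 -> measurable_fun setT F -> (forall c, 0 <= F c) ->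
  \int[P1]_w F (N1 w) = \int[P2]_w F (N2 w).
Proof.
move=> mN1 mN2 sl mF F0.
have [p1 [p1E p1i]] := pushforward_finite P1 mN1.
have [p2 [p2E p2i]] := pushforward_finite P2 mN2.
rewrite -(p1i F)// -(p2i F)//; apply: eq_measure_integral => A mA _.
by rewrite [LHS]p1E [RHS]p2E; exact: sl.
Qed.

Lemma ler_sum_uniq_subset (R : realType) (I : eqType) (s1 s2 : seq I) (F : I -> R) :
  uniq s1 -> {subset s1 <= s2} -> (forall i, 0 <= F i)%R ->
  (\sum_(i <- s1) F i <= \sum_(i <- s2) F i)%R.
Proof.
move=> + + F0; elim: s1 s2 => [|i s1 IH] s2 /=.
  by move=> _ _; rewrite big_nil sumr_ge0.
move=> /andP[is1 us1] sub; have is2 : i \in s2 by apply: sub; exact: mem_head.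
rewrite big_cons (big_rem i is2) /= lerD2l; apply: IH => // j js1.
have : j \in s2 by apply: sub; rewrite inE js1 orbT.
rewrite (perm_mem (perm_to_rem is2)) inE => /predU1P[ji|//].
by rewrite -ji js1 in is1.
Qed.

(** * Contributions of the individuals of the clusters *)

Section births.
Context (R : realType) (M : nat) (Om : Type) (f : R -> R)
  (pt : 'I_M -> nat -> Om -> \bar R) (G : 'I_M -> nat -> Om -> Defs.cluster M R).
Hypothesis f0 : forall y, (0 <= f y)%R.

Definition roots (n : nat) : seq ('I_M * nat) := [seq (m, i) | m <- enum 'I_M, i <- iota 0 n].

(** One parameter truncates the indices of the roots, the ranks of children and the generations, so
    that a single monotone limit reaches all individuals. *)
Definition box (n : nat) : seq ('I_M * nat * label) :=
  [seq (p, u) | p <- roots n, u <- below n n.+1].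

Lemma roots_uniq n : uniq (roots n).
Proof.
apply: allpairs_uniq; [exact: enum_uniq|exact: iota_uniq|].
by move=> [m i] [m' i'].
Qed.

Lemma box_uniq n : uniq (box n).
Proof.
apply: allpairs_uniq; [exact: roots_uniq|exact: below_uniq|].
by move=> [[? ?] ?] [[? ?] ?] _ _ [-> -> ->].
Qed.

Lemma mem_box n m i u : ((m, i, u) \in box n) = (i < n)%N && (u \in below n n.+1).
Proof.
apply/allpairsP/idP => [[[p v] [/= pr vb [pE ->]]]|/andP[im ub]].
  rewrite vb andbT; move: pr; rewrite -pE => /allpairsP[[m' i'] [/= _ + [_ ->]]].
  by rewrite mem_iota.
exists ((m, i), u); split => //=; apply/allpairsP; exists (m, i).
by split => //=; rewrite ?mem_enum// mem_iota.
Qed.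

Lemma box_mono n n' : (n <= n')%N -> {subset box n <= box n'}.
Proof.
move=> nn' [[m i] u]; rewrite !mem_box !mem_below => /and3P[im un ua].
rewrite (leq_trans im nn') (leq_trans un)//=.
by apply: sub_all ua => j jn; exact: leq_trans jn nn'.
Qed.

Lemma box_exhaust (X : seq ('I_M * nat * label)) : exists n, {subset X <= box n}.
Proof.
elim: X => [|[[m i] u] X [n Xn]]; first by exists 0%N.
exists (maxn n (maxn i.+1 (maxn (size u) (\max_(j <- u) j.+1)))) => -[[m' i'] u'].
rewrite inE => /predU1P[[-> -> ->]|/Xn]; last by apply: box_mono; exact: leq_maxl.
rewrite mem_box mem_below; apply/and3P; split.
- by rewrite !leq_max leqnn orbT.
- by rewrite ltnS !leq_max leqnn !orbT.
- apply/allP => j ju; rewrite !leq_max; do 3 (apply/orP; right).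
  exact: (leq_bigmax_seq (F := S) _ ju isT).
Qed.

(* The term that the individual i.2 of the cluster i.1 contributes to N(f). *)
Definition contrib (i : 'I_M * nat * label) (w : Om) : R :=
  if pt i.1.1 i.1.2 w is x%:E then
    if G i.1.1 i.1.2 w i.2 is Some (_, s) then f (x + s) else 0%R
  else 0%R.

Lemma contrib_ge0 i w : (0 <= contrib i w)%R.
Proof.
rewrite /contrib; case: (pt _ _ w) => [x||] //.
by case: (G _ _ w i.2) => [[m s]|].
Qed.

(** [cluster_births] is a set of dates: choosing one individual for each date is injective, while
    simultaneous births of one type count once, whence an inequality. *)
Lemma linear_stat_births_le w : linear_stat f (cluster_births pt G w) <=
  ereal_sup (range (fun n => (\sum_(i <- box n) contrib i w)%:E)).
Proof.
pose is_birth m (i : 'I_M * nat * label) t := exists x s,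
  [/\ pt i.1.1 i.1.2 w = x%:E, G i.1.1 i.1.2 w i.2 = Some (m, s) & t = (x + s)%R].
(* An individual has at most one type, so the sum over [m] of these is at most [contrib]. *)
pose typed_contrib m i := if `[< exists t, is_birth m i t >] then contrib i w else 0%R.
have type_le m : \esum_(t in cluster_births pt G w m) (f t)%:E <=
    \esum_(i in [set: 'I_M * nat * label]) (typed_contrib m i)%:E.
  have H t : exists i, cluster_births pt G w m t -> is_birth m i t.
    have [[m0 [k [x [u [s [e1 e2 e3]]]]]]|nb] := pselect (cluster_births pt G w m t).
      by exists (m0, k, u) => _; exists x, s.
    case: (pselect (exists i, is_birth m i t)) => [[i ib]|_]; first by exists i.
    have [[]|] := pselect (exists i : 'I_M * nat * label, True); first by move=> i _; exists i.
    by move=> _; exists (m, 0%N, [::] : label).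
  have [e eP] := choice H.
  apply: ge_ereal_sup => _ [X [finX XA] <-].
  apply: esum_ge; exists (e @` X).
    by split => //; exact: finite_image.
  rewrite [leRHS](reindex_fsbig e X (e @` X)); last first.
    apply: inj_bij => t1 t2 /set_mem X1 /set_mem X2 e12.
    have [x1 [s1 [p1 g1 ->]]] := eP _ (XA _ X1).
    have [x2 [s2 [p2 g2 ->]]] := eP _ (XA _ X2).
    move: p1 g1; rewrite e12 p2 g2 => -[<-] [<-].
    by [].
  apply: lee_fsum => // t Xt.
  have ebirth : is_birth m (e t) t by exact/eP/XA.
  rewrite /typed_contrib asboolT; last by exists t.
  by have [x [s [p1 g1 tE]]] := ebirth; rewrite /contrib p1 g1 -tE.
have -> : linear_stat f (cluster_births pt G w) =
    \sum_(m < M) \esum_(t in cluster_births pt G w m) (f t)%:E by [].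
apply: (@le_trans _ _ (\sum_(m < M)
    \esum_(i in [set: 'I_M * nat * label]) (typed_contrib m i)%:E)).
  exact: lee_sum.
have tc0 m i : (0 <= typed_contrib m i)%R.
  by rewrite /typed_contrib; case: ifP => // _; exact: contrib_ge0.
rewrite -esum_sum; last by move=> i m _ _; rewrite lee_fin.
apply: (@le_trans _ _ (\esum_(i in [set: 'I_M * nat * label]) (contrib i w)%:E)).
  apply: le_esum => i _; rewrite sumEFin lee_fin.
  case E : (G i.1.1 i.1.2 w i.2) => [[m s]|]; last first.
    rewrite big1 ?contrib_ge0// => m _; rewrite /typed_contrib; case: ifP => // /asboolP[t [x [s []]]].
    by rewrite E.
  rewrite (bigD1 m)//= big1 ?addr0.
    by rewrite /typed_contrib; case: ifP => // _; exact: contrib_ge0.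
  move=> m' mm'; rewrite /typed_contrib; case: ifP => // /asboolP[t [x [s' []]]].
  by rewrite E => _ [mE]; rewrite mE eqxx in mm'.
apply: ge_ereal_sup => _ [X [finX _] <-]; rewrite fsbig_finite//= sumEFin.
have [n Xn] := box_exhaust (finmap.enum_fset (fset_set X)).
apply: (@le_trans _ _ (\sum_(i <- box n) contrib i w)%:E).
  rewrite lee_fin; apply: ler_sum_uniq_subset => //; first exact: finmap.fset_uniq.
  by move=> i; exact: contrib_ge0.
by apply: ereal_sup_ubound; exists n.
Qed.

End births.

(** * Conclusion *)

Section delay_measure.
Context (R : realType) (h : R -> R).
Hypothesis mh : measurable_fun (`[0%R, +oo[ : set R) h.
Hypothesis h0 : forall t, (0 <= t)%R -> (0 <= h t)%R.
Hypothesis hfin : L1norm h < +oo.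

Lemma L1norm_ge0 : 0 <= L1norm h.
Proof.
apply: integral_ge0 => t /=; rewrite in_itv /= andbT => t0.
by rewrite lee_fin h0.
Qed.

Let I : set R := `]0%R, +oo[.

Let g (s : R) : \bar R := (h s / fine (L1norm h))%:E.

Let sub_half_line B : B `&` I `<=` `[0%R, +oo[.
Proof. by move=> x [_]; rewrite /I /= !in_itv /= !andbT => /ltW. Qed.

Let g0 x : I x -> 0 <= g x.
Proof.
rewrite /I /= in_itv /= andbT => x0.
by rewrite lee_fin divr_ge0//; [exact/h0/ltW|exact/fine_ge0/L1norm_ge0].
Qed.

Let mg : measurable_fun (`[0%R, +oo[ : set R) g.
Proof.
by apply/measurable_EFinP; apply: measurable_funM => //; exact: measurable_cst.
Qed.

Let delay0 : delay_law h set0 = 0.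
Proof. by rewrite /delay_law set0I integral_set0. Qed.

Let delay_ge0 B : 0 <= delay_law h B.
Proof. by apply: integral_ge0 => x [_ Ix]; exact: g0. Qed.

Let delay_sigma_additive : semi_sigma_additive (delay_law h).
Proof.
move=> F mF tF mUF; rewrite /delay_law; apply: cvg_toP.
  apply: ereal_nondecreasing_is_cvgn => m n mn.
  apply: lee_sum_nneg_natr => // k _ _; exact: delay_ge0.
rewrite setI_bigcupl ge0_integral_bigcup//.
- by move=> i; exact: (measurableI _ _ (mF i) (measurable_itv _)).
- apply: (measurable_funS (measurable_itv _) _ mg).
  by rewrite -setI_bigcupl; exact: sub_half_line.
- by move=> x [i _ [_ Ix]]; exact: g0.
- by apply: trivIset_setIr.
Qed.

HB.instance Definition _ := isMeasure.Build _ _ _ (delay_law h)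
  delay0 delay_ge0 delay_sigma_additive.

(** The mass is 1 except when [L1norm h] is 0: then the density is a division by 0, equal to 0, and
    the law is null. *)
Lemma delay_law_le1 : delay_law h setT <= 1.
Proof.
rewrite /delay_law setTI.
apply: (@le_trans _ _ (\int[lebesgue_measure]_(s in `[0%R, +oo[) g s)).
  apply: ge0_subset_integral => //=.
  - by move=> x; rewrite /= in_itv /= andbT => x0; rewrite lee_fin divr_ge0//; [exact: h0|exact/fine_ge0/L1norm_ge0].
  - by move=> x /=; rewrite !in_itv /= !andbT => /ltW.
rewrite /g; under eq_integral do rewrite mulrC EFinM.
rewrite ge0_integralZl//; last 3 first.
- exact/measurable_EFinP.
- by move=> x; rewrite /= in_itv /= andbT => x0; rewrite lee_fin h0.
- by rewrite lee_fin invr_ge0; exact/fine_ge0/L1norm_ge0.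
have fn : L1norm h \is a fin_num by rewrite ge0_fin_numE// L1norm_ge0.
rewrite -[X in _ * X]/(L1norm h) -[in X in _ * X](fineK fn) -EFinM lee_fin.
have [->|c0] := eqVneq (fine (L1norm h)) 0%R; first by rewrite mulr0.
by rewrite mulVf.
Qed.

Lemma delay_measure : exists kap : {finite_measure set R -> \bar R},
  (forall B, measurable B -> kap B = delay_law h B) /\ kap setT <= 1.
Proof.
have [|kap kapE] := @measure_to_finite _ _ _ [the {measure set R -> \bar R} of delay_law h].
  move=> B mB; rewrite ge0_fin_numE//; apply: (@le_lt_trans _ _ 1); last exact: ltry.
  apply: le_trans delay_law_le1; apply: le_measure; rewrite ?inE//; exact: subsetT.
by exists kap; split=> [B _|]; rewrite kapE//; exact: delay_law_le1.
Qed.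

End delay_measure.

Lemma measurable_expeR_linear_stat (R : realType) (M : nat) (f : R -> R) (xi : R) :
  measurable_fun setT f -> (forall y, (0 <= f y)%R) -> (0 <= xi)%R ->
  measurable_fun setT (fun c : config_space M R => expeR (xi%:E * linear_stat f c)).
Proof.
move=> mf f0 xi0.
(* [expeR] and [er_map expR] differ only at [-oo], a value which a nonnegative statistic does not
   take. *)
apply: (eq_measurable_fun (fun c : config_space M R => er_map expR (xi%:E * linear_stat f c))).
  move=> e _ /=; have : 0 <= xi%:E * linear_stat f e by rewrite mule_ge0// linear_stat_ge0.
  by case: (_ * _).
apply: measurableT_comp; first exact: (measurable_er_map (measurableTypeR R)).
by apply: measurable_funeM; exact: measurable_linear_stat.
Qed.

(** * From truncated clusters to the full process *)

Section births_laplace.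
Context (R : realType) (M : nat) d (Om : measurableType d) (P : probability Om R)
  (mu : 'I_M -> R) (h : 'I_M -> 'I_M -> R -> R)
  (pt : 'I_M -> nat -> Om -> \bar R) (G : 'I_M -> nat -> Om -> Defs.cluster M R)
  (f : R -> R) (xi : R).
Hypothesis f0 : forall y, (0 <= f y)%R.
Hypothesis xi0 : (0 <= xi)%R.

Let fw : 'I_M -> R -> R := fun _ y => expR (xi * f y).

Let partial n w : R := (\sum_(i <- box M n) contrib f pt G i w)%R.

Let partial_expR n w : (\prod_(p <- roots M n)
    cluster_val fw (below n n.+1) (pt p.1 p.2 w) (G p.1 p.2 w))%R = expR (xi * partial n w).
Proof.
rewrite /partial [X in (xi * X)%R]big_allpairs mulr_sumr expR_sum; apply: eq_bigr => p _.
rewrite mulr_sumr expR_sum /cluster_val /contrib /=.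
case: (pt p.1 p.2 w) => [x||] /=; last 2 first.
- by rewrite big1// => u _; rewrite mulr0 expR0.
- by rewrite big1// => u _; rewrite mulr0 expR0.
apply: eq_bigr => u _; case: (G p.1 p.2 w u) => [[m s]|] //=.
by rewrite mulr0 expR0.
Qed.

Let partial_nd w : nondecreasing_seq (partial ^~ w).
Proof.
move=> i j ij; apply: ler_sum_uniq_subset; [exact: box_uniq|exact: box_mono|].
by move=> k; exact: contrib_ge0.
Qed.

Let expR_partial_nd w : nondecreasing_seq (fun n => (expR (xi * partial n w))%:E).
Proof. by move=> i j ij; rewrite lee_fin ler_expR ler_wpM2l//; exact: partial_nd. Qed.

(** Writing the limit as [expeR b] reduces the comparison of exponentials to one of exponents. The
    case [xi = 0] is separate because the supremum is reached through a division by [xi]. *)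
Let le_lim w : expeR (xi%:E * linear_stat f (cluster_births pt G w)) <=
  limn (fun n => (expR (xi * partial n w))%:E).
Proof.
set L := limn _.
have gL n : (expR (xi * partial n w))%:E <= L.
  rewrite /L (cvg_lim _ (ereal_nondecreasing_cvgn (expR_partial_nd w)))//.
  by apply: ereal_sup_ubound; exists n.
have [b bL] : exists b, expeR b = L.
  by apply: expeR_total; apply: le_trans (gL 0%N); rewrite lee_fin expR_ge0.
have gb n : (xi * partial n w)%:E <= b by rewrite -lee_expeR bL; exact: gL.
rewrite -bL lee_expeR; have [x0|x0] := eqVneq xi 0%R.
  by have := gb 0%N; rewrite x0 mul0r mul0e.
have xi_gt0 : (0 < xi)%R by rewrite lt_neqAle eq_sym x0.
rewrite -lee_pdivlMl//; apply: le_trans (linear_stat_births_le _ _ f0 w) _.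
apply: ge_ereal_sup => _ [n _ <-]; rewrite lee_pdivlMl// -EFinM; exact: gb.
Qed.

Variables (T c : R) (psi : nat -> 'I_M -> R -> R).
Hypothesis HC : is_cluster_construction P mu h pt G.
Hypothesis mu0 : forall m, (0 <= mu m)%R.
Hypothesis mf : measurable_fun setT f.
Hypothesis mbirths : measurable_fun setT (cluster_births pt G : Om -> config_space M R).
Hypothesis mpsi : forall n m, measurable_fun setT (psi n m).
Hypothesis psi0 : forall n m y, (0 <= psi n m y)%R.
Hypothesis T0 : (0 < T)%R.
Hypothesis psi_le : forall n m a k,
  \int[lebesgue_measure]_(x in `[a, (a + k%:R * T)%R[) (expR (psi n m x) - 1)%:E <= c%:E.
Hypothesis cluster_le : forall n m i x,
  \int[P]_w (\prod_(u <- below n n.+1) val fw x (G m i w u))%:E <= (expR (psi n m x))%:E.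

Lemma births_laplace_le :
  \int[P]_w expeR (xi%:E * linear_stat f (cluster_births pt G w)) <=
  (expR (\sum_(m < M) mu m * c))%:E.
Proof.
have mfw (m : 'I_M) : measurable_fun setT (fw m).
  by apply: measurableT_comp => //; exact: measurable_funM.
have fw0 (m : 'I_M) y : (0 <= fw m y)%R by exact: expR_ge0.
have mpt m k : measurable_fun setT (pt m k) by exact: (roots_enum HC m).1.
have mG m k : measurable_fun setT (G m k : Om -> cluster_space M R).
  exact: (cluster_measurable (clusters_law HC m k)).
apply: (@integral_le_of_lim _ _ _ P (fun n w => (expR (xi * partial n w))%:E)) => //.
- move=> n; apply/measurable_EFinP; rewrite (_ : (fun w => _) = fun w =>
    (\prod_(p <- roots M n) cluster_val fw (below n n.+1) (pt p.1 p.2 w) (G p.1 p.2 w))%R).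
    by apply: measurable_prod => p _; exact: measurable_cluster_val.
  by apply/funext => w; rewrite partial_expR.
- exact: (measurableT_comp (measurable_expeR_linear_stat mf f0 xi0) mbirths).
- by move=> w; exact: expeR_ge0.
- move=> n; under eq_integral do rewrite -partial_expR.
  apply: le_trans (integral_clusters_le HC mfw fw0 (mpsi n) (cluster_le n) (roots_uniq M n)) _.
  exact: (poisson_bound HC mu0 (mpsi n) (psi0 n) T0 (psi_le n)).
Qed.

End births_laplace.

Lemma le_norm_1_infty (R : realType) (T : R) (f : R -> R) (k : nat) (y : R) :
  (forall t, (0 <= f t)%R) ->
  (\sum_(i < k) f (y + i%:R * T))%:E <= norm_1_infty T f.
Proof.
move=> f0; apply: (@le_trans _ _ (\esum_(n in [set: int]) (f (y + n%:~R * T)%R)%:E)).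
  apply: esum_ge; exists [set` [seq Posz i | i <- iota 0 k]]; first by split; [exact: finite_seq|].
  rewrite -fsbig_seq; last by rewrite map_inj_uniq; [exact: iota_uniq|move=> i j []].
  by rewrite big_map -[in iota 0 k](subn0 k) big_mkord sumEFin.
by apply: ereal_sup_ubound; exists y.
Qed.

Lemma C_rK_gt0 (R : realType) (r K : R) : (r < 1)%R -> (0 <= K)%R -> (0 < C_rK r K)%R.
Proof.
move=> r1 K0; rewrite /C_rK ltr_wpDr//; apply: divr_ge0; first exact: mulr_ge0.
by rewrite subr_ge0 ltW.
Qed.

(** The case of a finite norm, phrased with a real bound [a] and a product, so that neither extended
    reals nor a division by a zero norm interfere. *)
Lemma hawkes_laplace_le (R : realType) d (Omega : measurableType d) (P : probability Omega R)
    (M : nat) (mu : 'I_M -> R) (h : 'I_M -> 'I_M -> R -> R)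
    (N : Omega -> point_config M R) (r K xi a T : R) (f : R -> R) :
  (forall m, (0 <= mu m)%R) ->
  (forall m' m : 'I_M, measurable_fun (`[0%R, +oo[ : set R) (h m' m)) ->
  (forall m' m t, (0 <= t)%R -> (0 <= h m' m t)%R) ->
  (forall m' m, L1norm (h m' m) < +oo) ->
  stationary_hawkes P mu h N ->
  (0 < r)%R -> (r < 1)%R -> (0 <= K)%R ->
  (forall n, (1 <= n)%N -> (opnorm_infty (L1_matrix h ^+ n) <= K * r ^+ n)%R) ->
  measurable_fun setT f -> (forall t, (0 <= f t)%R) -> (0 < T)%R -> (0 <= xi)%R ->
  (0 <= a)%R -> norm_1_infty T f <= a%:E ->
  (xi * a * C_rK r K <= ln ((1 + r) / (2 * r)))%R ->
  \int[P]_w expeR (xi%:E * linear_stat f (N w)) <=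
  (expR ((expR (xi * a * C_rK r K) - 1) * (T * \sum_(m < M) mu m)))%:E.
Proof.
move=> mu0 mh h0 hfin [[mN _] [d' [Om' [P' [pt [G [HC [mB _] law]]]]]]].
move=> r0 r1 K0 AK mf f0 T0 xi0 a0 na xia.
pose theta := (xi * a)%R; pose F y := (xi * f y)%R.
have theta0 : (0 <= theta)%R by exact: mulr_ge0.
have H0 m m' : (0 <= L1_matrix h m m')%R.
  by rewrite mxE; apply/fine_ge0/L1norm_ge0 => // t; exact: h0.
have [kap kapP] := choice (fun p : 'I_M * 'I_M =>
  delay_measure (mh p.1 p.2) (h0 p.1 p.2) (hfin p.1 p.2)).
have kapE m m' B : measurable B -> kap (m, m') B = delay_law (h m m') B.
  by move=> mB'; exact: (kapP (m, m')).1.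
have kap1 m m' : kap (m, m') setT <= 1 by exact: (kapP (m, m')).2.
have F0 y : (0 <= F y)%R by exact: mulr_ge0.
have mF : measurable_fun setT F by exact: measurable_funM.
have FT k y : (\sum_(i < k) F (y + i%:R * T) <= theta)%R.
  rewrite -mulr_sumr ler_wpM2l// -lee_fin; apply: le_trans na.
  exact: le_norm_1_infty.
pose v := potential (L1_matrix h) r theta.
have v0 m : (theta <= v 0%N m)%R by exact: potential0.
have vS j m : (theta + \sum_(m' < M) L1_matrix h m m' * (expR (v j m') - 1) <= v j.+1 m)%R.
  exact: (potentialS H0 r0 r1 K0 theta0 AK xia).
pose A m m' := L1_matrix h m m'.
pose psi n := psi A (fun m m' => kap (m, m')) F n.
have psiP n m := psi_spec (H := A) (kap := fun m m' => kap (m, m')) H0 kap1 F0 mF FT v0 vS n m.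
have psi_le n m b k : \int[lebesgue_measure]_(x in `[b, (b + k%:R * T)%R[)
    (expR (psi n m x) - 1)%:E <= (T * (expR (theta * C_rK r K) - 1))%:E.
  apply: le_trans (integral_psi_le (H := A) (kap := fun m m' => kap (m, m'))
    H0 kap1 F0 mF FT v0 vS n m b k T0) _.
  rewrite lee_fin ler_pM2l// lerD2r ler_expR.
  exact: potential_le.
have cl n m i x : \int[P']_w (\prod_(u <- below n n.+1)
    val (fun _ y => expR (xi * f y)) x (G m i w u))%:E <= (expR (psi n m x))%:E.
  exact: (cluster_bound kapE kap1 F0 mF H0 FT v0 vS n n x (clusters_law HC m i)).
(* The exponential moment depends only on the law of [N], hence can be computed on the cluster
   construction. *)
rewrite (same_law_integral mN mB law (measurable_expeR_linear_stat mf f0 xi0)); last first.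
  by move=> c; exact: expeR_ge0.
have := births_laplace_le f0 xi0 HC mu0 mf mB (fun n m => let: And3 mp _ _ := psiP n m in mp)
  (fun n m => let: And3 _ p0 _ := psiP n m in p0) T0 psi_le cl.
move=> /le_trans; apply; rewrite lee_fin ler_expR -mulr_suml -/theta.
by rewrite le_eqVlt; apply/orP; left; apply/eqP; ring.
Qed.

(* The quotient by [norm_1_infty T f] is that of \bar R, with a / 0 = +oo and
   a / +oo = 0 for a > 0, and the product satisfies 0 * +oo = 0. *)
Theorem theorem2 (R : realType) (d : measure_display)
    (Omega : measurableType d) (P : probability Omega R)
    (M : nat) (hM : (0 < M)%N)
    (mu : 'I_M -> R) (mu_ge0 : forall m, (0 <= mu m)%R)
    (h : 'I_M -> 'I_M -> R -> R)
    (h_meas : forall m' m : 'I_M, measurable_fun (`[0%R, +oo[ : set R) (h m' m))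
    (h_ge0 : forall m' m t, (0 <= t)%R -> (0 <= h m' m t)%R)
    (h_fin : forall m' m, L1norm (h m' m) < +oo)
    (N : Omega -> point_config M R)
    (N_hawkes : stationary_hawkes P mu h N)
    (r K : R) (r_gt0 : (0 < r)%R) (r_lt1 : (r < 1)%R) (K_ge0 : (0 <= K)%R)
    (H_bound : forall n : nat, (1 <= n)%N ->
       (opnorm_infty (L1_matrix h ^+ n) <= K * r ^+ n)%R)
    (f : R -> R) (f_meas : measurable_fun setT f)
    (f_ge0 : forall t, (0 <= f t)%R)
    (T : R) (T_gt0 : (0 < T)%R)
    (xi : R) (xi_ge0 : (0 <= xi)%R)
    (xi_le : xi%:E <= (xi_rK r K)%:E / norm_1_infty T f) :
  \int[P]_w expeR (xi%:E * linear_stat f (N w)) <=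
  expeR ((expeR (xi%:E * norm_1_infty T f * (C_rK r K)%:E) - 1)
         * (T * \sum_(m < M) mu m)%R%:E).
Proof.
have C0 := C_rK_gt0 r_lt1 K_ge0.
have ln0 : (0 <= ln ((1 + r) / (2 * r)))%R.
  apply: ln_ge0; rewrite ler_pdivlMr ?mulr_gt0// mul1r mulr_natl mulr2n lerD2r.
  exact: ltW.
have n0 : 0 <= norm_1_infty T f.
  by have := le_norm_1_infty T 0 0%R f_ge0; rewrite big_ord0.
case E : (norm_1_infty T f) => [a||].
- have a0 : (0 <= a)%R by rewrite -lee_fin -E.
  rewrite -!EFinM /=.
  apply: (hawkes_laplace_le mu_ge0 h_meas h_ge0 h_fin N_hawkes r_gt0 r_lt1 K_ge0 H_bound) => //.
    by rewrite E.
  (* For a zero norm the threshold on [xi] is infinite, and the condition of [hawkes_laplace_le]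
     becomes [ln0]. *)
  move: xi_le; rewrite E; have [->|ane] := eqVneq a 0%R; first by rewrite mulr0 mul0r.
  rewrite inver (negbTE ane) -EFinM lee_fin /xi_rK ler_pdivlMr; last first.
    by rewrite lt_neqAle eq_sym ane.
  by rewrite ler_pdivlMl// mulrC.
(* For an infinite norm the threshold is 0; with [xi = 0] both exponents vanish and the claim is
   that [P] has mass at most 1. *)
- have -> : xi = 0%R.
    apply/eqP; rewrite eq_le xi_ge0 andbT -lee_fin.
    by move: xi_le; rewrite E invey mule0.
  under eq_integral do rewrite mul0e expeR0.
  rewrite !mul0e expeR0 subee// mul0e expeR0 integral_cst// mul1e.
  exact: probability_le1.
- by move: n0; rewrite E.
Qed.
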